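(* (1) If $A\in\mathcal C$ is a special symmetric Frobenius algebra in a pivotal finite tensor category $\mathcal C$, then the category $\mathsf{Mod}(\mathcal C)_A$ of right $A$-modules in $\mathcal C$, with left $\mathcal C$-action given by the tensor product, is a $\mathcal C$-inner-product module category (i.e. it carries the structure of one). (2) A semisimple bimodule category ${}_{\mathcal D}\mathcal M_{\mathcal C}$ over spherical fusion categories $\mathcal C,\mathcal D$ with a bimodule trace is an inner-product bimodule category (i.e. it carries the structure of one).
   Context: Basics. Let $k$ be a field; categories are $k$-linear abelian, functors linear. A right dual $x^*$ has $\mathrm{ev}_x:x^*\otimes x\to\mathbf 1$, $\mathrm{coev}_x:\mathbf 1\to x\otimes x^*$; a left dual ${}^*x$ has $\mathrm{ev}'_x:x\otimes{}^*x\to\mathbf 1$, $\mathrm{coev}'_x:\mathbf 1\to{}^*x\otimes x$ (snake identities). A finite tensor category is a $k$-linear abelian category with bilinear monoidal structure, finite-dimensional Homs, left and right duals, $\mathrm{End}(\mathbf 1)=k$, finite length, enough projectives, finitely many simples; a fusion category is a semisimple one. A pivotal structure is a monoidal natural isomorphism $a:\mathrm{id}\to(-)^{**}$; for $f:x\to x$ put $\mathrm{tr}^R(f)=\mathrm{ev}'_x(f\otimes{}^*a_x)\mathrm{coev}_x$ and $\mathrm{tr}^L(f)=\mathrm{ev}_x(a_{{}^*x}\otimes f)\mathrm{coev}'_x$; $a$ is spherical if $\mathrm{tr}^L=\mathrm{tr}^R$. Module categories are finite $k$-linear abelian categories with exact bilinear coherent action; bimodule categories, bimodule functors and bimodule natural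 transformations are defined with the usual coherences. Frobenius algebras. A Frobenius algebra $A$ is an algebra $(\mu,\eta)$ and coalgebra $(\Delta,\epsilon)$ with $\Delta\mu=(\mu\otimes1)(1\otimes\Delta)=(1\otimes\mu)(\Delta\otimes1)$. It is special if $\epsilon\eta=\beta_1$ and $\mu\Delta=\beta_A\,\mathrm{id}_A$ with $\beta_1,\beta_A\in k\setminus\{0\}$. It is symmetric if the two morphisms $A^*\to A$ given by $(\mathrm{ev}_A\otimes1_A)(1_{A^*}\otimes\Delta\eta)$ and $(1_A\otimes\mathrm{ev}'_A)(\Delta\eta\otimes{}^*a_A)$ agree, where ${}^*a_A:A^*\to{}^*A$ is the left dual of $a_A$. Inner-product (bi)module categories. For ${}_{\mathcal D}\mathcal M_{\mathcal C}$ let ${}^\#\mathcal M$, $\mathcal M^\#$ be the $(\mathcal C,\mathcal D)$-bimodule categories with underlying category $\mathcal M^{op}$ and actions $c\triangleright m\triangleleft d:=d^*\triangleright m\triangleleft c^*$, respectively $c\triangleright m\triangleleft d:={}^*d\triangleright m\triangleleft{}^*c$. The inner homs are defined by $\mathrm{Hom}_{\mathcal M}(m,d\triangleright\tilde m)\cong\mathrm{Hom}_{\mathcal D}({}_{\mathcal D}\langle m,\tilde m\rangle,d)$ and $\mathrm{Hom}_{\mathcal M}(m,\tilde m\triangleleft c)\cong\mathrm{Hom}_{\mathcal C}(\langle\tilde m,m\rangle_{\mathcal C},c)$. They are balanced bimodule functors $\mathcal M\boxtimes{}^\#\mathcal M\to\mathcal D$ and $\mathcal M^\#\boxtimes\mathcal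 M\to\mathcal C$ (bimodule functors with compatible coherent isomorphisms moving the inner action from one argument to the other). For pivotal $\mathcal C,\mathcal D$ the functors $(m,\tilde m)\mapsto({}_{\mathcal D}\langle\tilde m,m\rangle)^*$ and $(\tilde m,m)\mapsto{}^*(\langle m,\tilde m\rangle_{\mathcal C})$ are balanced bimodule functors on the same categories, using the pivotal structures. An inner-product module category over pivotal $\mathcal D$ is a module category ${}_{\mathcal D}\mathcal M$ with a bimodule natural isomorphism ${}_{\mathcal D}\langle m,\tilde m\rangle\cong({}_{\mathcal D}\langle\tilde m,m\rangle)^*$ of functors $\mathcal M\boxtimes{}^\#\mathcal M\to\mathcal D$. An inner-product bimodule category is a bimodule category with a $\mathcal C$-balanced $\mathcal D$-bimodule natural isomorphism ${}_{\mathcal D}\langle m,\tilde m\rangle\cong({}_{\mathcal D}\langle\tilde m,m\rangle)^*$ and a $\mathcal D$-balanced $\mathcal C$-bimodule natural isomorphism $\langle\tilde m,m\rangle_{\mathcal C}\cong{}^*(\langle m,\tilde m\rangle_{\mathcal C})$. Bimodule trace. For pivotal fusion categories $\mathcal C,\mathcal D$ and semisimple ${}_{\mathcal D}\mathcal M_{\mathcal C}$, a bimodule trace is a multi-balanced natural isomorphism $\eta_{\tilde m,m}:\mathrm{Hom}_{\mathcal M}(\tilde m,m)\to\mathrm{Hom}_{\mathcal M}(m,\tilde m)^*$ (vector space dual) of functors ${}^\#\mathcal M\boxtimes\mathcal M\to\mathrm{Vect}$; i.e. $\eta$ commutes with the isomorphisms $\mathrm{Hom}(d^*\triangleright\tilde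 m,m)\cong\mathrm{Hom}(\tilde m,d\triangleright m)$ and $\mathrm{Hom}(\tilde m\triangleleft c^*,m)\cong\mathrm{Hom}(\tilde m,m\triangleleft c^{**})$ given by duality, and, on the dual side, with the isomorphisms $\mathrm{Hom}(m,d^*\triangleright\tilde m)^*\cong\mathrm{Hom}(d\triangleright m,\tilde m)^*$ and $\mathrm{Hom}(m,\tilde m\triangleleft c^* )^*\cong\mathrm{Hom}(m\triangleleft c^{**},\tilde m)^*$ given by duality together with the pivotal structures. *)

(* Defs.v *)
From HB Require Import structures.
From mathcomp Require Import all_boot all_algebra.

Set Implicit Arguments.
Unset Strict Implicit.
Unset Printing Implicit Defensive.

Import GRing.Theory.
Local Open Scope ring_scope.

Declare Scope cat_scope.
Delimit Scope cat_scope with cat.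

(* Morphism spaces are finite-dimensional by construction ([vectType]): all the
   categories considered are finite tensor categories or finite linear
   categories. *)
Record lincat (k : fieldType) := Lincat {
  ob :> Type;
  hom : ob -> ob -> vectType k;
  idm : forall x, hom x x;
  comp : forall x y z, hom y z -> hom x y -> hom x z;
  compA : forall x y z w (h : hom z w) (g : hom y z) (f : hom x y),
    comp h (comp g f) = comp (comp h g) f;
  comp1m : forall x y (f : hom x y), comp (idm y) f = f;
  compm1 : forall x y (f : hom x y), comp f (idm x) = f;
  comp_linl : forall x y z (a : k) (g g' : hom y z) (f : hom x y),
    comp (a *: g + g') f = a *: comp g f + comp g' f;
  comp_linr : forall x y z (a : k) (g : hom y z) (f f' : hom x y),
    comp g (a *: f + f') = a *: comp g f + comp g f' }.

Arguments hom {k l} x y.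
Arguments idm {k l} x.
Arguments comp {k l x y z} g f.

Notation "g ∘ f" := (comp g f) (at level 50, left associativity) : cat_scope.
Local Open Scope cat_scope.

Section Abelian.
Variables (k : fieldType) (C : lincat k).
Implicit Types x y z w : C.

Definition monic x y (f : hom x y) :=
  forall w (g : hom w x), f ∘ g = 0 -> g = 0.

Definition epic x y (f : hom x y) :=
  forall w (g : hom y w), g ∘ f = 0 -> g = 0.

Definition is_inverse x y (f : hom x y) (g : hom y x) :=
  g ∘ f = idm x /\ f ∘ g = idm y.

Definition is_iso x y (f : hom x y) := exists g, is_inverse f g.

Definition isomorphic x y := exists f : hom x y, is_iso f.

Definition is_zero x := idm x = 0.

Definition is_kernel z x y (i : hom z x) (f : hom x y) :=
  f ∘ i = 0 /\
  forall w (g : hom w x), f ∘ g = 0 -> exists! h : hom w z, i ∘ h = g.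

Definition is_cokernel x y z (p : hom y z) (f : hom x y) :=
  p ∘ f = 0 /\
  forall w (g : hom y w), g ∘ f = 0 -> exists! h : hom z w, h ∘ p = g.

Definition is_direct_sum n (x : 'I_n -> C) y :=
  exists (inj : forall i, hom (x i) y) (proj : forall i, hom y (x i)),
  [/\ forall i, proj i ∘ inj i = idm (x i),
      forall i j, i != j -> proj j ∘ inj i = 0
    & \sum_i (inj i ∘ proj i) = idm y].

(* The empty direct sums are the zero objects. *)
Definition abelian : Prop :=
  [/\ forall n (x : 'I_n -> C), exists y, is_direct_sum x y,
      forall x y (f : hom x y), exists z (i : hom z x), is_kernel i f,
      forall x y (f : hom x y), exists z (p : hom y z), is_cokernel p f,
      forall x y (f : hom x y), monic f ->
        exists z (g : hom y z), is_kernel f g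
    & forall x y (f : hom x y), epic f ->
        exists z (g : hom z x), is_cokernel f g].

Definition simple x : Prop :=
  ~ is_zero x /\ forall y (f : hom y x), monic f -> f = 0 \/ is_iso f.

(* Existence of a composition series. *)
Inductive finite_length : C -> Prop :=
| finite_length0 x : is_zero x -> finite_length x
| finite_lengthS x y z (f : hom x y) (g : hom y z) :
    is_kernel f g -> is_cokernel g f -> finite_length x -> simple z ->
    finite_length y.

Definition projective p : Prop :=
  forall x y (e : hom x y) (f : hom p y), epic e -> exists g, e ∘ g = f.

Definition enough_projectives : Prop :=
  forall x, exists p (e : hom p x), projective p /\ epic e.

Definition finitely_many_simples : Prop :=
  exists n (s : 'I_n -> C), forall x, simple x -> exists i, isomorphic x (s i).

Definition finite_abelian : Prop :=
  [/\ abelian, forall x, finite_length x, enough_projectives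
    & finitely_many_simples].

Definition semisimple : Prop :=
  forall y, exists n (x : 'I_n -> C),
    (forall i, simple (x i)) /\ is_direct_sum x y.

End Abelian.

(* Exactness of the functor with object map [F] and morphism map [Fm]. *)
Definition exact (k : fieldType) (C D : lincat k) (F : C -> D)
    (Fm : forall x y : C, hom x y -> hom (F x) (F y)) : Prop :=
  (forall (x y z : C) (i : hom z x) (f : hom x y),
     is_kernel i f -> is_kernel (Fm _ _ i) (Fm _ _ f)) /\
  (forall (x y z : C) (p : hom y z) (f : hom x y),
     is_cokernel p f -> is_cokernel (Fm _ _ p) (Fm _ _ f)).

Record moncat (k : fieldType) := Moncat {
  mc_cat :> lincat k;
  one : mc_cat;
  ten : mc_cat -> mc_cat -> mc_cat;
  tenm : forall x x' y y' : mc_cat,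
    hom x x' -> hom y y' -> hom (ten x y) (ten x' y');
  tenm1 : forall x y, tenm (idm x) (idm y) = idm (ten x y);
  tenmM : forall (x x' x'' y y' y'' : mc_cat) (f' : hom x' x'') (f : hom x x')
      (g' : hom y' y'') (g : hom y y'),
    tenm (f' ∘ f) (g' ∘ g) = tenm f' g' ∘ tenm f g;
  tenm_linl : forall (x x' y y' : mc_cat) (a : k) (f f' : hom x x')
      (g : hom y y'), tenm (a *: f + f') g = a *: tenm f g + tenm f' g;
  tenm_linr : forall (x x' y y' : mc_cat) (a : k) (f : hom x x')
      (g g' : hom y y'), tenm f (a *: g + g') = a *: tenm f g + tenm f g';
  assoc : forall x y z, hom (ten (ten x y) z) (ten x (ten y z));
  assoc' : forall x y z, hom (ten x (ten y z)) (ten (ten x y) z);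
  assocK : forall x y z, is_inverse (assoc x y z) (assoc' x y z);
  assocN : forall (x x' y y' z z' : mc_cat) (f : hom x x') (g : hom y y')
      (h : hom z z'),
    assoc x' y' z' ∘ tenm (tenm f g) h = tenm f (tenm g h) ∘ assoc x y z;
  lun : forall x, hom (ten one x) x;
  lun' : forall x, hom x (ten one x);
  lunK : forall x, is_inverse (lun x) (lun' x);
  lunN : forall (x x' : mc_cat) (f : hom x x'),
    lun x' ∘ tenm (idm one) f = f ∘ lun x;
  run : forall x, hom (ten x one) x;
  run' : forall x, hom x (ten x one);
  runK : forall x, is_inverse (run x) (run' x);
  runN : forall (x x' : mc_cat) (f : hom x x'),
    run x' ∘ tenm f (idm one) = f ∘ run x;
  ten_pentagon : forall x y z w,
    assoc x y (ten z w) ∘ assoc (ten x y) z w =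
    tenm (idm x) (assoc y z w) ∘ assoc x (ten y z) w
      ∘ tenm (assoc x y z) (idm w);
  ten_triangle : forall x y,
    tenm (idm x) (lun y) ∘ assoc x one y = tenm (run x) (idm y) }.

Arguments one {k} m.
Arguments ten {k m} x y.
Arguments tenm {k m x x' y y'} f g.
Arguments assoc {k m} x y z.
Arguments assoc' {k m} x y z.
Arguments lun {k m} x.
Arguments lun' {k m} x.
Arguments run {k m} x.
Arguments run' {k m} x.

Notation "x ⊗ y" := (ten x y) (at level 40, left associativity) : cat_scope.
Notation "f ⊠ g" := (tenm f g) (at level 40, left associativity) : cat_scope.

(* [rdual x] is x^* with ev : x^* ⊗ x -> 1 and coev : 1 -> x ⊗ x^*;
   [ldual x] is ^*x with ev' : x ⊗ ^*x -> 1 and coev' : 1 -> ^*x ⊗ x. *)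
Record rigidcat (k : fieldType) := Rigidcat {
  rc_cat :> moncat k;
  rdual : rc_cat -> rc_cat;
  ev : forall x, hom (rdual x ⊗ x) (one rc_cat);
  coev : forall x, hom (one rc_cat) (x ⊗ rdual x);
  ldual : rc_cat -> rc_cat;
  ev' : forall x, hom (x ⊗ ldual x) (one rc_cat);
  coev' : forall x, hom (one rc_cat) (ldual x ⊗ x);
  rsnake1 : forall x,
    run x ∘ (idm x ⊠ ev x) ∘ assoc x (rdual x) x ∘ (coev x ⊠ idm x) ∘ lun' x
    = idm x;
  rsnake2 : forall x,
    lun (rdual x) ∘ (ev x ⊠ idm (rdual x)) ∘ assoc' (rdual x) x (rdual x)
      ∘ (idm (rdual x) ⊠ coev x) ∘ run' (rdual x)
    = idm (rdual x);
  lsnake1 : forall x,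
    lun x ∘ (ev' x ⊠ idm x) ∘ assoc' x (ldual x) x ∘ (idm x ⊠ coev' x) ∘ run' x
    = idm x;
  lsnake2 : forall x,
    run (ldual x) ∘ (idm (ldual x) ⊠ ev' x) ∘ assoc (ldual x) x (ldual x)
      ∘ (coev' x ⊠ idm (ldual x)) ∘ lun' (ldual x)
    = idm (ldual x) }.

Arguments rdual {k r} x.
Arguments ldual {k r} x.
Arguments ev {k r} x.
Arguments coev {k r} x.
Arguments ev' {k r} x.
Arguments coev' {k r} x.

Section Rigid.
Variables (k : fieldType) (C : rigidcat k).
Implicit Types x y z w : C.

(* The two bijections Hom(w ⊗ x, 1) = Hom(w, x^* ) and
   Hom(x ⊗ w, 1) = Hom(w, ^*x). *)
Definition rcurry w x (h : hom (w ⊗ x) (one C)) : hom w (rdual x) :=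
  lun (rdual x) ∘ (h ⊠ idm (rdual x)) ∘ assoc' w x (rdual x)
    ∘ (idm w ⊠ coev x) ∘ run' w.

Definition lcurry w x (h : hom (x ⊗ w) (one C)) : hom w (ldual x) :=
  run (ldual x) ∘ (idm (ldual x) ⊠ h) ∘ assoc (ldual x) x w
    ∘ (coev' x ⊠ idm w) ∘ lun' w.

Definition rdualm x y (f : hom x y) : hom (rdual y) (rdual x) :=
  rcurry (ev y ∘ (idm (rdual y) ⊠ f)).

Definition ldualm x y (f : hom x y) : hom (ldual y) (ldual x) :=
  lcurry (ev' y ∘ (f ⊠ idm (ldual y))).

Definition nest y' x' x y (p : hom (y' ⊗ y) (one C)) (q : hom (x' ⊗ x) (one C)) :
    hom ((y' ⊗ x') ⊗ (x ⊗ y)) (one C) :=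
  p ∘ (idm y' ⊠ (lun y ∘ (q ⊠ idm y) ∘ assoc' x' x y)) ∘ assoc y' x' (x ⊗ y).

(* y^* ⊗ x^* = (x ⊗ y)^* and ^*y ⊗ ^*x = ^*(x ⊗ y) *)
Definition rdual_ten x y : hom (rdual y ⊗ rdual x) (rdual (x ⊗ y)) :=
  rcurry (nest (ev y) (ev x)).

Definition ldual_ten x y : hom (ldual y ⊗ ldual x) (ldual (x ⊗ y)) :=
  lcurry (nest (ev' x) (ev' y)).

Definition rdual_one : hom (one C) (rdual (one C)) := rcurry (lun (one C)).

(* x = (^*x)^* *)
Definition rl_dual x : hom x (rdual (ldual x)) := rcurry (ev' x).

Definition finite_tensor : Prop :=
  finite_abelian C /\ bijective (fun a : k => a *: idm (one C)).

Definition fusion : Prop := finite_tensor /\ semisimple C.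

End Rigid.

(* In [piv_ten] and [piv_one] the monoidal structure
   x^** ⊗ y^** = (x ⊗ y)^** of the double dual is the composite of
   [rdual_ten y^* x^*] with the inverse of the dual of [rdual_ten x y], moved
   here to the other side of the equation; likewise for the unit. *)
Record pivcat (k : fieldType) := Pivcat {
  pc_cat :> rigidcat k;
  piv : forall x : pc_cat, hom x (rdual (rdual x));
  piv' : forall x : pc_cat, hom (rdual (rdual x)) x;
  pivK : forall x, is_inverse (piv x) (piv' x);
  pivN : forall (x y : pc_cat) (f : hom x y),
    piv y ∘ f = rdualm (rdualm f) ∘ piv x;
  piv_ten : forall x y : pc_cat,
    rdualm (rdual_ten x y) ∘ piv (x ⊗ y)
    = rdual_ten (rdual y) (rdual x) ∘ (piv x ⊠ piv y);
  piv_one : rdualm (rdual_one pc_cat) ∘ piv (one pc_cat) = rdual_one pc_cat }.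

Arguments piv {k p} x.
Arguments piv' {k p} x.

Section Pivotal.
Variables (k : fieldType) (C : pivcat k).
Implicit Types x : C.

(* ^*(a_x) : x^* = ^*(x^** ) -> ^*x *)
Definition piv_rl x : hom (rdual x) (ldual x) :=
  lcurry (ev (rdual x) ∘ (piv x ⊠ idm (rdual x))).

(* a_(^*x) : ^*x -> (^*x)^** = x^* *)
Definition piv_lr x : hom (ldual x) (rdual x) :=
  rdualm (rl_dual x) ∘ piv (ldual x).

(* ^*(a_(^*x)) : x = ^*(x^* ) -> ^**x *)
Definition piv_ll x : hom x (ldual (ldual x)) :=
  lcurry (ev x ∘ (piv_lr x ⊠ idm x)).

Definition traceR x (f : hom x x) : hom (one C) (one C) :=
  ev' x ∘ (f ⊠ piv_rl x) ∘ coev x.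

Definition traceL x (f : hom x x) : hom (one C) (one C) :=
  ev x ∘ (piv_lr x ⊠ f) ∘ coev' x.

Definition spherical : Prop :=
  forall x (f : hom x x), traceL f = traceR f.

End Pivotal.

Record laction (k : fieldType) (D : moncat k) (M : lincat k) := Laction {
  lact : D -> M -> M;
  lactm : forall (d d' : D) (m m' : M),
    hom d d' -> hom m m' -> hom (lact d m) (lact d' m');
  lactm1 : forall d m, lactm (idm d) (idm m) = idm (lact d m);
  lactmM : forall (d d' d'' : D) (m m' m'' : M) (f' : hom d' d'')
      (f : hom d d') (g' : hom m' m'') (g : hom m m'),
    lactm (f' ∘ f) (g' ∘ g) = lactm f' g' ∘ lactm f g;
  lactm_linl : forall (d d' : D) (m m' : M) (a : k) (f f' : hom d d')
      (g : hom m m'), lactm (a *: f + f') g = a *: lactm f g + lactm f' g;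
  lactm_linr : forall (d d' : D) (m m' : M) (a : k) (f : hom d d')
      (g g' : hom m m'), lactm f (a *: g + g') = a *: lactm f g + lactm f g';
  lassoc : forall d d' m, hom (lact (d ⊗ d') m) (lact d (lact d' m));
  lassoc' : forall d d' m, hom (lact d (lact d' m)) (lact (d ⊗ d') m);
  lassocK : forall d d' m, is_inverse (lassoc d d' m) (lassoc' d d' m);
  lassocN : forall (c c' d d' : D) (m m' : M) (f : hom c c') (g : hom d d')
      (h : hom m m'),
    lassoc c' d' m' ∘ lactm (f ⊠ g) h = lactm f (lactm g h) ∘ lassoc c d m;
  lunit : forall m, hom (lact (one D) m) m;
  lunit' : forall m, hom m (lact (one D) m);
  lunitK : forall m, is_inverse (lunit m) (lunit' m);
  lunitN : forall (m m' : M) (f : hom m m'),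
    lunit m' ∘ lactm (idm (one D)) f = f ∘ lunit m;
  lact_pentagon : forall b c d m,
    lassoc b c (lact d m) ∘ lassoc (b ⊗ c) d m =
    lactm (idm b) (lassoc c d m) ∘ lassoc b (c ⊗ d) m
      ∘ lactm (assoc b c d) (idm m);
  lact_triangle : forall d m,
    lactm (idm d) (lunit m) ∘ lassoc d (one D) m = lactm (run d) (idm m) }.

Record raction (k : fieldType) (C : moncat k) (M : lincat k) := Raction {
  ract : M -> C -> M;
  ractm : forall (m m' : M) (c c' : C),
    hom m m' -> hom c c' -> hom (ract m c) (ract m' c');
  ractm1 : forall m c, ractm (idm m) (idm c) = idm (ract m c);
  ractmM : forall (m m' m'' : M) (c c' c'' : C) (f' : hom m' m'')
      (f : hom m m') (g' : hom c' c'') (g : hom c c'),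
    ractm (f' ∘ f) (g' ∘ g) = ractm f' g' ∘ ractm f g;
  ractm_linl : forall (m m' : M) (c c' : C) (a : k) (f f' : hom m m')
      (g : hom c c'), ractm (a *: f + f') g = a *: ractm f g + ractm f' g;
  ractm_linr : forall (m m' : M) (c c' : C) (a : k) (f : hom m m')
      (g g' : hom c c'), ractm f (a *: g + g') = a *: ractm f g + ractm f g';
  rassoc : forall m c c', hom (ract (ract m c) c') (ract m (c ⊗ c'));
  rassoc' : forall m c c', hom (ract m (c ⊗ c')) (ract (ract m c) c');
  rassocK : forall m c c', is_inverse (rassoc m c c') (rassoc' m c c');
  rassocN : forall (m m' : M) (c c' d d' : C) (f : hom m m') (g : hom c c')
      (h : hom d d'),
    rassoc m' c' d' ∘ ractm (ractm f g) h = ractm f (g ⊠ h) ∘ rassoc m c d;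
  runit : forall m, hom (ract m (one C)) m;
  runit' : forall m, hom m (ract m (one C));
  runitK : forall m, is_inverse (runit m) (runit' m);
  runitN : forall (m m' : M) (f : hom m m'),
    runit m' ∘ ractm f (idm (one C)) = f ∘ runit m;
  ract_pentagon : forall m b c d,
    rassoc m b (c ⊗ d) ∘ rassoc (ract m b) c d =
    ractm (idm m) (assoc b c d) ∘ rassoc m (b ⊗ c) d
      ∘ ractm (rassoc m b c) (idm d);
  ract_triangle : forall m c,
    ractm (idm m) (lun c) ∘ rassoc m (one C) c = ractm (runit m) (idm c) }.

Arguments lact {k D M} L d m : rename.
Arguments lactm {k D M} L {d d' m m'} f g : rename.
Arguments lassoc {k D M} L d d' m : rename.
Arguments lassoc' {k D M} L d d' m : rename.
Arguments lunit {k D M} L m : rename.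
Arguments lunit' {k D M} L m : rename.
Arguments ract {k C M} R m c : rename.
Arguments ractm {k C M} R {m m' c c'} f g : rename.
Arguments rassoc {k C M} R m c c' : rename.
Arguments rassoc' {k C M} R m c c' : rename.
Arguments runit {k C M} R m : rename.
Arguments runit' {k C M} R m : rename.

Definition lact_exact (k : fieldType) (D : moncat k) (M : lincat k)
    (L : laction D M) : Prop :=
  (forall m : M, exact (F := fun d => lact L d m)
     (fun d d' f => lactm L f (idm m))) /\
  (forall d : D, exact (F := fun m => lact L d m)
     (fun m m' f => lactm L (idm d) f)).

Definition ract_exact (k : fieldType) (C : moncat k) (M : lincat k)
    (R : raction C M) : Prop :=
  (forall m : M, exact (F := fun c => ract R m c)
     (fun c c' f => ractm R (idm m) f)) /\
  (forall c : C, exact (F := fun m => ract R m c)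
     (fun m m' f => ractm R f (idm c))).

Definition module_category (k : fieldType) (D : moncat k) (M : lincat k)
    (L : laction D M) : Prop :=
  finite_abelian M /\ lact_exact L.

Record biaction (k : fieldType) (D C : moncat k) (M : lincat k) := Biaction {
  ba_l : laction D M;
  ba_r : raction C M;
  bassoc : forall d m c,
    hom (ract ba_r (lact ba_l d m) c) (lact ba_l d (ract ba_r m c));
  bassoc' : forall d m c,
    hom (lact ba_l d (ract ba_r m c)) (ract ba_r (lact ba_l d m) c);
  bassocK : forall d m c, is_inverse (bassoc d m c) (bassoc' d m c);
  bassocN : forall (d d' : D) (m m' : M) (c c' : C) (f : hom d d')
      (g : hom m m') (h : hom c c'),
    bassoc d' m' c' ∘ ractm ba_r (lactm ba_l f g) h
    = lactm ba_l f (ractm ba_r g h) ∘ bassoc d m c;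
  bact_pentagonl : forall d d' m c,
    lassoc ba_l d d' (ract ba_r m c) ∘ bassoc (d ⊗ d') m c
    = lactm ba_l (idm d) (bassoc d' m c) ∘ bassoc d (lact ba_l d' m) c
        ∘ ractm ba_r (lassoc ba_l d d' m) (idm c);
  bact_pentagonr : forall d m c c',
    bassoc d m (c ⊗ c') ∘ rassoc ba_r (lact ba_l d m) c c'
    = lactm ba_l (idm d) (rassoc ba_r m c c') ∘ bassoc d (ract ba_r m c) c'
        ∘ ractm ba_r (bassoc d m c) (idm c');
  bact_trianglel : forall m c,
    lunit ba_l (ract ba_r m c) ∘ bassoc (one D) m c
    = ractm ba_r (lunit ba_l m) (idm c);
  bact_triangler : forall d m,
    lactm ba_l (idm d) (runit ba_r m) ∘ bassoc d m (one C)
    = runit ba_r (lact ba_l d m) }.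

Arguments bassoc {k D C M} B d m c : rename.
Arguments bassoc' {k D C M} B d m c : rename.

Definition bimodule_category (k : fieldType) (D C : moncat k) (M : lincat k)
    (B : biaction D C M) : Prop :=
  [/\ finite_abelian M, lact_exact (ba_l B) & ract_exact (ba_r B)].

(* Functors on the Deligne product of M and #M are functors M x M^op -> D, where
   #M is M^op with the actions m ◁ d := d^* ▷ m and c ▷ m := m ◁ c^*. A pairing
   carries the structure isomorphisms d ⊗ P(m,n) -> P(d ▷ m,n) and
   P(m,n) ⊗ d -> P(m,n ◁ d) of a D-bimodule functor, and a balancing
   P(m ◁ c,n) -> P(m,c ▷ n) if C acts. Only these data, not their coherence,
   enter in the definition of (balanced) bimodule natural isomorphisms. *)

Section LeftInner.
Variables (k : fieldType) (D : pivcat k) (M : lincat k) (L : laction D M).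
Local Notation "d ▷ m" := (lact L d m) (at level 38, right associativity).
Local Notation "f ▶ g" := (lactm L f g) (at level 38, right associativity).
Implicit Types (d : D) (m n : M).

Record lpairing := Lpairing {
  lpr :> M -> M -> D;
  lprm : forall m m' n n', hom m m' -> hom n' n -> hom (lpr m n) (lpr m' n');
  lpr_left : forall d m n, hom (d ⊗ lpr m n) (lpr (d ▷ m) n);
  lpr_right : forall m n d, hom (lpr m n ⊗ d) (lpr m (rdual d ▷ n)) }.

Record lpairing_iso (P P' : lpairing) := LpairingIso {
  lpi :> forall m n, hom (P m n) (P' m n);
  lpi_iso : forall m n, is_iso (lpi m n);
  lpi_nat : forall m m' n n' (f : hom m m') (g : hom n' n),
    lpi m' n' ∘ lprm P f g = lprm P' f g ∘ lpi m n;
  lpi_left : forall d m n,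
    lpi (d ▷ m) n ∘ lpr_left P d m n
    = lpr_left P' d m n ∘ (idm d ⊠ lpi m n);
  lpi_right : forall m n d,
    lpi m (rdual d ▷ n) ∘ lpr_right P m n d
    = lpr_right P' m n d ∘ (lpi m n ⊠ idm d) }.

(* Inner homs: Hom_M(m, d ▷ n) = Hom_D(⟨m,n⟩, d), natural in d. Naturality in m
   and n is the definition of [linn_map]; linearity follows by the Yoneda
   lemma. *)
Record linner := Linner {
  linn : M -> M -> D;
  lflat : forall m n d, hom m (d ▷ n) -> hom (linn m n) d;
  lsharp : forall m n d, hom (linn m n) d -> hom m (d ▷ n);
  lflatK : forall m n d, cancel (@lflat m n d) (@lsharp m n d);
  lsharpK : forall m n d, cancel (@lsharp m n d) (@lflat m n d);
  lflatN : forall m n d d' (u : hom d d') (f : hom m (d ▷ n)),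
    lflat ((u ▶ idm n) ∘ f) = u ∘ lflat f }.

Arguments lflat l {m n d} f.
Arguments lsharp l {m n d} f.

Variable H : linner.
Local Notation "⟨ m , n ⟩" := (linn H m n).

Definition lun_inn m n : hom m (⟨m, n⟩ ▷ n) := lsharp H (idm ⟨m, n⟩).

Definition linn_map m m' n n' (f : hom m m') (g : hom n' n) :
    hom ⟨m, n⟩ ⟨m', n'⟩ :=
  lflat H ((idm ⟨m', n'⟩ ▶ g) ∘ lun_inn m' n' ∘ f).

Definition lcreate m d : hom m (ldual d ▷ d ▷ m) :=
  lassoc L (ldual d) d m ∘ (coev' d ▶ idm m) ∘ lunit' L m.

(* d ⊗ ⟨m,n⟩ -> ⟨d ▷ m,n⟩ is the transpose of a morphism
   ⟨m,n⟩ -> ^*d ⊗ ⟨d ▷ m,n⟩. *)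
Definition linn_left d m n : hom (d ⊗ ⟨m, n⟩) ⟨d ▷ m, n⟩ :=
  lun ⟨d ▷ m, n⟩ ∘ (ev' d ⊠ idm ⟨d ▷ m, n⟩) ∘ assoc' d (ldual d) ⟨d ▷ m, n⟩
    ∘ (idm d ⊠ lflat H (lassoc' L (ldual d) ⟨d ▷ m, n⟩ n
                        ∘ (idm (ldual d) ▶ lun_inn (d ▷ m) n) ∘ lcreate m d)).

(* The inverse of [linn_left]. *)
Definition linn_left' d m n : hom ⟨d ▷ m, n⟩ (d ⊗ ⟨m, n⟩) :=
  lflat H (lassoc' L d ⟨m, n⟩ n ∘ (idm d ▶ lun_inn m n)).

(* ⟨m,n⟩ ⊗ d -> ⟨m,d^* ▷ n⟩ is the transpose of a morphism
   ⟨m,n⟩ -> ⟨m,d^* ▷ n⟩ ⊗ d^*. *)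
Definition linn_right m n d : hom (⟨m, n⟩ ⊗ d) ⟨m, rdual d ▷ n⟩ :=
  run ⟨m, rdual d ▷ n⟩ ∘ (idm ⟨m, rdual d ▷ n⟩ ⊠ ev d)
    ∘ assoc ⟨m, rdual d ▷ n⟩ (rdual d) d
    ∘ (lflat H (lassoc' L ⟨m, rdual d ▷ n⟩ (rdual d) n ∘ lun_inn m (rdual d ▷ n))
         ⊠ idm d).

(* ⟨n,d ▷ m⟩ -> ⟨n,m⟩ ⊗ ^*d *)
Definition linn_right' n m d : hom ⟨n, d ▷ m⟩ (⟨n, m⟩ ⊗ ldual d) :=
  lflat H (lassoc' L ⟨n, m⟩ (ldual d) (d ▷ m) ∘ (idm ⟨n, m⟩ ▶ lcreate m d)
           ∘ lun_inn n m).

Definition linn_pairing : lpairing :=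
  Lpairing linn_map linn_left linn_right.

(* d ⊗ ⟨n,m⟩^* = (⟨n,m⟩ ⊗ ^*d)^* -> ⟨n,d ▷ m⟩^* *)
Definition linn_dual_left d m n :
    hom (d ⊗ rdual ⟨n, m⟩) (rdual ⟨n, d ▷ m⟩) :=
  rdualm (linn_right' n m d) ∘ rcurry (nest (ev' d) (ev ⟨n, m⟩)).

(* ⟨n,m⟩^* ⊗ d -> ⟨n,m⟩^* ⊗ d^** = (d^* ⊗ ⟨n,m⟩)^* -> ⟨d^* ▷ n,m⟩^* *)
Definition linn_dual_right m n d :
    hom (rdual ⟨n, m⟩ ⊗ d) (rdual ⟨rdual d ▷ n, m⟩) :=
  rdualm (linn_left' (rdual d) n m) ∘ rdual_ten (rdual d) ⟨n, m⟩
    ∘ (idm (rdual ⟨n, m⟩) ⊠ piv d).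

(* (m,n) |-> ⟨n,m⟩^* *)
Definition linn_dual_pairing : lpairing :=
  @Lpairing (fun m n => rdual ⟨n, m⟩)
    (fun m m' n n' f g => rdualm (linn_map g f))
    linn_dual_left linn_dual_right.

End LeftInner.

Arguments lflat {k D M L} H {m n d} f : rename.
Arguments lsharp {k D M L} H {m n d} f : rename.

Record inner_product (k : fieldType) (D : pivcat k) (M : lincat k)
    (L : laction D M) := InnerProduct {
  ip_inner : linner L;
  ip_iso : lpairing_iso (linn_pairing ip_inner) (linn_dual_pairing ip_inner) }.

Definition inner_product_module_category (k : fieldType) (D : pivcat k)
    (M : lincat k) (L : laction D M) : Prop :=
  module_category L /\ inhabited (inner_product L).

(* Functors on the Deligne product of M^# and M are functors M^op x M -> C, where
   M^# is M^op with the actions c ▷ n := n ◁ ^*c and n ◁ d := ^*d ▷ n. *)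

Section RightInner.
Variables (k : fieldType) (C : pivcat k) (M : lincat k) (R : raction C M).
Local Notation "m ◁ c" := (ract R m c) (at level 40, left associativity).
Local Notation "f ◀ g" := (ractm R f g) (at level 40, left associativity).
Implicit Types (c : C) (m n : M).

Record rpairing := Rpairing {
  rpr :> M -> M -> C;
  rprm : forall n n' m m', hom n' n -> hom m m' -> hom (rpr n m) (rpr n' m');
  rpr_left : forall c n m, hom (c ⊗ rpr n m) (rpr (n ◁ ldual c) m);
  rpr_right : forall n m c, hom (rpr n m ⊗ c) (rpr n (m ◁ c)) }.

Record rpairing_iso (Q Q' : rpairing) := RpairingIso {
  rpi :> forall n m, hom (Q n m) (Q' n m);
  rpi_iso : forall n m, is_iso (rpi n m);
  rpi_nat : forall n n' m m' (g : hom n' n) (f : hom m m'),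
    rpi n' m' ∘ rprm Q g f = rprm Q' g f ∘ rpi n m;
  rpi_left : forall c n m,
    rpi (n ◁ ldual c) m ∘ rpr_left Q c n m
    = rpr_left Q' c n m ∘ (idm c ⊠ rpi n m);
  rpi_right : forall n m c,
    rpi n (m ◁ c) ∘ rpr_right Q n m c
    = rpr_right Q' n m c ∘ (rpi n m ⊠ idm c) }.

(* Hom_M(m, n ◁ c) = Hom_C(⟨n,m⟩, c), natural in c. *)
Record rinner := Rinner {
  rinn : M -> M -> C;
  rflat : forall n m c, hom m (n ◁ c) -> hom (rinn n m) c;
  rsharp : forall n m c, hom (rinn n m) c -> hom m (n ◁ c);
  rflatK : forall n m c, cancel (@rflat n m c) (@rsharp n m c);
  rsharpK : forall n m c, cancel (@rsharp n m c) (@rflat n m c);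
  rflatN : forall n m c c' (u : hom c c') (f : hom m (n ◁ c)),
    rflat ((idm n ◀ u) ∘ f) = u ∘ rflat f }.

Arguments rflat r {n m c} f.
Arguments rsharp r {n m c} f.

Variable H : rinner.
Local Notation "⟨ n , m ⟩" := (rinn H n m).

Definition run_inn n m : hom m (n ◁ ⟨n, m⟩) := rsharp H (idm ⟨n, m⟩).

Definition rinn_map n n' m m' (g : hom n' n) (f : hom m m') :
    hom ⟨n, m⟩ ⟨n', m'⟩ :=
  rflat H ((g ◀ idm ⟨n', m'⟩) ∘ run_inn n' m' ∘ f).

Definition rcreate m c : hom m (m ◁ c ◁ rdual c) :=
  rassoc' R m c (rdual c) ∘ (idm m ◀ coev c) ∘ runit' R m.

(* c ⊗ ⟨n,m⟩ -> ⟨n ◁ ^*c,m⟩ is the transpose of a morphism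
   ⟨n,m⟩ -> ^*c ⊗ ⟨n ◁ ^*c,m⟩. *)
Definition rinn_left c n m : hom (c ⊗ ⟨n, m⟩) ⟨n ◁ ldual c, m⟩ :=
  lun ⟨n ◁ ldual c, m⟩ ∘ (ev' c ⊠ idm ⟨n ◁ ldual c, m⟩)
    ∘ assoc' c (ldual c) ⟨n ◁ ldual c, m⟩
    ∘ (idm c ⊠ rflat H (rassoc R n (ldual c) ⟨n ◁ ldual c, m⟩
                        ∘ run_inn (n ◁ ldual c) m)).

(* ⟨m ◁ c,n⟩ -> c^* ⊗ ⟨m,n⟩ *)
Definition rinn_left' m c n : hom ⟨m ◁ c, n⟩ (rdual c ⊗ ⟨m, n⟩) :=
  rflat H (rassoc R (m ◁ c) (rdual c) ⟨m, n⟩ ∘ (rcreate m c ◀ idm ⟨m, n⟩)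
           ∘ run_inn m n).

(* ⟨n,m⟩ ⊗ c -> ⟨n,m ◁ c⟩ is the transpose of a morphism
   ⟨n,m⟩ -> ⟨n,m ◁ c⟩ ⊗ c^*. *)
Definition rinn_right n m c : hom (⟨n, m⟩ ⊗ c) ⟨n, m ◁ c⟩ :=
  run ⟨n, m ◁ c⟩ ∘ (idm ⟨n, m ◁ c⟩ ⊠ ev c) ∘ assoc ⟨n, m ◁ c⟩ (rdual c) c
    ∘ (rflat H (rassoc R n ⟨n, m ◁ c⟩ (rdual c)
                ∘ (run_inn n (m ◁ c) ◀ idm (rdual c)) ∘ rcreate m c)
         ⊠ idm c).

(* The inverse of [rinn_right]. *)
Definition rinn_right' n m c : hom ⟨n, m ◁ c⟩ (⟨n, m⟩ ⊗ c) :=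
  rflat H (rassoc R n ⟨n, m⟩ c ∘ (run_inn n m ◀ idm c)).

Definition rinn_pairing : rpairing :=
  Rpairing rinn_map rinn_left rinn_right.

(* c ⊗ ^*⟨m,n⟩ -> ^**c ⊗ ^*⟨m,n⟩ = ^*(⟨m,n⟩ ⊗ ^*c) -> ^*⟨m,n ◁ ^*c⟩ *)
Definition rinn_dual_left c n m :
    hom (c ⊗ ldual ⟨m, n⟩) (ldual ⟨m, n ◁ ldual c⟩) :=
  ldualm (rinn_right' m n (ldual c)) ∘ ldual_ten ⟨m, n⟩ (ldual c)
    ∘ (piv_ll c ⊠ idm (ldual ⟨m, n⟩)).

(* ^*⟨m,n⟩ ⊗ c = ^*(c^* ⊗ ⟨m,n⟩) -> ^*⟨m ◁ c,n⟩ *)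
Definition rinn_dual_right n m c :
    hom (ldual ⟨m, n⟩ ⊗ c) (ldual ⟨m ◁ c, n⟩) :=
  ldualm (rinn_left' m c n) ∘ lcurry (nest (ev c) (ev' ⟨m, n⟩)).

(* (n,m) |-> ^*⟨m,n⟩ *)
Definition rinn_dual_pairing : rpairing :=
  @Rpairing (fun n m => ldual ⟨m, n⟩)
    (fun n n' m m' g f => ldualm (rinn_map f g))
    rinn_dual_left rinn_dual_right.

End RightInner.

Arguments rflat {k C M R} H {n m c} f : rename.
Arguments rsharp {k C M R} H {n m c} f : rename.

Section Balanced.
Variables (k : fieldType) (D C : pivcat k) (M : lincat k) (B : biaction D C M).
Local Notation L := (ba_l B).
Local Notation R := (ba_r B).
Local Notation "d ▷ m" := (lact L d m) (at level 38, right associativity).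
Local Notation "f ▶ g" := (lactm L f g) (at level 38, right associativity).
Local Notation "m ◁ c" := (ract R m c) (at level 40, left associativity).
Local Notation "f ◀ g" := (ractm R f g) (at level 40, left associativity).
Implicit Types (d : D) (c : C) (m n : M).

Definition lbalancing (P : lpairing L) :=
  forall m c n, hom (P (m ◁ c) n) (P m (n ◁ rdual c)).

Definition rbalancing (Q : rpairing R) :=
  forall n d m, hom (Q n (d ▷ m)) (Q (ldual d ▷ n) m).

Definition lbalanced P P' (b : lbalancing P) (b' : lbalancing P')
    (e : lpairing_iso P P') : Prop :=
  forall m c n, e m (n ◁ rdual c) ∘ b m c n = b' m c n ∘ e (m ◁ c) n.

Definition rbalanced Q Q' (b : rbalancing Q) (b' : rbalancing Q')
    (e : rpairing_iso Q Q') : Prop :=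
  forall n d m, e (ldual d ▷ n) m ∘ b n d m = b' n d m ∘ e n (d ▷ m).

(* (n ◁ c^* ) ◁ c -> n *)
Definition rannihil n c : hom (n ◁ rdual c ◁ c) n :=
  runit R n ∘ (idm n ◀ ev c) ∘ rassoc R n (rdual c) c.

(* d ▷ (^*d ▷ n) -> n *)
Definition lannihil d n : hom (d ▷ ldual d ▷ n) n :=
  lunit L n ∘ (ev' d ▶ idm n) ∘ lassoc' L d (ldual d) n.

Definition linn_balance (H : linner L) : lbalancing (linn_pairing H) :=
  fun m c n => let X := linn H m (n ◁ rdual c) in
    lflat H ((idm X ▶ rannihil n c) ∘ bassoc B X (n ◁ rdual c) c
             ∘ (lun_inn H m (n ◁ rdual c) ◀ idm c)).

(* dual of ⟨n ◁ c^*,m⟩ -> ⟨n,m ◁ c^**⟩ -> ⟨n,m ◁ c⟩ *)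
Definition linn_dual_balance (H : linner L) :
    lbalancing (linn_dual_pairing H) :=
  fun m c n =>
    rdualm (linn_map H (idm n) (idm m ◀ piv c) ∘ linn_balance H n (rdual c) m).

Definition rinn_balance (H : rinner R) : rbalancing (rinn_pairing H) :=
  fun n d m => let X := rinn H (ldual d ▷ n) m in
    rflat H ((lannihil d n ◀ idm X) ∘ bassoc' B d (ldual d ▷ n) X
             ∘ (idm d ▶ run_inn H (ldual d ▷ n) m)).

(* dual of ⟨m,^*d ▷ n⟩ -> ⟨^**d ▷ m,n⟩ -> ⟨d ▷ m,n⟩ *)
Definition rinn_dual_balance (H : rinner R) :
    rbalancing (rinn_dual_pairing H) :=
  fun n d m =>
    ldualm (rinn_map H (piv_ll d ▶ idm m) (idm n) ∘ rinn_balance H m (ldual d) n).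

Record inner_product_bi := InnerProductBi {
  ipl_inner : linner L;
  ipl_iso : lpairing_iso (linn_pairing ipl_inner) (linn_dual_pairing ipl_inner);
  ipl_bal : lbalanced (linn_balance ipl_inner) (linn_dual_balance ipl_inner)
              ipl_iso;
  ipr_inner : rinner R;
  ipr_iso : rpairing_iso (rinn_pairing ipr_inner) (rinn_dual_pairing ipr_inner);
  ipr_bal : rbalanced (rinn_balance ipr_inner) (rinn_dual_balance ipr_inner)
              ipr_iso }.

Definition inner_product_bimodule_category : Prop :=
  bimodule_category B /\ inhabited inner_product_bi.

Definition vdual (V : vectType k) : vectType k := 'Hom(V, k^o).

(* Hom(d^* ▷ n, m) = Hom(n, d ▷ m) *)
Definition lmate d n m (f : hom (rdual d ▷ n) m) : hom n (d ▷ m) :=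
  (idm d ▶ f) ∘ lassoc L d (rdual d) n ∘ (coev d ▶ idm n) ∘ lunit' L n.

(* Hom(m, d^* ▷ n) = Hom(d^** ▷ m, n) = Hom(d ▷ m, n) *)
Definition lmate_piv d n m (g : hom m (rdual d ▷ n)) : hom (d ▷ m) n :=
  lunit L n ∘ (ev (rdual d) ▶ idm n) ∘ lassoc' L (rdual (rdual d)) (rdual d) n
    ∘ (piv d ▶ g).

(* Hom(n ◁ c^*, m) = Hom(n, m ◁ c^** ) *)
Definition rmate c n m (f : hom (n ◁ rdual c) m) :
    hom n (m ◁ rdual (rdual c)) :=
  (f ◀ idm (rdual (rdual c))) ∘ rcreate R n (rdual c).

(* Hom(m, n ◁ c^* ) = Hom(m ◁ c, n) = Hom(m ◁ c^**, n) *)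
Definition rmate_piv c n m (g : hom m (n ◁ rdual c)) :
    hom (m ◁ rdual (rdual c)) n :=
  rannihil n c ∘ (g ◀ piv' c).

Record bimodule_trace := BimoduleTrace {
  btr : forall n m, 'Hom(hom n m, vdual (hom m n));
  btr_bij : forall n m, bijective (btr n m);
  btr_nat : forall n n' m m' (u : hom n' n) (v : hom m m') (f : hom n m)
      (g : hom m' n'),
    btr n' m' (v ∘ f ∘ u) g = btr n m f (u ∘ g ∘ v);
  btr_left : forall d n m (f : hom (rdual d ▷ n) m) (g : hom m (rdual d ▷ n)),
    btr n (d ▷ m) (lmate f) (lmate_piv g) = btr (rdual d ▷ n) m f g;
  btr_right : forall c n m (f : hom (n ◁ rdual c) m) (g : hom m (n ◁ rdual c)),
    btr n (m ◁ rdual (rdual c)) (rmate f) (rmate_piv g)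
    = btr (n ◁ rdual c) m f g }.

End Balanced.

Record frobalg (k : fieldType) (C : moncat k) := Frobalg {
  fa_ob :> C;
  mul : hom (fa_ob ⊗ fa_ob) fa_ob;
  eta : hom (one C) fa_ob;
  com : hom fa_ob (fa_ob ⊗ fa_ob);
  eps : hom fa_ob (one C);
  mul_assoc : mul ∘ (mul ⊠ idm fa_ob)
    = mul ∘ (idm fa_ob ⊠ mul) ∘ assoc fa_ob fa_ob fa_ob;
  mul_etal : mul ∘ (eta ⊠ idm fa_ob) = lun fa_ob;
  mul_etar : mul ∘ (idm fa_ob ⊠ eta) = run fa_ob;
  com_assoc : assoc fa_ob fa_ob fa_ob ∘ (com ⊠ idm fa_ob) ∘ com
    = (idm fa_ob ⊠ com) ∘ com;
  com_epsl : lun fa_ob ∘ (eps ⊠ idm fa_ob) ∘ com = idm fa_ob;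
  com_epsr : run fa_ob ∘ (idm fa_ob ⊠ eps) ∘ com = idm fa_ob;
  frobl : com ∘ mul
    = (mul ⊠ idm fa_ob) ∘ assoc' fa_ob fa_ob fa_ob ∘ (idm fa_ob ⊠ com);
  frobr : com ∘ mul
    = (idm fa_ob ⊠ mul) ∘ assoc fa_ob fa_ob fa_ob ∘ (com ⊠ idm fa_ob) }.

Arguments mul {k C} A : rename.
Arguments eta {k C} A : rename.
Arguments com {k C} A : rename.
Arguments eps {k C} A : rename.

Definition frob_special (k : fieldType) (C : moncat k) (A : frobalg C) : Prop :=
  exists beta1 betaA : k,
  [/\ beta1 != 0, betaA != 0, eps A ∘ eta A = beta1 *: idm (one C)
    & mul A ∘ com A = betaA *: idm (fa_ob A)].

Definition frob_symmetric (k : fieldType) (C : pivcat k) (A : frobalg C) :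
    Prop :=
  lun A ∘ (ev A ⊠ idm (fa_ob A)) ∘ assoc' (rdual A) A A
    ∘ (idm (rdual A) ⊠ (com A ∘ eta A)) ∘ run' (rdual A)
  = run A ∘ (idm (fa_ob A) ⊠ ev' A) ∘ assoc A A (ldual A)
    ∘ ((com A ∘ eta A) ⊠ piv_rl A) ∘ lun' (rdual A).

Section MonoidalLemmas.
Variables (k : fieldType) (C : moncat k).
Implicit Types x y z w : C.

Lemma comp_isoI x y z (f : hom x y) (g h : hom y z) :
  is_iso f -> g ∘ f = h ∘ f -> g = h.
Proof.
move=> [f' [_ ff']] E; rewrite -[g]compm1 -[h]compm1 -ff'.
by rewrite !compA E.
Qed.

Lemma tenm_one_inj x y (f g : hom x y) :
  idm (one C) ⊠ f = idm (one C) ⊠ g -> f = g.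
Proof.
move=> E; apply: (@comp_isoI _ _ _ (lun x)); first by exists (lun' x); apply: lunK.
by rewrite -!lunN E.
Qed.

Lemma tenm_oner_inj x y (f g : hom x y) :
  f ⊠ idm (one C) = g ⊠ idm (one C) -> f = g.
Proof.
move=> E; apply: (@comp_isoI _ _ _ (run x)); first by exists (run' x); apply: runK.
by rewrite -!runN E.
Qed.

Lemma tenm_is_iso x x' y y' (f : hom x x') (g : hom y y') :
  is_iso f -> is_iso g -> is_iso (f ⊠ g).
Proof.
move=> [f' [f1 f2]] [g' [g1 g2]]; exists (f' ⊠ g').
by split; rewrite -tenmM ?f1 ?f2 ?g1 ?g2 tenm1.
Qed.

Lemma assoc_is_iso x y z : is_iso (assoc x y z).
Proof. by exists (assoc' x y z); apply: assocK. Qed.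

Lemma idm_is_iso x : is_iso (idm x).
Proof. by exists (idm x); split; rewrite comp1m. Qed.

Lemma tenm_idl w x y z (g : hom y z) (f : hom x y) :
  idm w ⊠ (g ∘ f) = (idm w ⊠ g) ∘ (idm w ⊠ f).
Proof. by rewrite -tenmM comp1m. Qed.

Lemma tenm_idr w x y z (g : hom y z) (f : hom x y) :
  (g ∘ f) ⊠ idm w = (g ⊠ idm w) ∘ (f ⊠ idm w).
Proof. by rewrite -tenmM comp1m. Qed.

Lemma lun_ten x y : lun (x ⊗ y) ∘ assoc (one C) x y = lun x ⊠ idm y.
Proof.
apply: tenm_one_inj; rewrite tenm_idl.
apply: (comp_isoI (assoc_is_iso _ _ _)).
apply: (comp_isoI (tenm_is_iso (assoc_is_iso (one C) (one C) x) (idm_is_iso y))).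
rewrite -!compA [(idm _ ⊠ assoc _ _ _) ∘ _]compA -ten_pentagon.
rewrite compA ten_triangle -tenm1 -assocN [RHS]compA -assocN -compA.
by rewrite -tenm_idr ten_triangle.
Qed.

Lemma run_ten x y : (idm x ⊠ run y) ∘ assoc x y (one C) = run (x ⊗ y).
Proof.
apply: tenm_oner_inj; rewrite tenm_idr -ten_triangle.
have [a' [a1 _]] := assoc_is_iso x y (one C).
suff E : assoc x y (one C) ∘ (((idm x ⊠ run y) ⊠ idm (one C))
      ∘ (assoc x y (one C) ⊠ idm (one C)))
    = assoc x y (one C) ∘ ((idm (x ⊗ y) ⊠ lun (one C))
      ∘ assoc (x ⊗ y) (one C) (one C)).
  by rewrite -[LHS]comp1m -[RHS]comp1m -a1 -!compA E.
rewrite compA assocN -compA [RHS]compA -tenm1 assocN -[RHS]compA.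
rewrite ten_pentagon !compA -tenm_idl.
by rewrite ten_triangle.
Qed.

End MonoidalLemmas.

Section Modules.
Variables (k : fieldType) (C : moncat k) (A : frobalg C).
Record rmodule := Rmodule {
  rm_ob :> C;
  rm_act : hom (rm_ob ⊗ A) rm_ob;
  rm_mul : rm_act ∘ (rm_act ⊠ idm (fa_ob A))
    = rm_act ∘ (idm rm_ob ⊠ mul A) ∘ assoc rm_ob A A;
  rm_eta : rm_act ∘ (idm rm_ob ⊠ eta A) = run rm_ob }.

Implicit Types m n p : rmodule.

(* Module morphisms are the f with [rm_defect f] = 0, cf. [rmhomP]. *)
Definition rm_defect m n (f : hom (rm_ob m) (rm_ob n)) : hom (m ⊗ A) n :=
  (f ∘ rm_act m) - (rm_act n ∘ (f ⊠ idm (fa_ob A))).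

Fact rm_defect_linear m n : linear (@rm_defect m n).
Proof.
move=> a f g; rewrite /rm_defect comp_linl tenm_linl comp_linr.
by rewrite scalerBr opprD addrACA.
Qed.

HB.instance Definition _ m n :=
  GRing.isLinear.Build k _ _ _ (@rm_defect m n) (@rm_defect_linear m n).

Definition rmhom m n : vectType k :=
  subvs_of (lker (linfun (@rm_defect m n))).

Definition is_rmhom m n (f : hom (rm_ob m) (rm_ob n)) : Prop :=
  f ∘ rm_act m = rm_act n ∘ (f ⊠ idm (fa_ob A)).

Lemma rmhomP m n (f : hom (rm_ob m) (rm_ob n)) :
  reflect (is_rmhom f) (f \in lker (linfun (@rm_defect m n))).
Proof. by rewrite memv_ker lfunE /= subr_eq0; apply: eqP. Qed.

Definition rmhom_of m n (f : hom (rm_ob m) (rm_ob n)) (fP : is_rmhom f) :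
  rmhom m n := Subvs (introT (rmhomP f) fP).

Lemma rmhom_is m n (f : rmhom m n) : is_rmhom (vsval f).
Proof. exact/rmhomP/subvsP. Qed.

Lemma is_rmhom_id m : is_rmhom (idm (rm_ob m)).
Proof. by rewrite /is_rmhom comp1m tenm1 compm1. Qed.

Lemma is_rmhom_comp m n p (g : hom (rm_ob n) (rm_ob p))
    (f : hom (rm_ob m) (rm_ob n)) :
  is_rmhom g -> is_rmhom f -> is_rmhom (g ∘ f).
Proof.
rewrite /is_rmhom => gP fP.
by rewrite -compA fP compA gP -compA -tenm_idr.
Qed.

Lemma is_rmhom_inv m n (f : hom (rm_ob m) (rm_ob n))
    (g : hom (rm_ob n) (rm_ob m)) :
  is_inverse f g -> is_rmhom f -> is_rmhom g.
Proof.
rewrite /is_rmhom => -[gf fg] fP.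
rewrite -[rm_act n]compm1 -tenm1 -fg tenm_idr (compA (rm_act n)) -fP.
by rewrite !compA gf comp1m.
Qed.

Definition rmid m : rmhom m m := rmhom_of (is_rmhom_id m).

Definition rmcomp m n p (g : rmhom n p) (f : rmhom m n) : rmhom m p :=
  rmhom_of (is_rmhom_comp (rmhom_is g) (rmhom_is f)).

Fact rmcompA m n p q (h : rmhom p q) (g : rmhom n p) (f : rmhom m n) :
  rmcomp h (rmcomp g f) = rmcomp (rmcomp h g) f.
Proof. by apply: val_inj; rewrite /= compA. Qed.

Fact rmcomp1m m n (f : rmhom m n) : rmcomp (rmid n) f = f.
Proof. by apply: val_inj; rewrite /= comp1m. Qed.

Fact rmcompm1 m n (f : rmhom m n) : rmcomp f (rmid m) = f.
Proof. by apply: val_inj; rewrite /= compm1. Qed.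

Fact rmcomp_linl m n p (a : k) (g g' : rmhom n p) (f : rmhom m n) :
  rmcomp (a *: g + g') f = a *: rmcomp g f + rmcomp g' f.
Proof. by apply: val_inj; rewrite /= comp_linl. Qed.

Fact rmcomp_linr m n p (a : k) (g : rmhom n p) (f f' : rmhom m n) :
  rmcomp g (a *: f + f') = a *: rmcomp g f + rmcomp g f'.
Proof. by apply: val_inj; rewrite /= comp_linr. Qed.

Definition rmod : lincat k :=
  Lincat rmcompA rmcomp1m rmcompm1 rmcomp_linl rmcomp_linr.

(* The left action c ▷ (m, ρ) = (c ⊗ m, (1 ⊗ ρ) ∘ assoc). *)
Section Action.
Implicit Types c d : C.

Definition rm_lact_act c m : hom (c ⊗ m ⊗ A) (c ⊗ m) :=
  (idm c ⊠ rm_act m) ∘ assoc c m A.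

Fact rm_lact_mul c m :
  rm_lact_act c m ∘ (rm_lact_act c m ⊠ idm (fa_ob A))
  = rm_lact_act c m ∘ (idm (c ⊗ m) ⊠ mul A) ∘ assoc (c ⊗ m) A A.
Proof.
rewrite /rm_lact_act tenm_idr !compA -[_ ∘ _ ∘ (_ ⊠ _ ⊠ _)]compA assocN.
rewrite compA -tenm_idl rm_mul !tenm_idl -!compA.
rewrite [(idm c ⊠ assoc _ _ _) ∘ _]compA -ten_pentagon -tenm1.
by congr (_ ∘ _); rewrite !compA assocN.
Qed.

Fact rm_lact_eta c m :
  rm_lact_act c m ∘ (idm (c ⊗ m) ⊠ eta A) = run (c ⊗ m).
Proof.
by rewrite /rm_lact_act -compA -tenm1 assocN compA -tenm_idl rm_eta run_ten.
Qed.

Definition rm_lact c m : rmodule := Rmodule (rm_lact_mul c m) (rm_lact_eta c m).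

Fact is_rmhom_lact c d m n (f : hom c d) (g : hom (rm_ob m) (rm_ob n)) :
  is_rmhom g -> @is_rmhom (rm_lact c m) (rm_lact d n) (f ⊠ g).
Proof.
rewrite /is_rmhom /= /rm_lact_act => gP.
by rewrite compA -tenmM compm1 gP -compA assocN compA -tenmM comp1m.
Qed.

Definition rm_lactm c d m n (f : hom c d) (g : rmhom m n) :
  rmhom (rm_lact c m) (rm_lact d n) := rmhom_of (is_rmhom_lact f (rmhom_is g)).

Fact is_rmhom_assoc c d m :
  @is_rmhom (rm_lact (c ⊗ d) m) (rm_lact c (rm_lact d m)) (assoc c d m).
Proof.
rewrite /is_rmhom /= /rm_lact_act -tenm1 compA assocN -compA ten_pentagon.
by rewrite tenm_idl !compA.
Qed.

Definition rm_assoc c d m :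
  rmhom (rm_lact (c ⊗ d) m) (rm_lact c (rm_lact d m)) :=
  rmhom_of (is_rmhom_assoc c d m).

Definition rm_assoc' c d m :
  rmhom (rm_lact c (rm_lact d m)) (rm_lact (c ⊗ d) m) :=
  rmhom_of (@is_rmhom_inv (rm_lact (c ⊗ d) m) (rm_lact c (rm_lact d m)) _ _
              (assocK c d m) (is_rmhom_assoc c d m)).

Fact is_rmhom_lun m : @is_rmhom (rm_lact (one C) m) m (lun m).
Proof.
by rewrite /is_rmhom /= /rm_lact_act compA lunN -compA lun_ten.
Qed.

Definition rm_lun m : rmhom (rm_lact (one C) m) m := rmhom_of (is_rmhom_lun m).

Definition rm_lun' m : rmhom m (rm_lact (one C) m) :=
  rmhom_of (@is_rmhom_inv (rm_lact (one C) m) m _ _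
              (lunK (rm_ob m)) (is_rmhom_lun m)).

Definition rmod_laction : laction C rmod.
Proof.
refine (@Laction k C rmod rm_lact rm_lactm _ _ _ _ rm_assoc rm_assoc' _ _
  rm_lun rm_lun' _ _ _ _).
- by move=> c m; apply: val_inj; rewrite /= tenm1.
- by move=> *; apply: val_inj; rewrite /= tenmM.
- by move=> *; apply: val_inj; rewrite /= tenm_linl.
- by move=> *; apply: val_inj; rewrite /= tenm_linr.
- by move=> c d m; have [e1 e2] := assocK c d m; split; apply: val_inj.
- by move=> *; apply: val_inj; rewrite /= assocN.
- by move=> m; have [e1 e2] := lunK (rm_ob m); split; apply: val_inj.
- by move=> *; apply: val_inj; rewrite /= lunN.
- by move=> *; apply: val_inj; rewrite /= ten_pentagon.
- by move=> *; apply: val_inj; rewrite /= ten_triangle.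
Defined.

End Action.

End Modules.

(* Main.v *)
(* An inner product on a module category is the same as a family of morphisms
   ⟨m,n⟩ ▷ n -> m, compatible with the actions, that exhibits ⟨m,n⟩ as a right
   adjoint of - ▷ n at m as well as its left one ([counit]).

   For a Frobenius algebra A, the object m ⊗ ^*n of C is the inner hom of the
   underlying objects, and the pivotal structure gives it such a counit. Averaging
   with the Casimir element of A turns morphisms of C into morphisms of modules;
   up to a scalar it is an idempotent, since A is special, hence splits, and the
   inner hom of modules is its image on m ⊗ ^*n. Symmetry of A makes the
   counit invariant under averaging, so that it descends. The modules form a
   finite category since a free module on a projective generator of C is again
   one, and a category with a projective generator and finite-dimensional
   morphism spaces has finite length and finitely many simple objects.

   A bimodule trace amounts to a nondegenerate cyclic trace on the endomorphisms
   in M that intertwines the two adjunctions between the actions of an object and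
   of its dual. In a fusion category the pivotal trace is nondegenerate too, and
   the counit p is defined by tr_M(w p) = tr_D(w^), with w^ : ⟨m,n⟩ -> ⟨m,n⟩ the
   transpose of w : m -> ⟨m,n⟩ ▷ n. Its compatibility with left and right duals
   follows as the pivotal traces equal those of the left and right partial
   traces; here D has to be spherical. The C-valued inner product is the left
   one for the categories with reversed tensor products. *)

From HB Require Import structures.
From mathcomp Require Import all_boot all_algebra.
From Stdlib Require Import ClassicalEpsilon.
Require Import Defs.

Set Implicit Arguments.
Unset Strict Implicit.
Unset Printing Implicit Defensive.

Import GRing.Theory.
Local Open Scope ring_scope.
Local Open Scope cat_scope.

(** * Actions of rigid categories *)

(** The axioms of an inner product are equations between morphisms into ⟨n,m⟩^*. The bijections
    Hom(x, ⟨n,m⟩^* ) = Hom(x ⊗ ⟨n,m⟩, 1) = Hom(x ▷ n, m) move them to M, where neither the dual nor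
    ⟨n,m⟩ is left; this makes a morphism ⟨m,n⟩ ▷ n -> m the convenient datum. The obstacle
    throughout is coherence, since nothing is strict. Morphisms of D are therefore studied by their
    action on an arbitrary object of a module category. The action of D on itself is faithful, so
    equations in D can be tested in this way, and one computation serves both D and M. For modules
    the idempotent is x ⊗ φ |-> xγ' ⊗ γ''φ up to a scalar, with γ' ⊗ γ'' the Casimir element, so the
    inner hom is a model of m ⊗_A ^*n. For a trace, the counit comes from the chain Hom(d, ⟨m,n⟩) =
    Hom(⟨m,n⟩, d)^* = Hom(m, d ▷ n)^* = Hom(d ▷ n, m), whose outer steps are the trace pairings of D
    and of M: it is the image of the identity at d = ⟨m,n⟩. *)

Section LinearComposition.
Variables (k : fieldType) (C : lincat k).
Implicit Types x y z w : C.

(** Turns an equation into a rewriting rule for composites nested to the right, with an arbitrary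
    tail [e]. *)
Lemma postcomp x y z (g : hom y z) (f : hom x y) (h : hom x z) :
  g ∘ f = h -> forall w (e : hom w x), g ∘ (f ∘ e) = h ∘ e.
Proof. by move=> <- w e; rewrite compA. Qed.

Lemma postcomp3 x y z w (h : hom z w) (g : hom y z) (f : hom x y) e :
  h ∘ (g ∘ f) = e -> forall v (r : hom v x), h ∘ (g ∘ (f ∘ r)) = e ∘ r.
Proof. by move=> <- v r; rewrite !compA. Qed.

Lemma compDl x y z (g g' : hom y z) (f : hom x y) :
  (g + g') ∘ f = (g ∘ f) + (g' ∘ f).
Proof. by have := comp_linl 1 g g' f; rewrite !scale1r. Qed.

Lemma compDr x y z (g : hom y z) (f f' : hom x y) :
  g ∘ (f + f') = (g ∘ f) + (g ∘ f').
Proof. by have := comp_linr 1 g f f'; rewrite !scale1r. Qed.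

Lemma comp0m x y z (f : hom x y) : (0 : hom y z) ∘ f = 0.
Proof. by apply: (addIr (0 ∘ f)); rewrite -compDl !add0r. Qed.

Lemma compm0 x y z (g : hom y z) : g ∘ (0 : hom x y) = 0.
Proof. by apply: (addIr (g ∘ 0)); rewrite -compDr !add0r. Qed.

Lemma compZl x y z (a : k) (g : hom y z) (f : hom x y) :
  (a *: g) ∘ f = a *: (g ∘ f).
Proof. by have := comp_linl a g 0 f; rewrite !addr0 comp0m addr0. Qed.

Lemma compZr x y z (a : k) (g : hom y z) (f : hom x y) :
  g ∘ (a *: f) = a *: (g ∘ f).
Proof. by have := comp_linr a g f 0; rewrite !addr0 compm0 addr0. Qed.

Lemma compNl x y z (g : hom y z) (f : hom x y) : (- g) ∘ f = - (g ∘ f).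
Proof. by rewrite -scaleN1r compZl scaleN1r. Qed.

Lemma compNr x y z (g : hom y z) (f : hom x y) : g ∘ (- f) = - (g ∘ f).
Proof. by rewrite -scaleN1r compZr scaleN1r. Qed.

Lemma compBl x y z (g g' : hom y z) (f : hom x y) :
  (g - g') ∘ f = (g ∘ f) - (g' ∘ f).
Proof. by rewrite compDl compNl. Qed.

Lemma compBr x y z (g : hom y z) (f f' : hom x y) :
  g ∘ (f - f') = (g ∘ f) - (g ∘ f').
Proof. by rewrite compDr compNr. Qed.

Lemma comp_suml x y z (I : finType) (g : I -> hom y z) (f : hom x y) :
  (\sum_i g i) ∘ f = \sum_i (g i ∘ f).
Proof.
apply: (big_morph (fun g => g ∘ f)) => [g1 g2|]; first exact: compDl.
exact: comp0m.
Qed.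

Lemma comp_sumr x y z (I : finType) (g : hom y z) (f : I -> hom x y) :
  g ∘ (\sum_i f i) = \sum_i (g ∘ f i).
Proof.
apply: (big_morph (fun f => g ∘ f)) => [f1 f2|]; first exact: compDr.
exact: compm0.
Qed.

Lemma iso_monoI x y z (f : hom y z) (g h : hom x y) :
  is_iso f -> f ∘ g = f ∘ h -> g = h.
Proof.
by move=> [f' [f'f _]] E; rewrite -[g]comp1m -[h]comp1m -f'f -?compA E.
Qed.

Lemma iso_epiI x y z (f : hom x y) (g h : hom y z) :
  is_iso f -> g ∘ f = h ∘ f -> g = h.
Proof.
by move=> [f' [_ ff']] E; rewrite -[g]compm1 -[h]compm1 -ff' !compA E.
Qed.

Lemma is_iso_id x : is_iso (idm x).
Proof. by exists (idm x); split; rewrite comp1m. Qed.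

Lemma is_inverse_sym x y (f : hom x y) f' : is_inverse f f' -> is_inverse f' f.
Proof. by case. Qed.

Lemma is_inverse_comp x y z (f : hom x y) f' (g : hom y z) g' :
  is_inverse f f' -> is_inverse g g' -> is_inverse (g ∘ f) (f' ∘ g').
Proof.
move=> [f1 f2] [g1 g2]; split.
  by rewrite -compA (compA g') g1 comp1m f1.
by rewrite -compA (compA f) f2 comp1m g2.
Qed.

Lemma is_inverse_uniq x y (f g : hom x y) f' g' :
  is_inverse f f' -> is_inverse g g' -> f = g -> f' = g'.
Proof.
by move=> [f1 _] [_ g2] E; rewrite -[f']compm1 -g2 -E compA f1 comp1m.
Qed.

Lemma comp_is_iso x y z (g : hom y z) (f : hom x y) :
  is_iso g -> is_iso f -> is_iso (g ∘ f).
Proof.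
by move=> [g' gK] [f' fK]; exists (f' ∘ g'); apply: is_inverse_comp.
Qed.

(* Yoneda. *)
Lemma is_iso_postcomp x y (f : hom x y) :
  (forall w, bijective (fun g : hom w x => f ∘ g)) -> is_iso f.
Proof.
move=> bf; have [h hK fhK] := bf y.
exists (h (idm y)); split; last exact: fhK.
have inj := bij_inj (bf x); apply: inj => /=.
by rewrite compA fhK comp1m compm1.
Qed.

End LinearComposition.

Section Action.
Variables (k : fieldType) (D : moncat k) (M : lincat k) (L : laction D M).
Local Notation "d ▷ m" := (lact L d m) (at level 38, right associativity).
Local Notation "f ▶ g" := (lactm L f g) (at level 38, right associativity).
Implicit Types (d x y z : D) (m n : M).

Lemma lactm_idl d m n p (g : hom n p) (f : hom m n) :
  idm d ▶ (g ∘ f) = (idm d ▶ g) ∘ (idm d ▶ f).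
Proof. by rewrite -lactmM comp1m. Qed.

Lemma lactm_idr x y z m (g : hom y z) (f : hom x y) :
  (g ∘ f) ▶ idm m = (g ▶ idm m) ∘ (f ▶ idm m).
Proof. by rewrite -lactmM comp1m. Qed.

Lemma lactmE x y m n (f : hom x y) (g : hom m n) :
  f ▶ g = (f ▶ idm n) ∘ (idm x ▶ g).
Proof. by rewrite -lactmM comp1m compm1. Qed.

Lemma lactm_swap x y m n (f : hom x y) (g : hom m n) :
  (idm y ▶ g) ∘ (f ▶ idm m) = (f ▶ idm n) ∘ (idm x ▶ g).
Proof. by rewrite -!lactmM !comp1m !compm1. Qed.

Lemma lactm0l x y m n (g : hom m n) : (0 : hom x y) ▶ g = 0.
Proof.
have := lactm_linl L (-1) 0 (0 : hom x y) g.
by rewrite scaler0 addr0 => ->; rewrite scaleN1r addNr.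
Qed.

Lemma lactm0r x y m n (f : hom x y) : f ▶ (0 : hom m n) = 0.
Proof.
have := lactm_linr L (-1) f 0 (0 : hom m n).
by rewrite scaler0 addr0 => ->; rewrite scaleN1r addNr.
Qed.

Lemma lactmDl x y m n (f f' : hom x y) (g : hom m n) :
  (f + f') ▶ g = f ▶ g + f' ▶ g.
Proof. by have := lactm_linl L 1 f f' g; rewrite !scale1r. Qed.

Lemma lactmZl x y m n (a : k) (f : hom x y) (g : hom m n) :
  (a *: f) ▶ g = a *: (f ▶ g).
Proof. by have := lactm_linl L a f 0 g; rewrite !addr0 lactm0l addr0. Qed.

Lemma lactmZr x y m n (a : k) (f : hom x y) (g : hom m n) :
  f ▶ (a *: g) = a *: (f ▶ g).
Proof. by have := lactm_linr L a f g 0; rewrite !addr0 lactm0r addr0. Qed.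

Lemma lassocV x y m : lassoc L x y m ∘ lassoc' L x y m = idm _.
Proof. by have [] := lassocK L x y m. Qed.

Lemma lassoc'V x y m : lassoc' L x y m ∘ lassoc L x y m = idm _.
Proof. by have [] := lassocK L x y m. Qed.

Lemma lunitV m : lunit L m ∘ lunit' L m = idm _.
Proof. by have [] := lunitK L m. Qed.

Lemma lunit'V m : lunit' L m ∘ lunit L m = idm _.
Proof. by have [] := lunitK L m. Qed.

Lemma lassoc_is_iso x y m : is_iso (lassoc L x y m).
Proof. by exists (lassoc' L x y m); apply: lassocK. Qed.

Lemma lassoc'_is_iso x y m : is_iso (lassoc' L x y m).
Proof. by exists (lassoc L x y m); split; rewrite ?lassocV ?lassoc'V. Qed.

Lemma lunit_is_iso m : is_iso (lunit L m).
Proof. by exists (lunit' L m); apply: lunitK. Qed.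

Lemma lactm_is_iso x y m n (f : hom x y) (g : hom m n) :
  is_iso f -> is_iso g -> is_iso (f ▶ g).
Proof.
move=> [f' [f1 f2]] [g' [g1 g2]]; exists (f' ▶ g').
by split; rewrite -lactmM ?f1 ?f2 ?g1 ?g2 lactm1.
Qed.

Lemma lassoc'N x x' y y' m m' (f : hom x x') (g : hom y y') (h : hom m m') :
  lassoc' L x' y' m' ∘ (f ▶ (g ▶ h)) = ((f ⊠ g) ▶ h) ∘ lassoc' L x y m.
Proof.
apply: (iso_monoI (lassoc_is_iso x' y' m')).
rewrite !compA lassocV comp1m lassocN.
by rewrite -compA lassocV compm1.
Qed.

Lemma lunit'N m m' (f : hom m m') :
  lunit' L m' ∘ f = (idm (one D) ▶ f) ∘ lunit' L m.
Proof.
apply: (iso_monoI (lunit_is_iso m')).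
by rewrite !compA lunitV comp1m lunitN -compA lunitV compm1.
Qed.

Lemma lactm_oneI m n (f g : hom m n) :
  idm (one D) ▶ f = idm (one D) ▶ g -> f = g.
Proof.
move=> E; apply: (iso_epiI (f := lunit L m)); first exact: lunit_is_iso.
by rewrite -!lunitN E.
Qed.

(** The unit coherence that is not among the axioms. As in Kelly's argument for monoidal categories,
    it is checked after acting with the unit object, where the pentagon and the triangles apply. *)
Lemma lunit_lact d m :
  lunit L (d ▷ m) ∘ lassoc L (one D) d m = lun d ▶ idm m.
Proof.
apply: lactm_oneI; rewrite lactm_idl.
apply: (iso_epiI (lassoc_is_iso _ _ _)).
apply: (iso_epiI (lactm_is_iso (assoc_is_iso (one D) (one D) d) (is_iso_id m))).
rewrite -?compA [(idm _ ▶ lassoc L _ _ _) ∘ _]compA -lact_pentagon.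
rewrite compA lact_triangle -lactm1 -lassocN [RHS]compA -lassocN -compA.
by rewrite -lactm_idr ten_triangle.
Qed.

(* A morphism x ⊗ y -> 1 or 1 -> x ⊗ y is evaluated on a tail m, acted upon by x
   and y one after the other, so that the associators of D never appear; its
   behaviour on all tails determines it ([cap_inj], [cup_inj]). [cap] and [cup]
   are locked so that rewriting with [compA] does not look through them. *)
Fact cap_key : unit. Proof. by []. Qed.

Definition cap x y (h : hom (x ⊗ y) (one D)) m : hom (x ▷ y ▷ m) m :=
  locked_with cap_key (lunit L m ∘ (h ▶ idm m) ∘ lassoc' L x y m).

Definition cup x y (c : hom (one D) (x ⊗ y)) m : hom m (x ▷ y ▷ m) :=
  locked_with cap_key (lassoc L x y m ∘ (c ▶ idm m) ∘ lunit' L m).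

Lemma capE x y (h : hom (x ⊗ y) (one D)) m :
  cap h m = lunit L m ∘ (h ▶ idm m) ∘ lassoc' L x y m.
Proof. by rewrite /cap locked_withE. Qed.

Lemma cupE x y (c : hom (one D) (x ⊗ y)) m :
  cup c m = lassoc L x y m ∘ (c ▶ idm m) ∘ lunit' L m.
Proof. by rewrite /cup locked_withE. Qed.

Lemma capN x y (h : hom (x ⊗ y) (one D)) m n (f : hom m n) :
  cap h n ∘ (idm x ▶ (idm y ▶ f)) = f ∘ cap h m.
Proof.
rewrite !capE -?compA lassoc'N tenm1 (compA (h ▶ _)) -lactm_swap.
by rewrite !compA lunitN.
Qed.

Lemma cupN x y (c : hom (one D) (x ⊗ y)) m n (f : hom m n) :
  (idm x ▶ (idm y ▶ f)) ∘ cup c m = cup c n ∘ f.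
Proof.
rewrite !cupE !compA -lassocN tenm1 -?compA lunit'N (compA (c ▶ _)).
by rewrite -lactm_swap !compA.
Qed.

Lemma cap_ten x x' y y' (h : hom (x' ⊗ y') (one D)) (f : hom x x')
    (g : hom y y') m :
  cap (h ∘ (f ⊠ g)) m = cap h m ∘ (f ▶ (g ▶ idm m)).
Proof. by rewrite !capE lactm_idr -?compA lassoc'N. Qed.

Lemma cup_ten x x' y y' (c : hom (one D) (x ⊗ y)) (f : hom x x')
    (g : hom y y') m :
  cup ((f ⊠ g) ∘ c) m = (f ▶ (g ▶ idm m)) ∘ cup c m.
Proof. by rewrite !cupE lactm_idr !compA lassocN. Qed.

Lemma lunit_one m : lunit L (one D ▷ m) = idm (one D) ▶ lunit L m.
Proof. by apply: (iso_monoI (lunit_is_iso m)); rewrite lunitN. Qed.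

Lemma cap_lassoc x y (h : hom (x ⊗ y) (one D)) m :
  cap h m ∘ lassoc L x y m = lunit L m ∘ (h ▶ idm m).
Proof. by rewrite capE -?compA lassoc'V compm1. Qed.

Lemma cup_lunit x y (c : hom (one D) (x ⊗ y)) m :
  lassoc L x y m ∘ (c ▶ idm m) = cup c m ∘ lunit L m.
Proof. by rewrite cupE -?compA lunit'V compm1. Qed.

Lemma cap_lun m : cap (lun (one D)) m = lunit L m ∘ lunit L (one D ▷ m).
Proof. by rewrite capE -lunit_lact -?compA lassocV compm1. Qed.

Lemma lpentagon' x y z m :
  (idm x ▶ lassoc L y z m) ∘ lassoc L x (y ⊗ z) m =
  lassoc L x y (z ▷ m) ∘ (lassoc L (x ⊗ y) z m ∘ (assoc' x y z ▶ idm m)).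
Proof.
rewrite compA lact_pentagon -?compA -lactm_idr.
by have [_ ->] := assocK x y z; rewrite lactm1 compm1.
Qed.

Lemma lassoc_assoc' x y z m :
  lassoc L (x ⊗ y) z m ∘ (assoc' x y z ▶ idm m) =
  lassoc' L x y (z ▷ m) ∘ ((idm x ▶ lassoc L y z m) ∘ lassoc L x (y ⊗ z) m).
Proof. by rewrite lpentagon' compA lassoc'V comp1m. Qed.

Lemma lassoc_assoc x y z m :
  lassoc L x (y ⊗ z) m ∘ (assoc x y z ▶ idm m) =
  (idm x ▶ lassoc' L y z m) ∘ (lassoc L x y (z ▷ m) ∘ lassoc L (x ⊗ y) z m).
Proof.
rewrite lact_pentagon -?compA (compA (idm x ▶ _)) -lactm_idl lassoc'V lactm1.
by rewrite comp1m.
Qed.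

(** The left side is the first half of [rcurry], [linn_left] and [lptrace]; its mirror image in
    [lact_cap] is that of [lcurry], [linn_right] and [ptrace]. *)
Lemma cap_lact x y z (h : hom (x ⊗ y) (one D)) m :
  (lun z ∘ (h ⊠ idm z) ∘ assoc' x y z) ▶ idm m
  = cap h (z ▷ m) ∘ ((idm x ▶ lassoc L y z m) ∘ lassoc L x (y ⊗ z) m).
Proof.
rewrite lpentagon' !capE -?compA (postcomp (lassoc'V _ _ _)) comp1m.
rewrite -[idm (z ▷ m)]lactm1 (postcomp (esym (lassocN L _ _ _))) -?compA.
by rewrite (postcomp (lunit_lact _ _)) !lactm_idr -?compA.
Qed.

Lemma lact_cap x y z (h : hom (x ⊗ y) (one D)) m :
  (run z ∘ (idm z ⊠ h) ∘ assoc z x y) ▶ idm m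
  = (idm z ▶ cap h m) ∘ (lassoc L z x (y ▷ m) ∘ lassoc L (z ⊗ x) y m).
Proof.
rewrite lact_pentagon !capE !lactm_idl -?compA.
have E : (idm z ▶ lassoc' L x y m) ∘ (idm z ▶ lassoc L x y m) = idm _.
  by rewrite -lactm_idl lassoc'V lactm1.
rewrite (postcomp E) comp1m (postcomp (esym (lassocN L _ _ _))) -?compA.
by rewrite (postcomp (lact_triangle _ _ _)) !lactm_idr -?compA.
Qed.

Lemma lunit'_lact d m :
  lassoc L (one D) d m ∘ (lun' d ▶ idm m) = lunit' L (d ▷ m).
Proof.
apply: (iso_monoI (lunit_is_iso _)); rewrite compA lunit_lact lunitV.
by rewrite -lactm_idr; have [_ ->] := lunK d; rewrite lactm1.
Qed.

Lemma lact_lunit' d m :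
  lassoc L d (one D) m ∘ (run' d ▶ idm m) = idm d ▶ lunit' L m.
Proof.
apply: (iso_monoI (lactm_is_iso (is_iso_id d) (lunit_is_iso _))).
rewrite compA lact_triangle -lactm_idr -lactm_idl lunitV.
by have [_ ->] := runK d; rewrite lactm1.
Qed.

(** The left side has the shape of [lcurry] and of the snake identities [rsnake1] and [lsnake2];
    [cap_zag] treats [rcurry], [rsnake2] and [lsnake1]. *)
Lemma cap_zig x y z (h : hom (x ⊗ y) (one D)) (c : hom (one D) (z ⊗ x)) m :
  (run z ∘ (idm z ⊠ h) ∘ assoc z x y ∘ (c ⊠ idm y) ∘ lun' y) ▶ idm m
  = (idm z ▶ cap h m) ∘ cup c (y ▷ m).
Proof.
rewrite 2!lactm_idr lact_cap -?compA; congr (_ ∘ _); rewrite !cupE -?compA.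
congr (_ ∘ _); rewrite (postcomp (lassocN L _ _ _)) lactm1 -?compA.
by rewrite lunit'_lact.
Qed.

Lemma cap_zag x y z (h : hom (x ⊗ y) (one D)) (c : hom (one D) (y ⊗ z)) m :
  (lun z ∘ (h ⊠ idm z) ∘ assoc' x y z ∘ (idm x ⊠ c) ∘ run' x) ▶ idm m
  = cap h (z ▷ m) ∘ (idm x ▶ cup c m).
Proof.
rewrite 2!lactm_idr cap_lact -?compA; congr (_ ∘ _).
rewrite (postcomp (lassocN L _ _ _)) -?compA lact_lunit' !cupE !lactm_idl.
by rewrite -?compA.
Qed.

End Action.

Section RigidAction.
Variables (k : fieldType) (D : rigidcat k) (M : lincat k) (L : laction D M).
Local Notation "d ▷ m" := (lact L d m) (at level 38, right associativity).
Local Notation "f ▶ g" := (lactm L f g) (at level 38, right associativity).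
Implicit Types (d x y z w : D) (m n : M).

(** Lets [rdual_ten] and [ldual_ten], which are transposes of [nest], be handled by two successive
    caps. *)
Lemma cap_nest y' x' x y (p : hom (y' ⊗ y) (one D)) (q : hom (x' ⊗ x) (one D)) m :
  cap L (nest p q) m = cap L p m ∘ ((idm y' ▶ (cap L q (y ▷ m)
     ∘ (idm x' ▶ lassoc L x y m))) ∘ lassoc L y' x' ((x ⊗ y) ▷ m)).
Proof.
have -> : cap L q (y ▷ m) ∘ (idm x' ▶ lassoc L x y m)
    = ((lun y ∘ (q ⊠ idm y) ∘ assoc' x' x y) ▶ idm m) ∘ lassoc' L x' (x ⊗ y) m.
  apply: (iso_epiI (lassoc_is_iso L _ _ _)).
  by rewrite cap_lact -?compA lassoc'V compm1.
rewrite /nest 2!capE 2!lactm_idr lactm_idl -?compA; congr (_ ∘ (_ ∘ _)).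
rewrite (postcomp (lassoc'N L _ _ _)) -?compA; congr (_ ∘ _).
apply: (iso_monoI (lassoc_is_iso L _ _ _)).
apply: (iso_monoI (lactm_is_iso L (is_iso_id _) (lassoc_is_iso L _ _ _))).
rewrite (postcomp (lassocV L _ _ _)) comp1m (postcomp (esym (lactm_idl L _ _ _))).
rewrite lassocV lactm1 comp1m.
apply: (iso_epiI (lassoc_is_iso L _ _ _)).
rewrite -?compA lassoc'V compm1.
by rewrite lact_pentagon -?compA.
Qed.

Lemma coev_ev m x : (idm x ▶ cap L (ev x) m) ∘ cup L (coev x) (x ▷ m) = idm _.
Proof. by rewrite -cap_zig rsnake1 lactm1. Qed.

Lemma ev_coev m x :
  cap L (ev x) (rdual x ▷ m) ∘ (idm (rdual x) ▶ cup L (coev x) m) = idm _.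
Proof. by rewrite -cap_zag rsnake2 lactm1. Qed.

Lemma ev'_coev' m x :
  cap L (ev' x) (x ▷ m) ∘ (idm x ▶ cup L (coev' x) m) = idm _.
Proof. by rewrite -cap_zag lsnake1 lactm1. Qed.

Lemma coev'_ev' m x :
  (idm (ldual x) ▶ cap L (ev' x) m) ∘ cup L (coev' x) (ldual x ▷ m) = idm _.
Proof. by rewrite -cap_zig lsnake2 lactm1. Qed.

Lemma rcurry_lact w x (h : hom (w ⊗ x) (one D)) m :
  rcurry h ▶ idm m = cap L h (rdual x ▷ m) ∘ (idm w ▶ cup L (coev x) m).
Proof. exact: cap_zag. Qed.

Lemma lcurry_lact w x (h : hom (x ⊗ w) (one D)) m :
  lcurry h ▶ idm m = (idm (ldual x) ▶ cap L h m) ∘ cup L (coev' x) (w ▷ m).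
Proof. exact: cap_zig. Qed.

End RigidAction.

Definition regular (k : fieldType) (D : moncat k) : laction D D :=
  @Laction k D D (@ten k D) (@tenm k D) (@tenm1 k D) (@tenmM k D)
    (@tenm_linl k D) (@tenm_linr k D) (@assoc k D) (@assoc' k D) (@assocK k D)
    (@assocN k D) (@lun k D) (@lun' k D) (@lunK k D) (@lunN k D)
    (@ten_pentagon k D) (@ten_triangle k D).

(** The tail 1 suffices, since - ⊗ 1 is faithful. With arbitrary tails, however, the calculus of
    caps and cups becomes available. *)
Lemma regular_inj (k : fieldType) (D : moncat k) (x y : D) (f g : hom x y) :
  (forall m, lactm (regular D) f (idm m) = lactm (regular D) g (idm m)) ->
  f = g.
Proof. by move=> /(_ (one D)) /tenm_oner_inj. Qed.

Lemma cap_inj (k : fieldType) (D : moncat k) (x y : D)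
    (h h' : hom (x ⊗ y) (one D)) :
  (forall m, cap (regular D) h m = cap (regular D) h' m) -> h = h'.
Proof.
move=> /(_ (one D)); rewrite !capE -!compA.
move=> /(iso_monoI (lunit_is_iso (regular D) _)).
by move=> /(iso_epiI (lassoc'_is_iso (regular D) _ _ _)) /tenm_oner_inj.
Qed.

(** * Reversal of the tensor product, and transposes *)

Section Reverse.
Variable k : fieldType.

Lemma tenm_is_inverse (C : moncat k) (x x' y y' : C) (f : hom x x') f'
    (g : hom y y') g' :
  is_inverse f f' -> is_inverse g g' -> is_inverse (f ⊠ g) (f' ⊠ g').
Proof.
move=> [f1 f2] [g1 g2].
by split; rewrite -tenmM ?f1 ?f2 ?g1 ?g2 tenm1.
Qed.

Lemma is_inverse_id (C : lincat k) (x : C) : is_inverse (idm x) (idm x).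
Proof. by split; rewrite comp1m. Qed.

Lemma ten_pentagon' (C : moncat k) (x y z w : C) :
  assoc' (x ⊗ y) z w ∘ assoc' x y (z ⊗ w) =
  (assoc' x y z ⊠ idm w) ∘ (assoc' x (y ⊗ z) w ∘ (idm x ⊠ assoc' y z w)).
Proof.
apply: is_inverse_uniq (ten_pentagon x y z w).
  by apply: is_inverse_comp; apply: assocK.
apply: is_inverse_comp; first exact: tenm_is_inverse (assocK _ _ _) (is_inverse_id _).
apply: is_inverse_comp; first exact: assocK.
exact: tenm_is_inverse (is_inverse_id _) (assocK _ _ _).
Qed.

Lemma ten_triangle' (C : moncat k) (x y : C) :
  (run x ⊠ idm y) ∘ assoc' x (one C) y = idm x ⊠ lun y.
Proof. by rewrite -ten_triangle -compA (assocK _ _ _).2 compm1. Qed.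

Definition revm (C : moncat k) : moncat k.
Proof.
refine (@Moncat k C (one C) (fun x y => y ⊗ x)
  (fun x x' y y' f g => g ⊠ f) _ _ _ _
  (fun x y z => assoc' z y x) (fun x y z => assoc z y x) _ _
  (@run k C) (@run' k C) (@runK k C) (@runN k C)
  (@lun k C) (@lun' k C) (@lunK k C) (@lunN k C) _ _).
- by move=> x y; apply: tenm1.
- by move=> *; apply: tenmM.
- by move=> *; apply: tenm_linr.
- by move=> *; apply: tenm_linl.
- by move=> x y z; exact: is_inverse_sym (assocK z y x).
- by move=> *; exact: (lassoc'N (regular C)).
- by move=> x y z w; rewrite ten_pentagon' compA.
- by move=> x y; apply: ten_triangle'.
Defined.

Definition revr (C : rigidcat k) : rigidcat k :=
  @Rigidcat k (revm C) (@ldual k C) (@ev' k C) (@coev' k C)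
    (@rdual k C) (@ev k C) (@coev k C)
    (@lsnake1 k C) (@lsnake2 k C) (@rsnake1 k C) (@rsnake2 k C).

End Reverse.

Section RCurry.
Variables (k : fieldType) (C : rigidcat k).
Implicit Types x y z w : C.
Local Notation L := (regular C).

Lemma rcurryK w x (h : hom (w ⊗ x) (one C)) :
  ev x ∘ (rcurry h ⊠ idm x) = h.
Proof.
apply: cap_inj => m; rewrite cap_ten lactm1 rcurry_lact.
rewrite (postcomp (esym (capN L h (cap L (ev x) m)))) -compA -lactm_idl coev_ev.
by rewrite lactm1 compm1.
Qed.

Lemma evK w x (f : hom w (rdual x)) : rcurry (ev x ∘ (f ⊠ idm x)) = f.
Proof.
apply: regular_inj => m; rewrite rcurry_lact cap_ten -compA lactm1.
by rewrite -lactm_swap compA ev_coev comp1m.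
Qed.

Lemma ev_inj w x (f g : hom w (rdual x)) :
  ev x ∘ (f ⊠ idm x) = ev x ∘ (g ⊠ idm x) -> f = g.
Proof. by move=> E; rewrite -[f]evK E evK. Qed.

Lemma ev_rdualm x y (f : hom x y) :
  ev x ∘ (rdualm f ⊠ idm x) = ev y ∘ (idm (rdual y) ⊠ f).
Proof. exact: rcurryK. Qed.

Lemma rdualm_comp x y z (g : hom y z) (f : hom x y) :
  rdualm (g ∘ f) = rdualm f ∘ rdualm g.
Proof.
apply: ev_inj; rewrite ev_rdualm tenm_idl tenm_idr compA -ev_rdualm -compA.
rewrite -tenmM comp1m compm1 (compA (ev x)) ev_rdualm -compA -tenmM.
by rewrite comp1m compm1.
Qed.

Lemma rdualm1 x : rdualm (idm x) = idm (rdual x).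
Proof. by apply: ev_inj; rewrite ev_rdualm. Qed.

Lemma rdualm_is_iso x y (f : hom x y) : is_iso f -> is_iso (rdualm f).
Proof.
move=> [g [gf fg]]; exists (rdualm g).
by split; rewrite -rdualm_comp ?gf ?fg rdualm1.
Qed.

Lemma nest_tenm y' x' x y v' u' u v (p : hom (y' ⊗ y) (one C))
    (q : hom (x' ⊗ x) (one C)) (a : hom v' y') (b : hom u' x') (c : hom u x)
    (d : hom v y) :
  nest p q ∘ ((a ⊠ b) ⊠ (c ⊠ d)) = nest (p ∘ (a ⊠ d)) (q ∘ (b ⊠ c)).
Proof.
rewrite /nest -?compA assocN (compA (idm y' ⊠ _)) -tenmM comp1m.
rewrite (postcomp (esym (tenmM _ _ _ _))) -?compA compm1.
have := lassoc'N L b c d => /= ->.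
rewrite (postcomp (esym (lunN _))) -?compA; congr (p ∘ ((_ ⊠ (_ ∘ _)) ∘ _)).
by rewrite !compA -!tenmM !comp1m !compm1.
Qed.

End RCurry.

Section LCurry.
Variables (k : fieldType) (C : rigidcat k).
Implicit Types x y z w : C.
Local Notation L := (regular C).

Lemma lcurryK w x (h : hom (x ⊗ w) (one C)) :
  ev' x ∘ (idm x ⊠ lcurry h) = h.
Proof. exact: (@rcurryK k (revr C)). Qed.

Lemma ev'_inj w x (f g : hom w (ldual x)) :
  ev' x ∘ (idm x ⊠ f) = ev' x ∘ (idm x ⊠ g) -> f = g.
Proof. exact: (@ev_inj k (revr C)). Qed.

Lemma ldualm_is_iso x y (f : hom x y) : is_iso f -> is_iso (ldualm f).
Proof. exact: (@rdualm_is_iso k (revr C)). Qed.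

Lemma ev_rl_dual x : ev (ldual x) ∘ (rl_dual x ⊠ idm (ldual x)) = ev' x.
Proof. exact: rcurryK. Qed.

Definition lr_dual x : hom x (ldual (rdual x)) := lcurry (ev x).

(** Both x, by means of [ev'] and [coev'], and the right dual of ^*x are right duals of ^*x; the
    inverse is the comparison map in the other direction. *)
Lemma rl_dual_is_iso x : is_iso (rl_dual x).
Proof.
exists (lun x ∘ (ev (ldual x) ⊠ idm x) ∘ assoc' _ (ldual x) x
  ∘ (idm _ ⊠ coev' x) ∘ run' _); split.
  apply: regular_inj => m; rewrite lactm_idr (cap_zag L) -compA.
  rewrite lactm_swap compA -[idm (lact _ (ldual x) _)]lactm1 -cap_ten.
  by rewrite ev_rl_dual ev'_coev' lactm1.
apply: ev_inj; rewrite tenm_idr compA ev_rl_dual; apply: cap_inj => m.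
rewrite cap_ten lactm1 (cap_zag L) (postcomp (esym (capN L _ _))) -compA.
by rewrite -lactm_idl coev'_ev' !lactm1 tenm1 !compm1.
Qed.

Lemma ev_slide x y (f : hom x y) v w (a : hom v (rdual y)) (b : hom w x) :
  ev x ∘ ((rdualm f ∘ a) ⊠ b) = ev y ∘ (a ⊠ (f ∘ b)).
Proof.
rewrite -[b]comp1m tenmM compA ev_rdualm -compA -tenmM comp1m.
by rewrite comp1m.
Qed.

Lemma ev_rcurry x w (h : hom (w ⊗ x) (one C)) v u (a : hom v w) (b : hom u x) :
  ev x ∘ ((rcurry h ∘ a) ⊠ b) = h ∘ (a ⊠ b).
Proof. by rewrite -[b]comp1m tenmM compA rcurryK comp1m. Qed.

Lemma ev_rl x v w (a : hom v x) (b : hom w (ldual x)) :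
  ev (ldual x) ∘ ((rl_dual x ∘ a) ⊠ b) = ev' x ∘ (a ⊠ b).
Proof. exact: ev_rcurry. Qed.

End LCurry.

Section Slides.
Variables (k : fieldType) (C : rigidcat k).
Implicit Types x y z w : C.

Lemma ev'_slide x y (f : hom x y) v w (a : hom v x) (b : hom w (ldual y)) :
  ev' x ∘ (a ⊠ (ldualm f ∘ b)) = ev' y ∘ ((f ∘ a) ⊠ b).
Proof. exact: (@ev_slide k (revr C)). Qed.

Lemma ev'_lcurry x w (h : hom (x ⊗ w) (one C)) v u (a : hom v w) (b : hom u x) :
  ev' x ∘ (b ⊠ (lcurry h ∘ a)) = h ∘ (b ⊠ a).
Proof. exact: (@ev_rcurry k (revr C)). Qed.

Lemma ev'_lr x v w (a : hom v x) (b : hom w (rdual x)) :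
  ev' (rdual x) ∘ (b ⊠ (lr_dual x ∘ a)) = ev x ∘ (b ⊠ a).
Proof. exact: ev'_lcurry. Qed.

Lemma lr_dual_is_iso x : is_iso (lr_dual x).
Proof. exact: (@rl_dual_is_iso k (revr C)). Qed.

Lemma rl_dualN x y (f : hom x y) :
  rl_dual y ∘ f = rdualm (ldualm f) ∘ rl_dual x.
Proof.
apply: ev_inj; rewrite ev_rl ev_slide -[rl_dual x]compm1 ev_rl ev'_slide.
by rewrite compm1.
Qed.

Lemma lr_rl_dual x : rdualm (lr_dual x) ∘ rl_dual (rdual x) = idm (rdual x).
Proof.
apply: ev_inj; rewrite ev_slide -[rl_dual _]compm1 ev_rl.
by rewrite ev'_lr.
Qed.

Lemma ldual_ten_rl x y :
  rdualm (ldual_ten x y) ∘ rl_dual (x ⊗ y)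
  = rdual_ten (ldual y) (ldual x) ∘ (rl_dual x ⊠ rl_dual y).
Proof.
apply: ev_inj; rewrite ev_slide -[rl_dual (x ⊗ y)]compm1 ev_rl ev'_lcurry.
rewrite ev_rcurry !tenm1 compm1 -tenm1 nest_tenm.
by rewrite -[rl_dual x]compm1 -[rl_dual y]compm1 !ev_rl !tenm1 !compm1.
Qed.

End Slides.

Section Unit.
Variables (k : fieldType) (C : moncat k).

Lemma run_one : run (one C) = lun (one C).
Proof.
have E : idm (one C) ⊠ lun (one C) = lun (one C ⊗ one C).
  by apply: (iso_monoI (lunit_is_iso (regular C) (one C))); rewrite /= lunN.
apply: tenm_oner_inj; apply: (iso_epiI (f := assoc' (one C) (one C) (one C))).
  exact: (lassoc'_is_iso (regular C)).
by rewrite ten_triangle' E -lun_ten -compA (assocK _ _ _).2 compm1.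
Qed.

End Unit.

Lemma cap_nest_rev (k : fieldType) (C : rigidcat k) (M : lincat k)
    (L : laction C M) (y' x' x y : C)
    (p : hom (y' ⊗ y) (one C)) (q : hom (x' ⊗ x) (one C)) m :
  cap L (p ∘ ((run y' ∘ (idm y' ⊠ q) ∘ assoc y' x' x) ⊠ idm y)
    ∘ assoc' (y' ⊗ x') x y) m = cap L (nest p q) m.
Proof.
set r := run y' ∘ _ ∘ _; rewrite cap_nest 2!capE 2!lactm_idr -?compA.
congr (_ ∘ (_ ∘ _)); apply: (iso_monoI (lassoc_is_iso L _ _ _)).
rewrite (postcomp (lassocN L _ _ _)) (postcomp (lassocV L _ _ _)) comp1m.
rewrite lactm1 lact_cap -?compA.
rewrite (postcomp3 (esym (lpentagon' L (y' ⊗ x') x y m))).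
rewrite -?compA lassocV compm1 lactm_idl -?compA.
have := lassocN L (idm y') (idm x') (lassoc L x y m).
by rewrite tenm1 => ->; rewrite !capE !lactm_idl -?compA.
Qed.

(** [nest] absorbs the value of q into y from the left, its reversal absorbs it into y' from the
    right. As they agree, the structure maps built from [nest] for right duals in the reversed
    category are those for left duals. *)
Lemma nest_rev (k : fieldType) (C : rigidcat k) (y' x' x y : C)
    (p : hom (y' ⊗ y) (one C)) (q : hom (x' ⊗ x) (one C)) :
  @nest k (revr C) y x x' y' p q = nest p q.
Proof. by apply: (cap_inj (D := C)) => m; rewrite -cap_nest_rev. Qed.

(** * Pivotal structures and traces *)

Section PivotalPairings.
Variables (k : fieldType) (C : pivcat k).
Implicit Types x y z w : C.
Local Notation L := (regular C).

(** The pivotal structure makes x^* a left dual of x and ^*x a right dual. [evp] and [evq] are the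
    evaluations of these further dualities; later arguments use the pivotal structure mostly through
    them. *)
Definition evp x : hom (x ⊗ rdual x) (one C) :=
  locked_with cap_key (ev (rdual x) ∘ (piv x ⊠ idm (rdual x))).

Definition evq x : hom (ldual x ⊗ x) (one C) :=
  locked_with cap_key (ev x ∘ (piv_lr x ⊠ idm x)).

Lemma evpE x : evp x = ev (rdual x) ∘ (piv x ⊠ idm (rdual x)).
Proof. by rewrite /evp locked_withE. Qed.

Lemma evqE x : evq x = ev x ∘ (piv_lr x ⊠ idm x).
Proof. by rewrite /evq locked_withE. Qed.

Lemma evpN x y (f : hom x y) v w (a : hom v x) (b : hom w (rdual y)) :
  evp y ∘ ((f ∘ a) ⊠ b) = evp x ∘ (a ⊠ (rdualm f ∘ b)).
Proof.
by rewrite !evpE -[LHS]compA -[RHS]compA -!tenmM !comp1m compA pivN -compA ev_slide.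
Qed.

Lemma cap_evp (M : lincat k) (K : laction C M) x m :
  cap K (evp x) m = cap K (ev (rdual x)) m ∘ (lactm K (piv x) (idm _)).
Proof. by rewrite evpE cap_ten lactm1. Qed.

(** Since x is the right dual of ^*x by [rl_dual], statements on [evq] reduce to those on [evp] at
    ^*x. *)
Lemma evq_rl x : evq x = evp (ldual x) ∘ (idm (ldual x) ⊠ rl_dual x).
Proof.
rewrite evqE evpE /piv_lr ev_slide compm1 -compA -tenmM.
by rewrite compm1 comp1m.
Qed.

Lemma evqN x y (f : hom x y) v w (a : hom v (ldual y)) (b : hom w x) :
  evq y ∘ (a ⊠ (f ∘ b)) = evq x ∘ ((ldualm f ∘ a) ⊠ b).
Proof.
rewrite !evq_rl -[LHS]compA -[RHS]compA -!tenmM !comp1m compA rl_dualN -compA -evpN.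
by [].
Qed.

Lemma evp_ten x y v w (a : hom v _) (b : hom w _) :
  evp (x ⊗ y) ∘ (a ⊠ (rdual_ten x y ∘ b))
  = nest (evp x) (evp y) ∘ (a ⊠ b).
Proof.
rewrite !evpE -[LHS]compA -tenmM comp1m -ev_slide compA piv_ten.
rewrite -compA ev_rcurry -nest_tenm tenm1 -compA -tenmM comp1m.
by [].
Qed.

Lemma evp_one v w (a : hom v _) (b : hom w _) :
  evp (one C) ∘ (a ⊠ (rdual_one C ∘ b)) = lun (one C) ∘ (a ⊠ b).
Proof.
rewrite !evpE -[LHS]compA -tenmM comp1m -ev_slide compA piv_one.
by rewrite ev_rcurry.
Qed.

Lemma evq_ten x y v w (a : hom v _) (b : hom w _) :
  evq (x ⊗ y) ∘ ((ldual_ten x y ∘ a) ⊠ b)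
  = nest (evq y) (evq x) ∘ (a ⊠ b).
Proof.
rewrite evq_rl -compA -tenmM comp1m evpN compA ldual_ten_rl -compA evp_ten.
rewrite -[a]comp1m tenmM !comp1m compA.
rewrite -tenm1 nest_tenm -!evq_rl.
by [].
Qed.

Definition ldual_one : hom (one C) (ldual (one C)) := lcurry (run (one C)).

Lemma ldual_one_rl : rdualm ldual_one ∘ rl_dual (one C) = rdual_one C.
Proof.
apply: ev_inj; rewrite ev_slide -[rl_dual _]compm1 ev_rl compm1.
rewrite lcurryK /rdual_one rcurryK.
exact: run_one.
Qed.

(** The dual of an evaluation is a coevaluation, up to the structure maps of duality. *)
Lemma coev_rdual_ten x :
  rdualm (ev x) ∘ rdual_one C
  = rdual_ten (rdual x) x ∘ coev (rdual x).
Proof.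
apply: ev_inj; rewrite ev_slide compm1 -[rdual_one C]compm1 ev_rcurry.
rewrite ev_rcurry; apply: cap_inj => m; rewrite !cap_ten.
rewrite lactm1 cap_nest cap_lun -?compA lunitN cup_lunit lactm_idl -?compA.
rewrite (postcomp (cupN _ _ _)) -?compA (postcomp (coev_ev _ _ _)) comp1m.
by rewrite !compA cap_lassoc -?compA.
Qed.

(** In terms of the pivotal structure a this says that the dual of a_x is inverse to a at x^*, a
    consequence of a being monoidal. *)
Lemma evp_piv x v w (a : hom v _) (b : hom w _) :
  evp (rdual x) ∘ (a ⊠ (piv x ∘ b)) = ev x ∘ (a ⊠ b).
Proof.
suff -> : ev x = evp (rdual x) ∘ (idm _ ⊠ piv x).
  by rewrite -[RHS]compA -tenmM comp1m.
(* Naturality of the pivotal structure at ev_x : x^* ⊗ x -> 1. Monoidality then splits the right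
   side into pairings for x^* and for x, from which a coevaluation is removed. *)
have E : evp (one C) ∘ (ev x ⊠ rdual_one C)
    = evp (rdual x ⊗ x) ∘ (idm _ ⊠ (rdualm (ev x) ∘ rdual_one C)).
  by rewrite -{1}[ev x]compm1 evpN.
move: E; rewrite coev_rdual_ten evp_ten -[rdual_one C]compm1 evp_one => E.
apply: cap_inj => m.
apply: (iso_epiI (lassoc_is_iso L _ _ _)).
apply: (iso_epiI (lactm_is_iso L (is_iso_id _) (lunit_is_iso L m))).
have := congr1 (fun h => cap L h m) E.
rewrite (cap_ten L (lun _)) (cap_ten L (nest _ _)) cap_lun lunit_one -?compA.
rewrite lactm1 lactm_swap compA -cap_lassoc -compA => ->.
rewrite (cap_ten L (evp _)) cap_nest -?compA.
have -> : lassoc L (rdual x) x (lact L (rdual x ⊗ rdual (rdual x)) m)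
    ∘ lactm L (idm (rdual x ⊗ x)) (lactm L (coev (rdual x)) (idm m))
  = lactm L (idm _) (lactm L (idm _) (lactm L (coev (rdual x)) (idm m)))
    ∘ lassoc L (rdual x) x (lact L (one C) m).
  by rewrite -lassocN tenm1.
rewrite lactm_idl -?compA; congr (_ ∘ _).
rewrite !compA -!lactm_idl.
have -> : cap L (evp x) _ ∘ lactm L (idm x) (lassoc L (rdual x) _ m)
    ∘ lactm L (idm x) (lactm L (coev (rdual x)) (idm m))
  = lactm L (piv x) (idm m) ∘ lactm L (idm x) (lunit L m).
  rewrite -compA -lactm_idl cup_lunit lactm_idl compA cap_evp; congr (_ ∘ _).
  by rewrite -compA -lactm_swap compA ev_coev comp1m.
rewrite lactm_idl -?compA; congr (_ ∘ _).
by rewrite -lassocN tenm1.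
Qed.

Lemma evp_piv_lr x v w (a : hom v _) (b : hom w _) :
  evp x ∘ (a ⊠ (piv_lr x ∘ b)) = ev' x ∘ (a ⊠ b).
Proof. by rewrite /piv_lr -compA -evpN evp_piv ev_rl. Qed.

Lemma ev_piv_lr x v w (a : hom v _) (b : hom w _) :
  ev x ∘ ((piv_lr x ∘ a) ⊠ b) = evq x ∘ (a ⊠ b).
Proof. by rewrite evqE -compA -tenmM comp1m. Qed.

Lemma ev'_piv_ll x v w (a : hom v _) (b : hom w _) :
  ev' (ldual x) ∘ (a ⊠ (piv_ll x ∘ b)) = evq x ∘ (a ⊠ b).
Proof. by rewrite /piv_ll ev'_lcurry -evqE. Qed.

Lemma piv_is_iso x : is_iso (piv x).
Proof. by exists (piv' x); apply: pivK. Qed.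

Lemma piv_lr_is_iso x : is_iso (piv_lr x).
Proof.
exact: comp_is_iso (rdualm_is_iso (rl_dual_is_iso x)) (piv_is_iso _).
Qed.

Lemma piv_llE x : piv_ll x = ldualm (piv_lr x) ∘ lr_dual x.
Proof.
apply: ev'_inj; rewrite ev'_slide -[piv_ll x]compm1 ev'_piv_ll compm1.
by rewrite -[lr_dual x]compm1 ev'_lr tenm1 compm1 evqE.
Qed.

Lemma piv_ll_is_iso x : is_iso (piv_ll x).
Proof.
rewrite piv_llE.
exact: comp_is_iso (ldualm_is_iso (piv_lr_is_iso x)) (lr_dual_is_iso x).
Qed.

Definition piv_ll' x : hom (ldual (ldual x)) x :=
  proj1_sig (constructive_indefinite_description _ (piv_ll_is_iso x)).

Lemma piv_llK x : is_inverse (piv_ll x) (piv_ll' x).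
Proof.
exact: proj2_sig (constructive_indefinite_description _ (piv_ll_is_iso x)).
Qed.

Lemma piv_llN x y (f : hom x y) :
  piv_ll y ∘ f = ldualm (ldualm f) ∘ piv_ll x.
Proof.
apply: ev'_inj; rewrite ev'_slide ev'_piv_ll -[piv_ll x]compm1 ev'_piv_ll.
by rewrite -[in LHS](compm1 f) evqN.
Qed.

Lemma piv_ll_ten x y :
  ldualm (ldual_ten y x) ∘ piv_ll (y ⊗ x)
  = ldual_ten (ldual x) (ldual y) ∘ (piv_ll y ⊠ piv_ll x).
Proof.
apply: ev'_inj; rewrite ev'_slide -[piv_ll _]compm1 ev'_piv_ll evq_ten.
rewrite ev'_lcurry -!tenm1 !nest_tenm.
by rewrite -[piv_ll x]compm1 -[piv_ll y]compm1 !ev'_piv_ll.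
Qed.

Lemma piv_ll_one : ldualm ldual_one ∘ piv_ll (one C) = ldual_one.
Proof.
apply: ev'_inj; rewrite ev'_slide -[piv_ll _]compm1 ev'_piv_ll compm1.
rewrite lcurryK evq_rl -compA -tenmM comp1m compm1 -[ldual_one]compm1 evpN.
rewrite ldual_one_rl -[rdual_one C]compm1 evp_one tenm1 compm1.
exact: esym (run_one C).
Qed.

End PivotalPairings.

Section ReversePivotal.
Variable k : fieldType.

(** The double right dual of the reversed category is ^**x, so the pivotal structure has to be
    [piv_ll]. It exchanges [evp] with [evq], and hence the right trace with the left one. *)
Definition revp (C : pivcat k) : pivcat k.
Proof.
refine (@Pivcat k (revr C) (@piv_ll k C) (@piv_ll' k C) (@piv_llK k C)
  (@piv_llN k C) _ _).
- move=> x y; rewrite /rdual_ten !nest_rev.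
  exact: piv_ll_ten.
- exact: piv_ll_one.
Defined.

Lemma evp_rev (C : pivcat k) (x : C) : @evp k (revp C) x = evq x.
Proof.
by rewrite evpE; rewrite -[RHS]compm1 -tenm1 -ev'_piv_ll compm1.
Qed.

Lemma evq_rev (C : pivcat k) (x : C) : @evq k (revp C) x = evp x.
Proof.
have E : ev' x ∘ (idm x ⊠ (ldualm (lr_dual x) ∘ piv_ll (rdual x))) = evp x.
  rewrite ev'_slide compm1 -[piv_ll _]compm1 ev'_piv_ll evq_rl -compA -tenmM.
  by rewrite comp1m -[lr_dual x]compm1 evpN compm1 lr_rl_dual tenm1 compm1.
by rewrite evqE; exact: E.
Qed.

End ReversePivotal.

Section ActionOfCups.
Variables (k : fieldType) (D : moncat k) (M : lincat k) (L : laction D M).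
Implicit Types (x y z : D).

Lemma cup_lact x y z (c : hom (one D) (x ⊗ y)) m :
  lactm L (idm x) (lassoc L y z m) ∘ (lassoc L x (y ⊗ z) m
    ∘ lactm L (assoc x y z ∘ ((c ⊠ idm z) ∘ lun' z)) (idm m))
  = cup L c (lact L z m).
Proof.
rewrite compA lpentagon' 2!lactm_idr -?compA.
rewrite (compA (lactm L (assoc' _ _ _) _)) -lactm_idr (assocK _ _ _).1 lactm1.
rewrite comp1m (postcomp (lassocN L _ _ _)) lactm1 -?compA lunit'_lact.
by rewrite cupE -?compA.
Qed.

Lemma lact_cup x y z (c : hom (one D) (x ⊗ y)) m :
  lassoc L z x (lact L y m) ∘ (lassoc L (z ⊗ x) y m
    ∘ lactm L (assoc' z x y ∘ ((idm z ⊠ c) ∘ run' z)) (idm m))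
  = lactm L (idm z) (cup L c m).
Proof.
rewrite 2!lactm_idr compA lact_pentagon -?compA.
rewrite (compA (lactm L (assoc _ _ _) _)) -lactm_idr (assocK _ _ _).2 lactm1.
rewrite comp1m (postcomp (lassocN L _ _ _)) -?compA lact_lunit'.
by rewrite cupE !lactm_idl -?compA.
Qed.

Lemma lunit_cap_cup x y (h : hom (x ⊗ y) (one D)) (c : hom (one D) (x ⊗ y)) m :
  lunit L m ∘ lactm L (h ∘ c) (idm m) = cap L h m ∘ cup L c m ∘ lunit L m.
Proof. by rewrite lactm_idr compA -cap_lassoc -?compA cup_lunit. Qed.

Lemma cup_inj x y (c c' : hom (one D) (x ⊗ y)) :
  (forall m, cup (regular D) c m = cup (regular D) c' m) -> c = c'.
Proof.
move=> /(_ (one D)); rewrite !cupE -!compA.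
move=> /(iso_monoI (lassoc_is_iso (regular D) _ _ _)) E.
apply: tenm_oner_inj; apply: iso_epiI E.
by exists (lun (one D)); apply: is_inverse_sym; apply: lunK.
Qed.

End ActionOfCups.

Section Coevaluations.
Variables (k : fieldType) (C : rigidcat k).
Implicit Types x y z w d : C.
Local Notation L := (regular C).

(** [rcurry h] compares z with w^*, and the snake identity on w says that it carries c to the
    coevaluation. *)
Lemma coev_uniq w z (h : hom (z ⊗ w) (one C)) (c : hom (one C) (w ⊗ z)) :
  (forall m, lactm L (idm w) (cap L h m) ∘ cup L c (lact L w m) = idm _) ->
  coev w = (idm w ⊠ rcurry h) ∘ c.
Proof.
move=> E; apply: cup_inj => m; rewrite cup_ten rcurry_lact lactm_idl -compA.
by rewrite cupN compA E comp1m.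
Qed.

Lemma coev_slide x y (f : hom x y) :
  (f ⊠ idm (rdual x)) ∘ coev x = (idm y ⊠ rdualm f) ∘ coev y.
Proof.
apply: cup_inj => m; rewrite !cup_ten lactm1 rcurry_lact cap_ten.
by rewrite -compA -lactm_idl lactm_idl -compA cupN compA coev_ev comp1m.
Qed.

Definition coev_nest x d : hom (one C) ((x ⊗ d) ⊗ (rdual d ⊗ rdual x)) :=
  assoc' x d _ ∘ ((idm x ⊠ (assoc d (rdual d) (rdual x)
    ∘ ((coev d ⊠ idm (rdual x)) ∘ lun' _))) ∘ coev x).

Lemma cup_coev_nest (M : lincat k) (K : laction C M) x d m :
  lactm K (idm _) (lassoc K (rdual d) (rdual x) m) ∘ cup K (coev_nest x d) m
  = lassoc' K x d _ ∘ (lactm K (idm x) (cup K (coev d) _) ∘ cup K (coev x) m).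
Proof.
rewrite (cupE K (coev_nest _ _)) /coev_nest -?compA 2!lactm_idr.
rewrite -?compA (postcomp (lassoc_assoc' K _ _ _ _)) -?compA (postcomp (lassocN K _ _ _)) -?compA.
rewrite -[idm (x ⊗ d)]tenm1 (postcomp (esym (lassoc'N K _ _ _))) -?compA.
congr (_ ∘ _); rewrite (postcomp (esym (lactm_idl K _ _ _))).
rewrite (postcomp (esym (lactm_idl K _ _ _))) -?compA cup_lact.
by rewrite (cupE K (coev x)) -?compA.
Qed.

Lemma coev_ten x d :
  coev (x ⊗ d) = (idm (x ⊗ d) ⊠ rdual_ten x d) ∘ coev_nest x d.
Proof.
apply: coev_uniq => m; rewrite cap_nest.
rewrite !(lactm_idl L (x ⊗ d)) -?compA cup_coev_nest.
set A := cap L (ev d) _; set F := cap L (ev x) _.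
rewrite -[idm (x ⊗ d)]tenm1.
do 2! rewrite (postcomp (esym (lassoc'N L _ _ _))) -?compA.
do 2! rewrite (postcomp (esym (lactm_idl L _ _ _))) -?compA.
rewrite cupN (compA (lactm L _ A)) coev_ev comp1m.
rewrite lactm_idl -?compA cupN (postcomp (coev_ev L _ _)) comp1m.
by rewrite lassoc'V.
Qed.

End Coevaluations.

(** * Traces, partial traces and nondegeneracy *)

Section Traces.
Variables (k : fieldType) (C : pivcat k).
Implicit Types x y z w d : C.
Local Notation L := (regular C).

Lemma traceRE x (f : hom x x) :
  traceR f = evp x ∘ ((f ⊠ idm (rdual x)) ∘ coev x).
Proof.
by rewrite /traceR /piv_rl -[lcurry _]compm1 ev'_lcurry -evpE compA.
Qed.

Lemma traceLE x (f : hom x x) :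
  traceL f = evq x ∘ ((idm (ldual x) ⊠ f) ∘ coev' x).
Proof. by rewrite /traceL -[piv_lr x]compm1 ev_piv_lr compA. Qed.

Lemma traceR_cyclic x y (f : hom x y) (g : hom y x) :
  traceR (g ∘ f) = traceR (f ∘ g).
Proof.
rewrite !traceRE compA evpN compm1.
have -> : evp y ∘ (f ⊠ rdualm g) ∘ coev x
    = evp y ∘ (f ⊠ idm _ ∘ ((idm _ ⊠ rdualm g) ∘ coev x)).
  by rewrite (compA (f ⊠ idm _)) -tenmM compm1 comp1m compA.
by rewrite -coev_slide (compA (f ⊠ _)) -tenm_idr.
Qed.

Definition ptrace x d (v : hom (x ⊗ d) (x ⊗ d)) : hom x x :=
  (run x ∘ (idm x ⊠ evp d) ∘ assoc x d (rdual d)) ∘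
  ((v ⊠ idm (rdual d)) ∘
   (assoc' x d (rdual d) ∘ ((idm x ⊠ coev d) ∘ run' x))).

Lemma ptrace_lact (M : lincat k) (K : laction C M) x d
    (v : hom (x ⊗ d) (x ⊗ d)) m :
  lactm K (ptrace v) (idm m) = lactm K (idm x) (cap K (evp d) m) ∘
   (lassoc K x d _ ∘ (lactm K v (idm _) ∘
     (lassoc' K x d _ ∘ lactm K (idm x) (cup K (coev d) m)))).
Proof.
rewrite /ptrace lactm_idr (lactm_idr K _ (v ⊠ _)) lact_cap -lact_cup -?compA.
congr (_ ∘ (_ ∘ _)).
rewrite (postcomp (lassoc'V _ _ _ _)) comp1m (postcomp (lassocN _ _ _ _)).
by rewrite lactm1 -?compA.
Qed.

(** The coevaluation of x ⊗ d is that of d nested in that of x ([coev_ten]), and [evp] nests in the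
    same way because the pivotal structure is monoidal ([evp_ten]). So d can be closed up before
    x. *)
Lemma traceR_ptrace x d (v : hom (x ⊗ d) (x ⊗ d)) :
  traceR v = traceR (ptrace v).
Proof.
apply: regular_inj => m; apply: (iso_monoI (lunit_is_iso L m)).
rewrite !traceRE !lunit_cap_cup; congr (_ ∘ _).
have E : cap L (evp (x ⊗ d)) m ∘ lactm L (idm _) (lactm L (rdual_ten x d) (idm m))
    = cap L (nest (evp x) (evp d)) m.
  rewrite -cap_ten; congr (cap L _ m).
  have := evp_ten (x := x) (y := d) (idm _) (idm _).
  by rewrite compm1 tenm1 compm1.
rewrite coev_ten !cup_ten !lactm1 (compA (lactm L v _)) -lactm_swap -?compA.
rewrite (postcomp E) cap_nest ptrace_lact lactm_idl -?compA.
rewrite -cup_coev_nest (postcomp (esym (lassocN L _ _ _))) -?compA tenm1.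
by rewrite (compA (lactm L v _)) -lactm_swap -?compA.
Qed.

(* The functions f |-> f ⊠ 1 ∘ coev and g |-> evp ∘ (g ⊠ 1) turn the trace
   pairing into the composition pairing of Hom(1, y ⊗ x^* ) and
   Hom(y ⊗ x^*, 1). *)
Lemma coev_faithful x y (f : hom x y) :
  (f ⊠ idm (rdual x)) ∘ coev x = 0 -> f = 0.
Proof.
move=> E; apply: regular_inj => m; rewrite lactm0l.
rewrite -[LHS]compm1 -(coev_ev L) compA -lactm_swap -compA.
by rewrite -[idm (lact L (rdual x) _)]lactm1 -cup_ten E cupE lactm0l compm0 comp0m compm0.
Qed.

Lemma evp_full x y (q : hom (y ⊗ rdual x) (one C)) :
  exists g : hom y x, evp x ∘ (g ⊠ idm _) = q.
Proof.
exists (piv' x ∘ rcurry q).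
rewrite evpE -compA -tenmM comp1m compA (pivK x).2 -[idm _ ∘ _]compm1 comp1m.
by rewrite ev_rcurry tenm1 compm1.
Qed.

Lemma traceR_nondegenerate x y (f : hom x y) :
  (forall (w : C) (c : hom (one C) w), (forall q : hom w (one C), q ∘ c = 0) ->
     c = 0) ->
  (forall g : hom y x, traceR (g ∘ f) = 0) -> f = 0.
Proof.
move=> nd tr0; apply: coev_faithful; apply: nd => q.
have [g <-] := evp_full q.
by rewrite -compA (compA (g ⊠ _)) -tenm_idr -traceRE.
Qed.

End Traces.

Lemma traceL_rev (k : fieldType) (C : pivcat k) (x : C) (f : hom x x) :
  traceL f = @traceR k (revp C) x f.
Proof.
by rewrite traceLE traceRE evp_rev.
Qed.

(** * Inner homs and their counits *)

Section InnerHoms.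
Variables (k : fieldType) (D : pivcat k) (M : lincat k) (L : laction D M).
Local Notation "d ▷ m" := (lact L d m) (at level 38, right associativity).
Local Notation "f ▶ g" := (lactm L f g) (at level 38, right associativity).
Implicit Types (d x y : D) (m n : M).
Variable H : linner L.
Local Notation "⟨ m , n ⟩" := (linn H m n).
Local Notation u := (lun_inn H).

Lemma lcreateE m d : lcreate L m d = cup L (coev' d) m.
Proof. by rewrite cupE. Qed.

Lemma lsharpE m n d (h : hom ⟨m, n⟩ d) : lsharp H h = (h ▶ idm n) ∘ u m n.
Proof.
rewrite -[RHS](lflatK H) lflatN (lsharpK (idm _)) compm1.
by [].
Qed.

Lemma lflat_lun m n d (f : hom m (d ▷ n)) : (lflat H f ▶ idm n) ∘ u m n = f.
Proof. by rewrite -lsharpE lflatK. Qed.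

Lemma linn_inj m n d (h h' : hom ⟨m, n⟩ d) :
  (h ▶ idm n) ∘ u m n = (h' ▶ idm n) ∘ u m n -> h = h'.
Proof. by rewrite -!lsharpE => /(can_inj (@lsharpK _ _ _ _ H _ _ _)). Qed.

Lemma linn_map_lun m m' n n' (f : hom m m') (g : hom n' n) :
  (linn_map H f g ▶ idm n) ∘ u m n = (idm _ ▶ g) ∘ (u m' n' ∘ f).
Proof. by rewrite lflat_lun compA. Qed.

Lemma linn_left'_lun d m n :
  (linn_left' H d m n ▶ idm n) ∘ u (d ▷ m) n
  = lassoc' L d _ n ∘ (idm d ▶ u m n).
Proof. exact: lflat_lun. Qed.

Lemma linn_right'_lun n m d :
  (linn_right' H n m d ▶ idm (d ▷ m)) ∘ u n (d ▷ m)
  = lassoc' L _ (ldual d) (d ▷ m) ∘ ((idm _ ▶ cup L (coev' d) m) ∘ u n m).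
Proof. by rewrite lflat_lun compA lcreateE. Qed.

Lemma linn_left_lun d m n :
  (linn_left H d m n ▶ idm n) ∘ (lassoc' L d _ n ∘ (idm d ▶ u m n))
  = u (d ▷ m) n.
Proof.
rewrite /linn_left lactm_idr cap_lact -?compA.
rewrite (postcomp (lassocN L _ _ _)) -?compA (postcomp (lassocV L _ _ _)).
rewrite comp1m -lactm_idl -[lactm L (idm d) _ ∘ _]lactm_idl.
rewrite lflat_lun -?compA lcreateE (postcomp (lassocV L _ _ _)) comp1m.
by rewrite lactm_idl compA capN -compA ev'_coev' compm1.
Qed.

(** The morphism whose transpose is [linn_right]. It is the one that the universal property of ⟨m,n⟩
    describes directly. *)
Definition linn_right_aux m n d : hom ⟨m, n⟩ (⟨m, rdual d ▷ n⟩ ⊗ rdual d) :=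
  lflat H (lassoc' L _ (rdual d) n ∘ u m (rdual d ▷ n)).

Lemma linn_right_aux_lun m n d :
  (linn_right_aux m n d ▶ idm n) ∘ u m n
  = lassoc' L _ (rdual d) n ∘ u m (rdual d ▷ n).
Proof. exact: lflat_lun. Qed.

Lemma linn_right_lact (N : lincat k) (K : laction D N) m n d p :
  lactm K (linn_right H m n d) (idm p)
  = lactm K (idm _) (cap K (ev d) p) ∘ (lassoc K _ (rdual d) (lact K d p)
    ∘ (lactm K (linn_right_aux m n d) (idm (lact K d p)) ∘ lassoc K _ d p)).
Proof.
rewrite /linn_right lactm_idr lact_cap -/(linn_right_aux _ _ _) -?compA.
by rewrite lassocN lactm1.
Qed.

(* Hom(x ⊗ ⟨n,m⟩, 1) = Hom(x ▷ n, m) *)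
Definition pairing_act x m n (h : hom (x ⊗ ⟨n, m⟩) (one D)) : hom (x ▷ n) m :=
  cap L h m ∘ (idm x ▶ u n m).

Lemma pairing_act_inj x m n (h h' : hom (x ⊗ ⟨n, m⟩) (one D)) :
  pairing_act h = pairing_act h' -> h = h'.
Proof.
rewrite /pairing_act => E; rewrite -[h]lcurryK -[h']lcurryK.
suff -> : lcurry h = lcurry h' by [].
apply: linn_inj; rewrite !lcurry_lact -!compA -!cupN !compA -!lactm_idl E.
by [].
Qed.

Definition act_pairing x m n (f : hom (x ▷ n) m) : hom (x ⊗ ⟨n, m⟩) (one D) :=
  ev' x ∘ (idm x ⊠ lflat H ((idm (ldual x) ▶ f) ∘ cup L (coev' x) n)).

Lemma act_pairingK x m n (f : hom (x ▷ n) m) :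
  pairing_act (act_pairing f) = f.
Proof.
rewrite /pairing_act /act_pairing cap_ten -compA -lactm_idl lflat_lun.
by rewrite lactm_idl compA capN -compA ev'_coev' compm1.
Qed.

Lemma pairing_act_comp x y m n (h : hom (x ⊗ ⟨n, m⟩) (one D)) (f : hom y x) :
  pairing_act (h ∘ (f ⊠ idm _)) = pairing_act h ∘ (f ▶ idm n).
Proof.
by rewrite /pairing_act cap_ten lactm1 -compA -lactm_swap compA.
Qed.

(* An isomorphism ⟨m,n⟩ -> ⟨n,m⟩^* amounts to a morphism ⟨m,n⟩ ▷ n -> m
   exhibiting ⟨m,n⟩ as a right adjoint of the action on n as well; it is encoded
   by the intermediate pairing ⟨m,n⟩ ⊗ ⟨n,m⟩ -> 1. *)
Record counit := Counit {
  cun :> forall m n, hom (⟨m, n⟩ ▷ n) m;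
  cun_nat : forall m m' n n' (f : hom m m') (g : hom n' n),
    cun m' n' ∘ (linn_map H f g ▶ idm n') = f ∘ (cun m n ∘ (idm _ ▶ g));
  cun_left : forall d m n,
    cun (d ▷ m) n ∘ (linn_left H d m n ▶ idm n)
    = (idm d ▶ cun m n) ∘ lassoc L d _ n;
  cun_right : forall m n d,
    cun m (rdual d ▷ n) ∘ (linn_right H m n d ▶ idm _)
    = cun m n ∘ ((idm _ ▶ cap L (evp d) n) ∘ lassoc L _ d (rdual d ▷ n));
  cun_bij : forall m n d,
    bijective (fun g : hom d ⟨m, n⟩ => cun m n ∘ (g ▶ idm n)) }.

Variable psi : counit.

Definition counit_form m n : hom (⟨m, n⟩ ⊗ ⟨n, m⟩) (one D) :=
  act_pairing (psi m n).

Definition counit_iso m n : hom ⟨m, n⟩ (rdual ⟨n, m⟩) :=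
  rcurry (counit_form m n).

Lemma pairing_act_form x m n (f : hom x ⟨m, n⟩) :
  pairing_act (counit_form m n ∘ (f ⊠ idm _)) = psi m n ∘ (f ▶ idm n).
Proof. by rewrite pairing_act_comp act_pairingK. Qed.

(** By the Yoneda lemma: composition with [counit_iso] is the bijection [cun_bij] from Hom(w, ⟨m,n⟩)
    to Hom(w ▷ n, m), followed by the two adjunctions to Hom(w, ⟨n,m⟩^* ). *)
Lemma counit_iso_is_iso m n : is_iso (counit_iso m n).
Proof.
apply: is_iso_postcomp => w; have [inv gK invK] := cun_bij psi m n w.
exists (fun t => inv (pairing_act (ev _ ∘ (t ⊠ idm ⟨n, m⟩)))) => g.
  by rewrite ev_rcurry pairing_act_form gK.
apply: ev_inj; rewrite ev_rcurry; apply: pairing_act_inj.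
by rewrite pairing_act_form invK.
Qed.

(** [ev_inj] removes the dual and [pairing_act_inj] the inner hom ⟨n',m'⟩; what remains is an
    equation between morphisms ⟨m,n⟩ ▷ n' -> m', given by [cun_nat]. The next two lemmas proceed in
    the same way. *)
Lemma counit_iso_nat m m' n n' (f : hom m m') (g : hom n' n) :
  counit_iso m' n' ∘ linn_map H f g
  = rdualm (linn_map H g f) ∘ counit_iso m n.
Proof.
apply: ev_inj; rewrite ev_rcurry ev_slide compm1.
rewrite -[counit_iso m n]compm1 ev_rcurry.
apply: pairing_act_inj; rewrite pairing_act_form cun_nat.
rewrite /pairing_act cap_ten -compA -lactm_idl linn_map_lun lactm_idl.
rewrite (compA (cap _ _ _)) capN -compA lactm_idl; congr (_ ∘ _).
by rewrite compA -/(pairing_act _) act_pairingK.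
Qed.

Lemma counit_iso_left d m n :
  counit_iso (d ▷ m) n ∘ linn_left H d m n
  = linn_dual_left H d m n ∘ (idm d ⊠ counit_iso m n).
Proof.
apply: ev_inj; rewrite ev_rcurry -[linn_dual_left _ _ _ _ ∘ _]compA ev_slide.
rewrite compm1 ev_rcurry.
have -> : nest (ev' d) (ev ⟨n, m⟩)
    ∘ ((idm d ⊠ counit_iso m n) ⊠ linn_right' H n m d)
  = nest (ev' d) (counit_form m n) ∘ (idm _ ⊠ linn_right' H n m d).
  rewrite -[linn_right' _ _ _ _]comp1m -[_ ⊠ counit_iso _ _]compm1 tenmM compA.
  rewrite -[idm (_ ⊗ ldual d)]tenm1 nest_tenm rcurryK tenm1 compm1.
  by rewrite tenm1 comp1m.
apply: pairing_act_inj; rewrite pairing_act_form cun_left.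
rewrite /pairing_act cap_ten -compA -lactm_idl linn_right'_lun cap_nest.
rewrite -[idm (d ⊗ _)]tenm1 -[RHS]compA -[X in _ = _ ∘ X]compA lassocN.
rewrite (compA (idm d ▶ _)) -lactm_idl -(compA (cap L (counit_form _ _) _)).
rewrite -lactm_idl (postcomp (lassocV L _ _ _)) comp1m (lactm_idl L ⟨m, n⟩).
rewrite (compA (cap L (counit_form _ _) _)) capN.
rewrite -(compA (cup L (coev' d) m)) -/(pairing_act _) act_pairingK lactm_idl.
by rewrite !compA ev'_coev' comp1m.
Qed.

Lemma counit_iso_right m n d :
  counit_iso m (rdual d ▷ n) ∘ linn_right H m n d
  = linn_dual_right H m n d ∘ (counit_iso m n ⊠ idm d).
Proof.
have -> : linn_dual_right H m n d ∘ (counit_iso m n ⊠ idm d)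
    = rdualm (linn_left' H (rdual d) n m)
      ∘ (rdual_ten (rdual d) ⟨n, m⟩ ∘ (counit_iso m n ⊠ piv d)).
  by rewrite /linn_dual_right -!compA -tenmM comp1m compm1.
apply: ev_inj; rewrite ev_rcurry ev_slide ev_rcurry compm1.
have -> : nest (ev ⟨n, m⟩) (ev (rdual d))
    ∘ ((counit_iso m n ⊠ piv d) ⊠ linn_left' H (rdual d) n m)
  = nest (counit_form m n) (evp d) ∘ (idm _ ⊠ linn_left' H (rdual d) n m).
  rewrite -[linn_left' _ _ _ _]comp1m -[_ ⊠ piv d]compm1 tenmM compA.
  rewrite -[idm (rdual d ⊗ _)]tenm1 nest_tenm rcurryK -evpE tenm1 comp1m.
  by [].
apply: pairing_act_inj; rewrite pairing_act_form cun_right.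
rewrite /pairing_act cap_ten -compA -lactm_idl linn_left'_lun cap_nest.
rewrite -[idm (⟨m, n⟩ ⊗ _)]tenm1 -[RHS]compA -[X in _ = _ ∘ X]compA lassocN.
rewrite (compA (idm _ ▶ _)) -lactm_idl -(compA (cap L (evp _) _)).
rewrite -lactm_idl (postcomp (lassocV L _ _ _)) comp1m capN lactm_idl.
rewrite -[X in _ = _ ∘ X]compA [RHS]compA -/(pairing_act _) act_pairingK.
by [].
Qed.

Definition counit_lpairing_iso :
    lpairing_iso (linn_pairing H) (linn_dual_pairing H) :=
  @LpairingIso _ _ _ _ (linn_pairing H) (linn_dual_pairing H) counit_iso
    counit_iso_is_iso counit_iso_nat counit_iso_left counit_iso_right.

End InnerHoms.

Section LactInjective.
Variables (k : fieldType) (D : pivcat k) (M : lincat k) (L : laction D M).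
Local Notation "d ▷ m" := (lact L d m) (at level 38, right associativity).
Local Notation "f ▶ g" := (lactm L f g) (at level 38, right associativity).
Variable H : linner L.

(* The adjunction between d ▷ - and ^*d ▷ - moves d to the other side. *)
Lemma lact_linn_inj (d t : D) (m n : M) (h h' : hom (d ⊗ linn H m n) t) :
  (h ▶ idm n) ∘ (lassoc' L d _ n ∘ (idm d ▶ lun_inn H m n))
  = (h' ▶ idm n) ∘ (lassoc' L d _ n ∘ (idm d ▶ lun_inn H m n)) -> h = h'.
Proof.
set u := lun_inn H m n; move=> E.
pose cr (h : hom (d ⊗ linn H m n) t) :=
  (idm (ldual d) ⊠ h) ∘ cup (regular D) (coev' d) (linn H m n).
have crK g : cap (regular D) (ev' d) t ∘ (idm d ⊠ cr g) = g.
  have := lactm_idl (regular D) d => /= ->.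
  rewrite compA; have := capN (regular D) (ev' d) => /= ->.
  by rewrite -compA; have := ev'_coev' (regular D) => /= ->; rewrite compm1.
have crE g : lassoc L (ldual d) t n ∘ ((cr g ▶ idm n) ∘ u)
    = (idm _ ▶ ((g ▶ idm n) ∘ (lassoc' L d _ n ∘ (idm d ▶ u))))
      ∘ cup L (coev' d) m.
  rewrite /cr lactm_idr -?compA (postcomp (lassocN L _ _ _)) -?compA.
  rewrite !lactm_idl -?compA cupN; congr (_ ∘ _).
  rewrite -cup_lact cupE -?compA.
  rewrite (postcomp (esym (lactm_idl L _ _ _))) lassoc'V lactm1 comp1m.
  by [].
rewrite -[h]crK -[h']crK; suff -> : cr h = cr h' by [].
apply: linn_inj; apply: (iso_monoI (lassoc_is_iso L _ _ _)).
by rewrite !crE E.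
Qed.

Local Notation u := (lun_inn H).

(** The transpose w of g along the duality of d satisfies the equation that characterizes
    [linn_right_aux]; transposing back gives g. *)
Lemma linn_right_uniq m n d (g : hom (linn H m n ⊗ d) (linn H m (rdual d ▷ n))) :
  (g ▶ idm _) ∘ (lassoc' L _ d _ ∘ ((idm _ ▶ cup L (coev d) n) ∘ u m n))
  = u m (rdual d ▷ n) -> linn_right H m n d = g.
Proof.
move=> E; pose w := (g ⊠ idm (rdual d))
  ∘ (assoc' _ d (rdual d) ∘ ((idm _ ⊠ coev d) ∘ run' _)).
have wE (N : lincat k) (K : laction D N) r :
    lassoc K _ (rdual d) r ∘ lactm K w (idm r)
    = lactm K g (idm _) ∘ (lassoc' K _ d _
      ∘ lactm K (idm _) (cup K (coev d) r)).
  rewrite /w lactm_idr (postcomp (lassocN K _ _ _)) lactm1 -?compA.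
  by rewrite -lact_cup (postcomp (lassoc'V K _ _ _)) comp1m.
have {E} : linn_right_aux H m n d = w.
  apply: linn_inj; rewrite linn_right_aux_lun.
  apply: (iso_monoI (lassoc_is_iso L _ _ _)).
  by rewrite !compA wE lassocV comp1m -?compA E.
move=> E; apply: regular_inj => q.
rewrite linn_right_lact E (postcomp (wE _ _ _)) -?compA.
rewrite (compA (lactm _ (idm _) (cap _ _ _))) lactm_swap -?compA.
have -> : lactm (regular D) (idm (linn H m n ⊗ d)) (cap (regular D) (ev d) q)
  = lassoc' _ _ _ _ ∘ (lactm _ (idm _) (lactm _ (idm _) (cap (regular D) (ev d) q))
    ∘ lassoc _ _ _ _).
  by rewrite compA lassoc'N tenm1 -compA lassoc'V compm1.
rewrite -?compA (postcomp (lassocV _ _ _ _)) comp1m.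
rewrite (compA (lactm _ (idm _) _)) -lactm_idl coev_ev lactm1 comp1m lassoc'V.
by rewrite compm1.
Qed.

End LactInjective.

Section LeftDuals.
Variables (k : fieldType) (C : rigidcat k).
Implicit Types x y n q : C.

Lemma coev'_slide x y (f : hom x y) :
  (idm (ldual x) ⊠ f) ∘ coev' x = (ldualm f ⊠ idm y) ∘ coev' y.
Proof. exact: (@coev_slide k (revr C)). Qed.

Lemma cup_coev'_ten (M : lincat k) (L : laction C M) x n (q : M) :
  cup L (coev' (x ⊗ n)) q
  = lactm L (ldual_ten x n) (idm _) ∘ (lactm L (idm _) (lassoc' L x n q)
    ∘ (lassoc' L (ldual n) (ldual x) _
    ∘ (lactm L (idm _) (cup L (coev' x) (lact L n q)) ∘ cup L (coev' n) q))).
Proof.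
have -> : coev' (x ⊗ n) = (ldual_ten x n ⊠ idm (x ⊗ n))
    ∘ (assoc (ldual n ⊗ ldual x) x n ∘
       (((assoc' (ldual n) (ldual x) x ∘ ((idm (ldual n) ⊠ coev' x) ∘ run' _))
          ⊠ idm n) ∘ coev' n)).
  have := @coev_ten k (revr C) n x.
  by rewrite /rdual_ten nest_rev.
rewrite cup_ten lactm1; congr (_ ∘ _).
set t := assoc' _ (ldual x) x ∘ _.
rewrite cupE !lactm_idr -?compA.
have E : lassoc L (ldual n ⊗ ldual x) (x ⊗ n) q
    ∘ lactm L (assoc (ldual n ⊗ ldual x) x n) (idm q)
  = lactm L (idm _) (lassoc' L x n q)
    ∘ (lassoc L _ x _ ∘ lassoc L (_ ⊗ x) n q).
  rewrite lact_pentagon !compA -lactm_idl lassoc'V lactm1 comp1m.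
  by [].
rewrite (postcomp E) -?compA; congr (_ ∘ _).
rewrite (postcomp (lassocN L _ _ _)) lactm1 -?compA.
rewrite -lact_cup -?compA (postcomp (lassoc'V _ _ _ _)) comp1m -/t.
by rewrite (cupE L (coev' n)) -?compA.
Qed.

Lemma coev'_lr (d : C) :
  coev' (rdual d) = (lr_dual d ⊠ idm (rdual d)) ∘ coev d.
Proof.
apply: cup_inj => m; rewrite cup_ten lactm1 lcurry_lact -compA -cupN compA.
by rewrite -lactm_idl ev_coev lactm1 comp1m.
Qed.

End LeftDuals.

(** * The inner hom m ⊗ ^*n of the category acting on itself *)

Section RegularInnerHom.
Variables (k : fieldType) (C : pivcat k).
Implicit Types (d x y m n q : C).
Local Notation L := (regular C).
Local Notation "d ▷ m" := (lact L d m) (at level 38, right associativity).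
Local Notation "f ▶ g" := (lactm L f g) (at level 38, right associativity).

Definition reg_unit m n : hom m ((m ⊗ ldual n) ⊗ n) :=
  locked_with cap_key (assoc' m (ldual n) n ∘ ((idm m ⊠ coev' n) ∘ run' m)).

Definition reg_counit m n : hom ((m ⊗ ldual n) ⊗ n) m :=
  locked_with cap_key (run m ∘ (idm m ⊠ evq n) ∘ assoc m (ldual n) n).

Definition reg_flat m n d (f : hom m (d ⊗ n)) : hom (m ⊗ ldual n) d :=
  locked_with cap_key
    (run d ∘ (idm d ⊠ ev' n) ∘ assoc d n (ldual n) ∘ (f ⊠ idm (ldual n))).

Definition reg_sharp m n d (g : hom (m ⊗ ldual n) d) : hom m (d ⊗ n) :=
  (g ⊠ idm n) ∘ reg_unit m n.

Lemma reg_unit_lact m n q :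
  lassoc L m (ldual n) (n ▷ q) ∘ (lassoc L _ n q ∘ (reg_unit m n ▶ idm q))
  = idm m ▶ cup L (coev' n) q.
Proof. by rewrite /reg_unit locked_withE lact_cup. Qed.

Lemma reg_counit_lact m n q :
  reg_counit m n ▶ idm q
  = (idm m ▶ cap L (evq n) q) ∘ (lassoc L m (ldual n) (n ▷ q) ∘ lassoc L _ n q).
Proof. by rewrite /reg_counit locked_withE lact_cap. Qed.

Lemma reg_flat_lact m n d (f : hom m (d ⊗ n)) q :
  reg_flat f ▶ idm q
  = (idm d ▶ cap L (ev' n) q) ∘ (lassoc L d n (ldual n ▷ q)
      ∘ ((f ▶ idm (ldual n ▷ q)) ∘ lassoc L m (ldual n) q)).
Proof.
by rewrite /reg_flat locked_withE lactm_idr lact_cap -?compA lassocN lactm1.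
Qed.

Lemma reg_sharpK m n d (g : hom (m ⊗ ldual n) d) : reg_flat (reg_sharp g) = g.
Proof.
apply: regular_inj => q; rewrite reg_flat_lact /reg_sharp lactm_idr -?compA.
rewrite (postcomp (lassocN L _ _ _)) lactm1 -?compA.
rewrite (compA (idm d ▶ _)) lactm_swap -?compA.
have E : (idm (m ⊗ ldual n) ▶ cap L (ev' n) q)
  = lassoc' L m (ldual n) q ∘ ((idm m ▶ (idm (ldual n) ▶ cap L (ev' n) q))
     ∘ lassoc L m (ldual n) _).
  by rewrite -lassocN tenm1 compA lassoc'V comp1m.
rewrite E -?compA (postcomp3 (reg_unit_lact _ _ _)).
rewrite (compA (idm m ▶ _)) -lactm_idl coev'_ev' lactm1 comp1m lassoc'V compm1.
by [].
Qed.

Lemma reg_flatK m n d (f : hom m (d ⊗ n)) : reg_sharp (reg_flat f) = f.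
Proof.
apply: regular_inj => q; rewrite /reg_sharp lactm_idr.
apply: (iso_monoI (lassoc_is_iso L _ _ _)).
rewrite (postcomp (lassocN L _ _ _)) lactm1 -?compA reg_flat_lact -?compA.
rewrite reg_unit_lact -lactm_swap -[idm (d ⊗ n)]tenm1.
rewrite (postcomp (lassocN L _ _ _)) -?compA (compA (idm d ▶ _)) -lactm_idl.
by rewrite ev'_coev' lactm1 comp1m.
Qed.

Lemma reg_flatN m n d d' (u : hom d d') (f : hom m (d ⊗ n)) :
  reg_flat ((u ⊠ idm n) ∘ f) = u ∘ reg_flat f.
Proof.
apply: (can_inj (@reg_sharpK m n d')).
by rewrite reg_flatK /reg_sharp tenm_idr -compA -/(reg_sharp _) reg_flatK.
Qed.

Definition reg_inner : linner L :=
  @Linner k C C L (fun m n => m ⊗ ldual n) reg_flat reg_sharp reg_flatK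
    reg_sharpK reg_flatN.

Lemma reg_lun_inn m n : lun_inn reg_inner m n = reg_unit m n.
Proof. by rewrite /lun_inn /= /reg_sharp tenm1 comp1m. Qed.

Lemma regular_lassocN x x' y y' m m' (f : hom x x') (g : hom y y')
    (h : hom m m') :
  lassoc L x' y' m' ∘ ((f ▶ g) ▶ h) = (f ▶ (g ▶ h)) ∘ lassoc L x y m.
Proof. exact: assocN. Qed.

Lemma reg_inner_map m m' n n' (f : hom m m') (g : hom n' n) :
  linn_map reg_inner f g = f ⊠ ldualm g.
Proof.
apply: (linn_inj (H := reg_inner)); rewrite linn_map_lun !reg_lun_inn.
apply: regular_inj => q; rewrite 3!lactm_idr.
apply: (iso_monoI (lassoc_is_iso L _ _ _)).
apply: (iso_monoI (lassoc_is_iso L _ _ _)).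
rewrite -[lactm L (idm _) g]/(idm (m' ⊗ ldual n') ⊠ g).
rewrite -[lactm L _ (idm n)]/((f ⊠ ldualm g) ⊠ idm n).
rewrite ![linn _ _ _]/= !(postcomp (lassocN L _ _ _)) -?tenm1 -?compA.
rewrite !(postcomp (lassocN L _ _ _)) -?compA (postcomp3 (reg_unit_lact _ _ _)).
rewrite reg_unit_lact (compA (idm m' ▶ _)) -lactm_idl -!lactmM.
by rewrite comp1m !compm1 -!cup_ten coev'_slide.
Qed.

Lemma reg_inner_left d m n : linn_left reg_inner d m n = assoc' d m (ldual n).
Proof.
apply: (lact_linn_inj (H := reg_inner)); rewrite linn_left_lun !reg_lun_inn.
apply: regular_inj => q; rewrite 2!lactm_idr.
apply: (iso_monoI (lassoc_is_iso L _ _ _)).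
apply: (iso_monoI (lassoc_is_iso L _ _ _)).
rewrite ![linn _ _ _]/= reg_unit_lact.
rewrite -[lactm L (assoc' _ _ _) (idm n)]/(assoc' d m (ldual n) ⊠ idm n).
rewrite !(postcomp (lassocN L _ _ _)) lactm1 -?compA.
rewrite -[lassoc' L d _ n]/(assoc' d (m ⊗ ldual n) n).
rewrite (postcomp (lassoc_assoc' L _ _ _ _)) -?compA.
rewrite (postcomp (lassoc_assoc' L _ _ _ _)) -?compA.
rewrite (postcomp (lassocV L _ _ _)) comp1m regular_lassocN.
do 2! rewrite (postcomp (esym (lactm_idl L _ _ _))) -?compA.
by rewrite (reg_unit_lact m n q) compA lassoc'N tenm1 -compA lassoc'V compm1.
Qed.

Lemma cap_evqN x y (f : hom x y) q :
  cap L (evq x) q ∘ (ldualm f ▶ idm _) = cap L (evq y) q ∘ (idm _ ▶ (f ▶ idm q)).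
Proof.
rewrite -[idm (x ▷ q)]lactm1 -!cap_ten; congr (cap L _ q).
have := evqN f (idm (ldual y)) (idm x).
by rewrite !compm1.
Qed.

Lemma reg_counit_nat m m' n n' (f : hom m m') (g : hom n' n) :
  reg_counit m' n' ∘ (linn_map reg_inner f g ▶ idm n')
  = f ∘ (reg_counit m n ∘ (idm _ ▶ g)).
Proof.
rewrite reg_inner_map; apply: regular_inj => q; rewrite 3!lactm_idr.
rewrite !reg_counit_lact -?compA ![linn _ _ _]/=.
rewrite !regular_lassocN lactm1 !(postcomp (lassocN L _ _ _)) -?compA.
rewrite -?tenm1 !(postcomp (lassocN L _ _ _)) -?compA !compA -!lactmM.
by rewrite !comp1m !compm1 tenm1 cap_evqN.
Qed.

Lemma reg_counit_left d m n :
  reg_counit (d ▷ m) n ∘ (linn_left reg_inner d m n ▶ idm n)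
  = (idm d ▶ reg_counit m n) ∘ lassoc L d _ n.
Proof.
rewrite reg_inner_left; apply: regular_inj => q; rewrite 2!lactm_idr.
apply: (iso_monoI (lassoc_is_iso L _ _ _)).
rewrite (postcomp (regular_lassocN _ _ _)) -?compA.
rewrite !reg_counit_lact -?compA ![linn _ _ _]/= !lactm_idl -?compA.
rewrite regular_lassocN lactm1 (postcomp (lassoc_assoc' L _ _ _ _)) -?compA.
have -> : idm (d ▷ m) ▶ cap L (evq n) q
    = lassoc' L d m q ∘ ((idm d ▶ (idm m ▶ cap L (evq n) q)) ∘ lassoc L d m _).
  by rewrite compA lassoc'N tenm1 -compA lassoc'V compm1.
rewrite -?compA !(postcomp (lassocV L _ _ _)) !comp1m.
by rewrite lact_pentagon -?compA.
Qed.

(** The canonical map ^*n ⊗ d -> ^*n ⊗ ^*e -> ^*(e ⊗ n) for e = d^*. *)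
Definition ldual_act n d : hom (ldual n ⊗ d) (ldual (rdual d ⊗ n)) :=
  ldual_ten (rdual d) n ∘ (idm (ldual n) ⊠ lr_dual d).

Lemma cap_regular_lact x y (h : hom (x ⊗ y) (one C)) n q :
  cap L h n ▶ idm q
  = cap L h (n ▷ q) ∘ ((idm x ▶ lassoc L y n q) ∘ lassoc L x (y ▷ n) q).
Proof. by rewrite [cap L h n]capE; exact: cap_lact. Qed.

Lemma reg_right_lact m n d p :
  lassoc L m _ p ∘ (((idm m ⊠ ldual_act n d) ∘ assoc m (ldual n) d) ▶ idm p)
  = (idm m ▶ (ldual_act n d ▶ idm p)) ∘ ((idm m ▶ lassoc' L (ldual n) d p)
    ∘ (lassoc L m _ _ ∘ lassoc L _ d p)).
Proof.
rewrite lactm_idr (postcomp (lassocN L _ _ _)) -?compA.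
by rewrite lassoc_assoc.
Qed.

Lemma reg_inner_right m n d :
  linn_right reg_inner m n d
  = (idm m ⊠ ldual_act n d) ∘ assoc m (ldual n) d.
Proof.
apply: linn_right_uniq; rewrite !reg_lun_inn.
apply: regular_inj => q; set g := _ ∘ assoc m _ _; set r := lact L _ n.
have gE := reg_right_lact m n d; rewrite -/g in gE.
rewrite 3!lactm_idr -?compA ![linn _ _ _]/=.
apply: (iso_monoI (lassoc_is_iso L _ _ _)).
apply: (iso_monoI (lassoc_is_iso L _ _ _)).
rewrite (reg_unit_lact m r q) (postcomp (regular_lassocN _ _ _)) lactm1 -?compA.
rewrite (postcomp (gE _)) -?compA (postcomp (lassoc_assoc' L _ _ _ _)) -?compA.
rewrite (postcomp (lassocV L _ _ _)) comp1m.
rewrite (postcomp (regular_lassocN _ _ _)) -?tenm1 -?compA.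
do 2! rewrite (postcomp (lassocN L _ _ _)) -?compA.
rewrite reg_unit_lact -!lactm_idl; congr (_ ▶ _).
rewrite cup_coev'_ten coev'_lr cup_ten /ldual_act !tenm1 lactm_idr -?compA.
congr (_ ∘ _); rewrite -cup_lact.
have -> : assoc d (rdual d) n ∘ ((coev d ⊠ idm n) ∘ lun' n) = cup L (coev d) n.
  by rewrite cupE !compA.
rewrite !lactm1 (postcomp (esym (lactm_swap L (lr_dual d) _))) -?compA.
rewrite (lactm_idl L _ (lactm _ _ _)) -?compA.
rewrite (postcomp (lassoc'N L _ (idm _) _)) tenm1 -?compA.
rewrite (postcomp (esym (lactm_idl L (_ ⊗ ldual (rdual d)) _ _))) lassoc'V.
rewrite lactm1 comp1m.
rewrite !(lactm_idl L (ldual n)) -?compA (postcomp (lassoc'N L _ (lr_dual d) _)).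
by rewrite -?compA.
Qed.

Lemma evq_lr d v w (a : hom v d) (b : hom w (rdual d)) :
  evq (rdual d) ∘ ((lr_dual d ∘ a) ⊠ b) = evp d ∘ (a ⊠ b).
Proof.
rewrite evq_rl -compA -tenmM comp1m evpN compA lr_rl_dual comp1m.
by [].
Qed.

Lemma cap_evq_ldual_act n d q :
  cap L (evq (rdual d ⊗ n)) q ∘ (ldual_act n d ▶ idm _)
  = cap L (evq n) q ∘ ((idm _ ▶ (cap L (evp d) _ ∘ (idm d ▶ lassoc L _ n q)))
      ∘ lassoc L (ldual n) d _).
Proof.
have -> : idm ((rdual d ⊗ n) ▷ q) = idm _ ▶ idm q by rewrite lactm1.
rewrite -cap_ten /ldual_act evq_ten -tenm1 nest_tenm -[lr_dual d]compm1 evq_lr.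
by rewrite !tenm1 !compm1 cap_nest.
Qed.

Lemma reg_counit_right m n d :
  reg_counit m (rdual d ⊗ n) ∘ (linn_right reg_inner m n d ▶ idm _)
  = reg_counit m n
    ∘ ((idm _ ▶ cap L (evp d) n) ∘ lassoc L _ d (rdual d ▷ n)).
Proof.
rewrite reg_inner_right; set r := rdual d ⊗ n.
set g := (idm m ⊠ _) ∘ _; have gE := reg_right_lact m n d; rewrite -/g in gE.
apply: regular_inj => q; rewrite (lactm_idr L q (reg_counit m r)).
rewrite (lactm_idr L q (reg_counit m n)) !reg_counit_lact -!compA.
rewrite regular_lassocN lactm1 (postcomp (gE _)) -!compA.
rewrite (compA (idm m ▶ cap _ (evq r) _)) -lactm_idl cap_evq_ldual_act !lactm_idl -!compA.
have -> : (idm m ▶ lassoc L (ldual n) d (r ▷ q)) ∘ ((idm m ▶ lassoc' L (ldual n) d (r ▷ q))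
    ∘ (lassoc L m (ldual n) (d ▷ (r ▷ q)) ∘ (lassoc L (m ⊗ ldual n) d (r ▷ q)
    ∘ lassoc L ((m ⊗ ldual n) ⊗ d) r q)))
  = lassoc L m (ldual n) (d ▷ (r ▷ q)) ∘ (lassoc L (m ⊗ ldual n) d (r ▷ q)
    ∘ lassoc L ((m ⊗ ldual n) ⊗ d) r q).
  by rewrite compA -lactm_idl lassocV lactm1 comp1m.
rewrite lactm_idr (postcomp (regular_lassocN _ _ _)) cap_regular_lact -!compA.
have P := etrans (compA _ _ _) (esym (lact_pentagon L (m ⊗ ldual n) d r q)).
rewrite !(lactm_idl L (m ⊗ ldual n)) -!compA [X in _ = _ ∘ (_ ∘ (_ ∘ (_ ∘ X)))]P.
rewrite -[idm (m ⊗ ldual n)]tenm1.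
by do 2! rewrite (postcomp (lassocN L _ _ _)) -!compA.
Qed.

(** The partner of [evq]: the pair exhibits ^*n as a right dual of n, and arises from [ev] and
    [coev] by transport along x^* = ^*x. It is the unit for the adjunction with counit
    [reg_counit]. *)
Definition coevq n : hom (one C) (n ⊗ ldual n) := (idm n ⊠ piv_rl n) ∘ coev n.

Lemma piv_lrK n : piv_rl n ∘ piv_lr n = idm (ldual n).
Proof.
apply: ev'_inj; rewrite /piv_rl ev'_lcurry -evpE -[piv_lr n]compm1 evp_piv_lr.
by [].
Qed.

Lemma piv_rlK n : piv_lr n ∘ piv_rl n = idm (rdual n).
Proof.
apply: (iso_epiI (piv_lr_is_iso n)).
by rewrite -compA piv_lrK comp1m compm1.
Qed.

Lemma cap_evq n q : cap L (evq n) q = cap L (ev n) q ∘ (piv_lr n ▶ idm (n ▷ q)).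
Proof. by rewrite evqE cap_ten lactm1. Qed.

Lemma coevq_evq n q : (idm n ▶ cap L (evq n) q) ∘ cup L (coevq n) (n ▷ q) = idm _.
Proof.
rewrite cap_evq /coevq cup_ten lactm_idl -compA (compA (idm n ▶ (piv_lr n ▶ _))).
by rewrite -lactm_idl -lactm_idr piv_rlK !lactm1 comp1m coev_ev.
Qed.

Lemma evq_coevq n q :
  cap L (evq n) (ldual n ▷ q) ∘ (idm (ldual n) ▶ cup L (coevq n) q) = idm _.
Proof.
rewrite cap_evq /coevq cup_ten -compA -lactm_swap lactm_idl -!compA.
rewrite (compA (cap _ _ _)) capN -!compA (postcomp (ev_coev _ _ _)) comp1m.
by rewrite -lactm_idr piv_lrK lactm1.
Qed.

Definition reg_cotranspose d m n (f : hom (d ⊗ n) m) : hom d (m ⊗ ldual n) :=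
  (f ⊠ idm (ldual n)) ∘ (assoc' d n (ldual n) ∘ ((idm d ⊠ coevq n) ∘ run' d)).

Lemma reg_cotranspose_lact d m n (f : hom (d ⊗ n) m) q :
  lassoc L m (ldual n) q ∘ (reg_cotranspose f ▶ idm q)
  = (f ▶ idm _) ∘ (lassoc' L d n _ ∘ (idm d ▶ cup L (coevq n) q)).
Proof.
rewrite /reg_cotranspose lactm_idr (postcomp (lassocN L _ _ _)) lactm1 -compA.
by rewrite -lact_cup (postcomp (lassoc'V L _ _ _)) comp1m.
Qed.

Lemma reg_counit_bij m n d :
  bijective (fun g : hom d (m ⊗ ldual n) => reg_counit m n ∘ (g ▶ idm n)).
Proof.
exists (@reg_cotranspose d m n) => [g|f].
  apply: regular_inj => q; apply: (iso_monoI (lassoc_is_iso L _ _ _)).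
  rewrite reg_cotranspose_lact lactm_idr reg_counit_lact -!compA.
  rewrite (postcomp (regular_lassocN _ _ _)) lactm1 -!compA.
  rewrite (postcomp (lassocV L _ _ _)) comp1m -lactm_swap.
  rewrite -[idm (m ⊗ ldual n)]tenm1 (postcomp (lassocN L _ _ _)) -!compA.
  by rewrite compA -lactm_idl evq_coevq lactm1 comp1m.
apply: regular_inj => q; rewrite lactm_idr reg_counit_lact -!compA.
rewrite regular_lassocN lactm1 (postcomp (reg_cotranspose_lact _ _)) -!compA.
rewrite (compA (idm m ▶ _)) lactm_swap -!compA.
rewrite -[idm (d ⊗ n)]tenm1 (postcomp (esym (lassoc'N L _ _ _))) -!compA.
rewrite (compA (idm d ▶ _)) -lactm_idl coevq_evq lactm1 comp1m lassoc'V compm1.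
by [].
Qed.

End RegularInnerHom.

(** * Averaging over a Frobenius algebra *)

Section BinaryActions.
Variables (k : fieldType) (C : moncat k) (M : lincat k) (L : laction C M).
Implicit Types x y z w t v : C.
Local Notation "d ▷ m" := (lact L d m) (at level 38, right associativity).
Local Notation "f ▶ g" := (lactm L f g) (at level 38, right associativity).

(** The counterpart of [cap] for a target other than the unit; it keeps multiplications and module
    actions free of associators. *)
Definition act2 x y z (h : hom (x ⊗ y) z) q : hom (x ▷ y ▷ q) (z ▷ q) :=
  locked_with cap_key ((h ▶ idm q) ∘ lassoc' L x y q).

Lemma act2E x y z (h : hom (x ⊗ y) z) q :
  act2 h q = (h ▶ idm q) ∘ lassoc' L x y q.
Proof. by rewrite /act2 locked_withE. Qed.

Lemma act2_lassoc x y z (h : hom (x ⊗ y) z) q :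
  act2 h q ∘ lassoc L x y q = h ▶ idm q.
Proof. by rewrite act2E -!compA lassoc'V compm1. Qed.

Lemma act2N x y z (h : hom (x ⊗ y) z) q r (f : hom q r) :
  act2 h r ∘ (idm x ▶ (idm y ▶ f)) = (idm z ▶ f) ∘ act2 h q.
Proof. by rewrite !act2E -compA lassoc'N tenm1 !compA lactm_swap. Qed.

Lemma act2_ten x x' y y' z (h : hom (x' ⊗ y') z) (f : hom x x') (g : hom y y') q :
  act2 (h ∘ (f ⊠ g)) q = act2 h q ∘ (f ▶ (g ▶ idm q)).
Proof. by rewrite !act2E lactm_idr -!compA lassoc'N. Qed.

Lemma act2_comp x y z z' (g : hom z z') (h : hom (x ⊗ y) z) q :
  act2 (g ∘ h) q = (g ▶ idm q) ∘ act2 h q.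
Proof. by rewrite !act2E lactm_idr !compA. Qed.

Lemma lpentagon'' x y z q :
  lassoc' L (x ⊗ y) z q ∘ lassoc' L x y (z ▷ q)
  = (assoc' x y z ▶ idm q) ∘ (lassoc' L x (y ⊗ z) q ∘ (idm x ▶ lassoc' L y z q)).
Proof.
apply: (iso_monoI (lassoc_is_iso L _ _ _)).
rewrite !compA lassocV comp1m lassoc_assoc' -!compA.
rewrite (postcomp (lassocV L x _ _)) comp1m -lactm_idl lassocV lactm1.
by rewrite compm1.
Qed.

Lemma act2A x y z w t v (h : hom (z ⊗ w) v) (g : hom (x ⊗ y) z)
    (h' : hom (x ⊗ t) v) (g' : hom (y ⊗ w) t) q :
  h ∘ (g ⊠ idm w) = h' ∘ (idm x ⊠ g') ∘ assoc x y w ->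
  act2 h q ∘ act2 g (w ▷ q) = act2 h' q ∘ (idm x ▶ act2 g' q).
Proof.
move=> E; rewrite !act2E -!compA.
rewrite -[idm (w ▷ q)]lactm1 (postcomp (lassoc'N L _ _ _)) -!compA lpentagon''.
rewrite lactm_idl (postcomp (lassoc'N L _ _ _)) -!compA.
rewrite !compA -!lactm_idr E -!compA (assocK _ _ _).2 compm1.
by [].
Qed.

Lemma lact_act2 c x y z (h : hom (x ⊗ y) z) q :
  act2 ((idm c ⊠ h) ∘ assoc c x y) q
  = lassoc' L c z q ∘ ((idm c ▶ act2 h q) ∘ lassoc L c x (y ▷ q)).
Proof.
rewrite !act2E lactm_idr; apply: (iso_monoI (lassoc_is_iso L c z q)).
rewrite (postcomp (lassocV L c z q)) comp1m -!compA.
rewrite (postcomp (lassocN L _ _ _)) -!compA (postcomp (lassoc_assoc L _ _ _ _)).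
by rewrite -!compA lassocV compm1 lactm_idl -!compA.
Qed.

Lemma act2_unit x y z (h : hom (x ⊗ y) z) (e : hom (one C) y) q :
  act2 h q ∘ (idm x ▶ ((e ▶ idm q) ∘ lunit' L q))
  = ((h ∘ (idm x ⊠ e) ∘ run' x) ▶ idm q).
Proof.
rewrite lactm_idl compA -act2_ten act2E -compA -lact_lunit'.
by rewrite (compA (lassoc' _ _ _ _)) lassoc'V comp1m -lactm_idr.
Qed.

End BinaryActions.

Section Averaging.
Variables (k : fieldType) (C : moncat k) (A : frobalg C).
Local Notation L := (regular C).
Local Notation "d ▷ m" := (lact L d m) (at level 38, right associativity).
Local Notation "f ▶ g" := (lactm L f g) (at level 38, right associativity).
Implicit Types (m n p : rmodule A) (q : C).
Notation a := (fa_ob A).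

Definition casimir : hom (one C) (a ⊗ a) := com A ∘ eta A.

Local Notation ρ m q := (act2 L (rm_act m) q).
Local Notation μ q := (act2 L (mul A) q).
Local Notation γ q := (cup L casimir q).

Lemma rm_act2A m q : ρ m q ∘ ρ m (a ▷ q) = ρ m q ∘ (idm _ ▶ μ q).
Proof. by apply: act2A; rewrite rm_mul. Qed.

(** With the unit inserted, the two Frobenius relations say that multiplying the Casimir element
    from the left or from the right gives the coproduct in both cases. So the Casimir element is
    central, which makes averages A-linear. *)
Lemma casimirl q : μ (a ▷ q) ∘ (idm a ▶ γ q) = lassoc L a a q ∘ (com A ▶ idm q).
Proof.
rewrite -lact_cup act2E -!compA (postcomp (lassoc'V _ _ _ _)) comp1m.
rewrite -[idm (a ▷ q)]lactm1 (postcomp (esym (lassocN L _ _ _))) -!compA.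
rewrite -lactm_idr; congr (_ ∘ (_ ▶ _)).
rewrite /casimir tenm_idl -?compA !compA -frobl -!compA.
by rewrite (compA (mul A)) mul_etar (runK _).2 compm1.
Qed.

Lemma casimirr q : (idm a ▶ μ q) ∘ γ (a ▷ q) = lassoc L a a q ∘ (com A ▶ idm q).
Proof.
rewrite -cup_lact act2E lactm_idl -!compA (compA (idm a ▶ lassoc' _ _ _ _)).
rewrite -lactm_idl lassoc'V lactm1 comp1m (compA (idm a ▶ _)) -lassocN -!compA.
rewrite -lactm_idr; congr (_ ∘ (_ ▶ _)).
rewrite /casimir tenm_idr -?compA !compA -frobr -!compA.
by rewrite (compA (mul A)) mul_etal (lunK _).2 compm1.
Qed.

(** With γ' ⊗ γ'' for the Casimir element, this is x |-> f(xγ')γ''. *)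
Definition average m n (f : hom (rm_ob m) (rm_ob n)) : hom (rm_ob m) (rm_ob n) :=
  locked_with cap_key ((rm_act n ∘ (f ⊠ idm a)) ∘ ((rm_act m ⊠ idm a)
    ∘ (assoc' (rm_ob m) a a ∘ ((idm (rm_ob m) ⊠ casimir) ∘ run' (rm_ob m))))).

Lemma average_lact m n (f : hom (rm_ob m) (rm_ob n)) q :
  average f ▶ idm q
  = ρ n q ∘ ((f ▶ idm (a ▷ q)) ∘ (ρ m (a ▷ q) ∘ (idm (rm_ob m) ▶ γ q))).
Proof.
rewrite -lact_cup /average locked_withE lactm_idr lactm_idr.
rewrite (lactm_idr L q (rm_act m ⊠ _)) -act2_lassoc !act2E -!compA.
congr (_ ∘ _).
do 2! rewrite (postcomp (lassocN L _ _ _)) lactm1 -!compA.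
by rewrite (postcomp (lassoc'V L _ a (a ▷ q))) comp1m.
Qed.

Lemma is_rmhom_lactP m n (f : hom (rm_ob m) (rm_ob n)) :
  is_rmhom f <-> forall q, (f ▶ idm q) ∘ ρ m q = ρ n q ∘ (f ▶ idm (a ▷ q)).
Proof.
rewrite /is_rmhom; split=> [E q | E].
  rewrite -act2_comp E -[idm (a ▷ q)]lactm1 -act2_ten.
  by [].
apply: regular_inj => q; have := E q.
rewrite -act2_comp -[idm (a ▷ q)]lactm1 -act2_ten !act2E.
exact: iso_epiI (lassoc'_is_iso _ _ _ _).
Qed.

Lemma average_is_rmhom m n (f : hom (rm_ob m) (rm_ob n)) : is_rmhom (average f).
Proof.
apply/is_rmhom_lactP => q; rewrite !average_lact -!compA.
rewrite -act2N (postcomp (rm_act2A m _)) -!compA -lactm_idl casimirl.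
rewrite [RHS](postcomp (rm_act2A n _)) -!compA.
rewrite (compA (idm _ ▶ μ q)) lactm_swap -!compA.
by rewrite (postcomp (esym (act2N _ _ _))) -!compA -lactm_idl casimirr.
Qed.

Section Special.
Variable b : k.
Hypothesis com_mul : mul A ∘ com A = b *: idm a.

(** For A-linear f, f(xγ')γ'' = f(xγ'γ''), and γ'γ'' is the composite of unit, coproduct and
    product, that is b times the unit. *)
Lemma average_fix m n (f : hom (rm_ob m) (rm_ob n)) :
  is_rmhom f -> average f = b *: f.
Proof.
move/is_rmhom_lactP => fP; apply: regular_inj => q.
rewrite average_lact (postcomp (esym (fP _))) -compA (postcomp (rm_act2A m _)).
rewrite -compA -lactm_idl.
have -> : μ q ∘ γ q = b *: ((eta A ▶ idm q) ∘ lunit' L q).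
  rewrite cupE act2E -!compA (postcomp (lassoc'V L _ _ _)) comp1m compA.
  by rewrite -lactm_idr /casimir compA com_mul compZl comp1m lactmZl compZl.
rewrite lactmZr !compZr act2_unit.
by rewrite rm_eta (runK _).2 lactm1 compm1 lactmZl.
Qed.

End Special.

Lemma average_comp m n p r (g : hom (rm_ob n) (rm_ob p))
    (f : hom (rm_ob m) (rm_ob n)) (h : hom (rm_ob r) (rm_ob m)) :
  is_rmhom g -> is_rmhom h -> average (g ∘ (f ∘ h)) = g ∘ (average f ∘ h).
Proof.
move=> /is_rmhom_lactP gP /is_rmhom_lactP hP; apply: regular_inj => q.
rewrite 2!lactm_idr !average_lact 2!lactm_idr -!compA.
rewrite (postcomp (esym (gP _))) -!compA; congr (_ ∘ (_ ∘ (_ ∘ _))).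
by rewrite (postcomp (hP _)) -compA lactm_swap.
Qed.

Lemma rm_lact_act2 c m q :
  ρ (rm_lact c m) q = lassoc' L c (rm_ob m) q
    ∘ ((idm c ▶ ρ m q) ∘ lassoc L c (rm_ob m) (a ▷ q)).
Proof. exact: lact_act2. Qed.

Lemma average_act c m n (f : hom (rm_ob m) (rm_ob n)) :
  @average (rm_lact c m) (rm_lact c n) (idm c ⊠ f) = idm c ⊠ average f.
Proof.
apply: regular_inj => q; rewrite average_lact !rm_lact_act2 -!compA.
apply: (iso_monoI (lassoc_is_iso L c _ q)).
rewrite (postcomp (lassocV L c _ _)) comp1m.
rewrite (postcomp (lassocN L (idm c) _ _)) -!compA.
rewrite (postcomp (lassocV L c _ _)) comp1m -[idm (rm_lact c m)]tenm1 lassocN.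
by rewrite lassocN (average_lact f) !lactm_idl -!compA.
Qed.

End Averaging.

(** * Averaging on m ⊗ ^*n and the symmetry of A *)

Section SymmetricAveraging.
Variables (k : fieldType) (C : pivcat k) (A : frobalg C).
Local Notation L := (regular C).
Local Notation "d ▷ m" := (lact L d m) (at level 38, right associativity).
Local Notation "f ▶ g" := (lactm L f g) (at level 38, right associativity).
Implicit Types (m n p : rmodule A) (q r : C).
Local Notation a := (fa_ob A).
Local Notation ρ m q := (act2 L (rm_act m) q).
Local Notation μ q := (act2 L (mul A) q).
Local Notation γ q := (cup L (casimir A) q).

(** The left action on ^*n adjoint, with respect to [ev'], to the right action on n. *)
Definition lmod_act n : hom (a ⊗ ldual (rm_ob n)) (ldual (rm_ob n)) :=
  lcurry (ev' (rm_ob n) ∘ (rm_act n ⊠ idm (ldual (rm_ob n)))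
          ∘ assoc' (rm_ob n) a (ldual (rm_ob n))).

Local Notation λ n q := (act2 L (lmod_act n) q).

Lemma ev'_lmod_act n q :
  cap L (ev' (rm_ob n)) q ∘ (idm (rm_ob n) ▶ λ n q)
  = cap L (ev' (rm_ob n)) q ∘ ρ n (ldual (rm_ob n) ▷ q).
Proof.
rewrite !act2E lactm_idl compA -cap_ten lcurryK capE lactm_idr lactm_idr -!compA.
rewrite -lpentagon'' capE -!compA.
rewrite -[idm (ldual (rm_ob n) ▷ q)]lactm1.
by rewrite (postcomp (lassoc'N L _ _ _)) -!compA.
Qed.

Lemma lmod_actE n q :
  λ n q = (idm _ ▶ (cap L (ev' (rm_ob n)) q ∘ ρ n (ldual (rm_ob n) ▷ q)))
    ∘ cup L (coev' (rm_ob n)) _.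
Proof.
rewrite -ev'_lmod_act lactm_idl -compA cupN compA coev'_ev' comp1m.
by [].
Qed.

Definition trace_act n q : hom (a ▷ ldual (rm_ob n) ▷ rm_ob n ▷ q) q :=
  cap L (evq (rm_ob n)) q ∘ λ n (rm_ob n ▷ q).

Lemma trace_actN n q r (f : hom q r) :
  f ∘ trace_act n q
  = trace_act n r ∘ (idm a ▶ (idm _ ▶ (idm _ ▶ f))).
Proof. by rewrite /trace_act -compA act2N !compA capN. Qed.

Definition lmod_coact n : hom (ldual (rm_ob n)) (ldual a ⊗ ldual (rm_ob n)) :=
  (idm _ ⊠ lmod_act n) ∘ (assoc (ldual a) a _ ∘ ((coev' a ⊠ idm _) ∘ lun' _)).

Lemma lmod_coact_lact n q :
  lassoc L (ldual a) (ldual (rm_ob n)) q ∘ (lmod_coact n ▶ idm q)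
  = (idm (ldual a) ▶ λ n q) ∘ cup L (coev' a) (ldual (rm_ob n) ▷ q).
Proof.
rewrite /lmod_coact lactm_idr (postcomp (lassocN L _ _ _)) -cup_lact -!compA.
by rewrite (compA (idm _ ▶ λ n q)) -lactm_idl act2_lassoc.
Qed.

(** Identifies the dual of the action with the transpose of [lmod_act]; [evqN] and [evq_ten] can
    then carry the action across the pivotal evaluation. *)
Lemma ldualm_rm_act n :
  ldualm (rm_act n) = ldual_ten (rm_ob n) a ∘ lmod_coact n.
Proof.
apply: ev'_inj; rewrite -[ldualm _]compm1 ev'_slide compm1 ev'_lcurry.
apply: cap_inj => q; rewrite !cap_ten lactm1 cap_nest.
rewrite -[idm (rm_ob n ⊗ a)]tenm1 -[RHS]compA -[X in _ = _ ∘ X]compA lassocN.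
rewrite (compA (idm _ ▶ (cap _ _ _ ∘ _))) -lactm_idl -(compA (cap _ _ _)).
rewrite -lactm_idl lmod_coact_lact (lactm_idl L a) (compA (cap L (ev' a) _)) capN -compA.
by rewrite ev'_coev' compm1 compA ev'_lmod_act -compA act2_lassoc.
Qed.

(** For [ev'] the actions on n and ^*n are adjoint by construction. For [evq] the factor A lies on
    the wrong side of the pair, and has to be carried around it by the cup of ^*A and [evq a]. *)
Lemma cap_evq_rm_act n r :
  cap L (evq (rm_ob n)) r ∘ (idm _ ▶ ρ n r)
  = cap L (evq a) r ∘ ((idm _ ▶ trace_act n (a ▷ r)) ∘ cup L (coev' a) _).
Proof.
apply: (iso_epiI (lactm_is_iso L (is_iso_id _) (lassoc_is_iso L (rm_ob n) a r))).
rewrite -!compA -lactm_idl act2_lassoc.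
rewrite -cap_ten.
have -> : evq (rm_ob n) ∘ (idm (ldual (rm_ob n)) ⊠ rm_act n)
  = nest (evq a) (evq (rm_ob n)) ∘ (lmod_coact n ⊠ idm (rm_ob n ⊗ a)).
  by rewrite -[rm_act n]compm1 evqN compm1 ldualm_rm_act evq_ten.
rewrite cap_ten lactm1 cap_nest -!compA.
rewrite lmod_coact_lact; congr (_ ∘ _).
rewrite compA -lactm_idl -(compA (cap _ _ _)) -act2N compA.
by rewrite -cupN (compA (idm _ ▶ trace_act _ _)) -lactm_idl.
Qed.

Section Symmetric.
Hypothesis symA : frob_symmetric A.

(** Symmetry of A, after x^* and ^*x are identified: contracting the first leg of the Casimir
    element by [evq] is the same as contracting the second leg by [ev']. *)
Lemma casimir_evq q :
  cap L (evq a) (a ▷ q) ∘ (idm _ ▶ γ q)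
  = (idm a ▶ cap L (ev' a) q) ∘ γ (ldual a ▷ q).
Proof.
have S : (lun a ∘ (ev a ⊠ idm a) ∘ assoc' (rdual a) a a
    ∘ (idm (rdual a) ⊠ casimir A) ∘ run' (rdual a))
  = run a ∘ (idm a ⊠ ev' a) ∘ assoc a a (ldual a)
    ∘ (casimir A ⊠ idm (ldual a)) ∘ lun' (ldual a) ∘ piv_rl a.
  rewrite [LHS]symA -!compA; do 3! congr (_ ∘ _).
  have := lunit'N L (piv_rl a) => /= ->.
  by rewrite (compA (casimir A ⊠ _)) -tenmM comp1m compm1.
have := congr1 (fun h => lactm L (h ∘ piv_lr a) (idm q)) S.
rewrite -[in RHS]compA piv_lrK compm1 cap_zig lactm_idr cap_zag => <-.
by rewrite cap_evq -!compA lactm_swap.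
Qed.

(** In elements, γ' ⟨γ''φ, v⟩ = ⟨φ, vγ'⟩ γ'', with the pairing [evq]. The previous lemma undoes the
    detour around the pair in [cap_evq_rm_act]. *)
Lemma casimir_trace_act n q :
  (idm a ▶ trace_act n q) ∘ γ (ldual (rm_ob n) ▷ rm_ob n ▷ q)
  = cap L (evq (rm_ob n)) (a ▷ q)
    ∘ ((idm _ ▶ ρ n (a ▷ q)) ∘ (idm _ ▶ (idm (rm_ob n) ▶ γ q))).
Proof.
rewrite compA cap_evq_rm_act -!compA -cupN.
rewrite (compA (idm _ ▶ trace_act _ _)) -lactm_idl -trace_actN lactm_idl -!compA.
rewrite compA casimir_evq -compA -cupN compA -lactm_idl.
congr (_ ∘ _); congr (idm a ▶ _).
by rewrite (lactm_idl L a) compA capN -compA ev'_coev' compm1.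
Qed.
End Symmetric.

Local Notation U m := (rm_ob m).

Definition avg_unit m n : hom (U m) (U (rm_lact (U m ⊗ ldual (U n)) n)) :=
  @average k C A m (rm_lact (U m ⊗ ldual (U n)) n) (reg_unit (U m) (U n)).

Definition avg_counit m n : hom (U (rm_lact (U m ⊗ ldual (U n)) n)) (U m) :=
  @average k C A (rm_lact (U m ⊗ ldual (U n)) n) m (reg_counit (U m) (U n)).

Lemma avg_unit_lact m n q :
  avg_unit m n ▶ idm q
  = lassoc' L _ (U n) q ∘ ((idm _ ▶ ρ n q) ∘ (lassoc L _ (U n) (a ▷ q)
    ∘ ((reg_unit (U m) (U n) ▶ idm (a ▷ q))
    ∘ (ρ m (a ▷ q) ∘ (idm (U m) ▶ γ q))))).
Proof.
apply: etrans (@average_lact k C A m (rm_lact _ n) _ q) _.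
by rewrite rm_lact_act2 -!compA.
Qed.

Lemma avg_counit_lact m n q :
  avg_counit m n ▶ idm q
  = ρ m q ∘ ((reg_counit (U m) (U n) ▶ idm (a ▷ q))
    ∘ (lassoc' L _ (U n) (a ▷ q) ∘ ((idm _ ▶ ρ n (a ▷ q))
    ∘ (lassoc L _ (U n) (a ▷ a ▷ q) ∘ (idm (_ ⊗ U n) ▶ γ q))))).
Proof.
apply: etrans (@average_lact k C A (rm_lact _ n) m _ q) _.
by rewrite rm_lact_act2 -!compA.
Qed.

(* Averaging on Hom(m, d ⊗ n) = Hom(m ⊗ ^*n, d) comes from an endomorphism of
   m ⊗ ^*n. *)
Definition avg_endo m n : hom (U m ⊗ ldual (U n)) (U m ⊗ ldual (U n)) :=
  reg_flat (avg_unit m n).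

Lemma avg_endo_unit m n :
  (avg_endo m n ⊠ idm (U n)) ∘ reg_unit (U m) (U n) = avg_unit m n.
Proof. exact: reg_flatK. Qed.

(** In elements, x ⊗ φ |-> xγ' ⊗ γ''φ: averaging a map into d ⊗ n acts on n, and the adjunction
    moves this action to ^*n. *)
Lemma avg_endo_lact m n q :
  lassoc L (U m) (ldual (U n)) q ∘ (avg_endo m n ▶ idm q)
  = ρ m (ldual (U n) ▷ q)
    ∘ ((idm (U m) ▶ ((idm a ▶ λ n q) ∘ γ (ldual (U n) ▷ q)))
    ∘ lassoc L (U m) (ldual (U n)) q).
Proof.
rewrite /avg_endo reg_flat_lact avg_unit_lact -!compA.
rewrite (postcomp (lassocV L _ _ _)) comp1m.
rewrite (compA (idm _ ▶ cap _ _ _)) -lactm_idl -[idm (U m ⊗ _)]tenm1.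
rewrite (postcomp (lassocN L _ _ _)) -!compA (postcomp3 (reg_unit_lact _ _ _)).
rewrite (compA (idm (U m) ▶ _)) -lactm_idl -lmod_actE.
by rewrite (postcomp (esym (act2N _ _ _))) -!compA lactm_idl -!compA.
Qed.

(** The endomorphism is defined by its effect on the unit of the one adjunction; that it also
    averages the counit of the other is what [casimir_trace_act] supplies. *)
Lemma avg_endo_counit m n : frob_symmetric A ->
  reg_counit (U m) (U n) ∘ (avg_endo m n ⊠ idm (U n)) = avg_counit m n.
Proof.
move=> symA; apply: regular_inj => q.
rewrite lactm_idr reg_counit_lact -!compA (lassocN L) lactm1.
rewrite (postcomp (avg_endo_lact _ _ _)) -!compA.
rewrite (postcomp (esym (act2N _ _ _))) -!compA.
rewrite (compA (idm (U m) ▶ (idm a ▶ _))) -lactm_idl (compA (idm a ▶ cap _ _ _)).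
rewrite -lactm_idl -/(trace_act n q) (casimir_trace_act symA).
rewrite avg_counit_lact reg_counit_lact -!compA.
rewrite (postcomp (lassocV L _ _ _)) comp1m -[idm (U m ⊗ _)]tenm1.
rewrite (postcomp (lassocN L _ _ _)) -!compA.
rewrite -[idm (U m ⊗ ldual (U n) ⊗ U n)]tenm1 lassocN -[idm (U m ⊗ _)]tenm1.
by rewrite (postcomp (lassocN L _ _ _)) !lactm_idl -!compA.
Qed.

End SymmetricAveraging.

Record splitting (k : fieldType) (C : lincat k) (x : C) (p : hom x x) :=
  Splitting {
    spl_ob : C;
    spl_in : hom spl_ob x;
    spl_out : hom x spl_ob;
    spl_inK : spl_out ∘ spl_in = idm spl_ob;
    spl_outK : spl_in ∘ spl_out = p }.

(** The universal property of the inner hom of modules relates its structure maps to those of m ⊗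
    ^*n through the projections, whereas its counit is a restriction along the inclusions. As the
    ambient map commutes with the idempotents, one relation gives the other. *)
Lemma splitting_lift (k : fieldType) (C : lincat k) (x y z t : C)
    (i : hom z x) (r : hom x z) (j : hom t y) (s : hom y t)
    (f : hom z t) (g : hom x y) :
  r ∘ i = idm z -> s ∘ j = idm t -> f ∘ r = s ∘ g ->
  (j ∘ s) ∘ g = g ∘ (i ∘ r) -> j ∘ f = g ∘ i.
Proof.
move=> ri sj fr gp; rewrite -[f]compm1 -ri (compA f) fr -!compA.
by rewrite compA (compA (j ∘ s)) gp -!compA ri compm1.
Qed.

Section Transpose.
Variables (k : fieldType) (C : rigidcat k).
Implicit Types x y z d : C.

(** The form in which [linn_right] arises from [linn_right_aux]; being natural, it reduces
    identities for the former to the latter. *)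
Definition transpose z d x (w : hom x (z ⊗ rdual d)) : hom (x ⊗ d) z :=
  run z ∘ (idm z ⊠ ev d) ∘ assoc z (rdual d) d ∘ (w ⊠ idm d).

Lemma transpose_compl y z d x (g : hom z y) (w : hom x (z ⊗ rdual d)) :
  transpose ((g ⊠ idm (rdual d)) ∘ w) = g ∘ transpose w.
Proof.
rewrite /transpose tenm_idr -!compA (compA (assoc _ _ _)) assocN tenm1 -!compA.
rewrite (compA (idm y ⊠ _)) -tenmM comp1m compm1.
by rewrite (compA g) -runN -!compA (compA (g ⊠ idm (one C))) -tenmM compm1 comp1m.
Qed.

Lemma transpose_compr z d x y (w : hom x (z ⊗ rdual d)) (f : hom y x) :
  transpose (w ∘ f) = transpose w ∘ (f ⊠ idm d).
Proof. by rewrite /transpose tenm_idr !compA. Qed.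

End Transpose.

(** * The inner hom of modules as the image of an idempotent *)

Section RmodInner.
Variables (k : fieldType) (C : pivcat k) (A : frobalg C) (b : k).
Hypothesis b_neq0 : b != 0.
Hypothesis com_mul : mul A ∘ com A = b *: idm (fa_ob A).
Hypothesis symA : frob_symmetric A.
Hypothesis split : forall (x : C) (p : hom x x), p ∘ p = p -> splitting p.
Local Notation L := (regular C).
Local Notation K := (rmod_laction A).
Local Notation "d ▷ m" := (lact L d m) (at level 38, right associativity).
Local Notation "f ▶ g" := (lactm L f g) (at level 38, right associativity).
Local Notation U m := (rm_ob m).
Implicit Types (m n : rmodule A) (d q : C).

Definition mean m n (f : hom (U m) (U n)) : hom (U m) (U n) :=
  b^-1 *: average f.

Lemma mean_is_rmhom m n (f : hom (U m) (U n)) : is_rmhom (mean f).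
Proof.
rewrite /is_rmhom /mean compZl (average_is_rmhom f).
by have := lactmZl L b^-1 (average f) (idm (fa_ob A)) => /= ->; rewrite compZr.
Qed.

Lemma mean_fix m n (f : hom (U m) (U n)) : is_rmhom f -> mean f = f.
Proof.
move=> fP; rewrite /mean (average_fix com_mul fP) scalerA mulVf //.
by rewrite scale1r.
Qed.

Lemma mean_comp m n p r (g : hom (U n) (U p)) (f : hom (U m) (U n))
    (h : hom (U r) (U m)) :
  is_rmhom g -> is_rmhom h -> mean (g ∘ (f ∘ h)) = g ∘ (mean f ∘ h).
Proof.
by move=> gP hP; rewrite /mean average_comp // compZl compZr.
Qed.

Lemma mean_compl m n p (g : hom (U n) (U p)) (f : hom (U m) (U n)) :
  is_rmhom g -> mean (g ∘ f) = g ∘ mean f.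
Proof.
move=> gP; have := mean_comp f gP (is_rmhom_id m).
by rewrite !compm1.
Qed.

Lemma mean_compr m p r (f : hom (U m) (U p)) (h : hom (U r) (U m)) :
  is_rmhom h -> mean (f ∘ h) = mean f ∘ h.
Proof.
move=> hP; have := mean_comp f (is_rmhom_id p) hP.
by rewrite !comp1m.
Qed.

Lemma mean_act c m n (f : hom (U m) (U n)) :
  @mean (rm_lact c m) (rm_lact c n) (idm c ▶ f) = idm c ▶ mean f.
Proof.
by rewrite /mean average_act; exact: esym (lactmZr L _ _ _).
Qed.

Local Notation u0 m n := (reg_unit (U m) (U n)).
Local Notation v0 m n := (reg_counit (U m) (U n)).
Local Notation X0 m n := (U m ⊗ ldual (U n)).

Definition mean_endo m n : hom (X0 m n) (X0 m n) := b^-1 *: avg_endo m n.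

Lemma mean_endo_unit m n :
  (mean_endo m n ▶ idm (U n)) ∘ u0 m n = @mean m (rm_lact (X0 m n) n) (u0 m n).
Proof.
rewrite /mean_endo lactmZl compZl.
by have := avg_endo_unit m n => /= ->.
Qed.

Lemma mean_endo_counit m n :
  v0 m n ∘ (mean_endo m n ▶ idm (U n))
  = @mean (rm_lact (X0 m n) n) m (v0 m n).
Proof.
rewrite /mean_endo lactmZl compZr.
by have := avg_endo_counit m n symA => /= ->.
Qed.

Lemma mean_endo_reg_inj m n d (f g : hom (X0 m n) d) :
  (f ▶ idm (U n)) ∘ u0 m n = (g ▶ idm (U n)) ∘ u0 m n -> f = g.
Proof.
by move=> E; apply: (linn_inj (H := @reg_inner k C)); rewrite reg_lun_inn.
Qed.

Lemma is_rmhom_lactl x y n (f : hom x y) :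
  @is_rmhom k C A (rm_lact x n) (rm_lact y n) (f ▶ idm (U n)).
Proof. by apply: is_rmhom_lact; apply: is_rmhom_id. Qed.

Lemma is_rmhom_lactr x m n (f : hom (U m) (U n)) :
  is_rmhom f -> @is_rmhom k C A (rm_lact x m) (rm_lact x n) (idm x ▶ f).
Proof. exact: is_rmhom_lact. Qed.

(** A morphism out of m ⊗ ^*n is determined by its effect on the unit, on which [mean_endo] acts by
    averaging; a mean is A-linear and hence its own mean. *)
Lemma mean_endo_idem m n : mean_endo m n ∘ mean_endo m n = mean_endo m n.
Proof.
apply: mean_endo_reg_inj; rewrite lactm_idr -compA !mean_endo_unit.
rewrite -(mean_compl _ (is_rmhom_lactl _ _)) mean_endo_unit.
by rewrite mean_fix //; apply: mean_is_rmhom.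
Qed.

Local Notation S m n := (split (mean_endo_idem m n)).
Local Notation X m n := (spl_ob (S m n)).
Local Notation "'ι' m n" := (spl_in (S m n)) (at level 10, m at level 9, n at level 9).
Local Notation "'π' m n" := (spl_out (S m n)) (at level 10, m at level 9, n at level 9).

Lemma out_endo m n : (π m n) ∘ mean_endo m n = π m n.
Proof.
suff : (π m n) ∘ ((ι m n) ∘ (π m n)) = π m n by rewrite spl_outK.
by rewrite compA spl_inK comp1m.
Qed.

Lemma endo_in m n : mean_endo m n ∘ (ι m n) = ι m n.
Proof.
suff : (ι m n) ∘ (π m n) ∘ (ι m n) = ι m n by rewrite spl_outK.
by rewrite -compA spl_inK compm1.
Qed.

Lemma rmod_sharp_is_rmhom m n d (g : hom (X m n) d) :
  @is_rmhom k C A m (rm_lact d n) (reg_sharp (g ∘ (π m n))).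
Proof.
rewrite /reg_sharp -out_endo compA.
have := lactm_idr L (U n) (g ∘ π m n) (mean_endo m n) => /= ->.
rewrite -compA; have := mean_endo_unit m n => /= ->.
exact: (@is_rmhom_comp k C A m (rm_lact (X0 m n) n) (rm_lact d n) _ _
  (is_rmhom_lactl _ _) (mean_is_rmhom _)).
Qed.

Definition rmod_flat m n d (f : rmhom m (rm_lact d n)) : hom (X m n) d :=
  reg_flat (vsval f) ∘ (ι m n).

Definition rmod_sharp m n d (g : hom (X m n) d) : rmhom m (rm_lact d n) :=
  rmhom_of (rmod_sharp_is_rmhom g).

Lemma rmod_flatK m n d : cancel (@rmod_flat m n d) (@rmod_sharp m n d).
Proof.
move=> f; apply: val_inj; rewrite /= /rmod_flat -compA spl_outK /reg_sharp.
have := lactm_idr L (U n) (reg_flat (vsval f)) (mean_endo m n) => /= ->.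
rewrite -compA; have := mean_endo_unit m n => /= ->.
rewrite -(mean_compl _ (is_rmhom_lactl _ _)).
have := reg_flatK (vsval f); rewrite /reg_sharp /= => ->.
exact: (@mean_fix m (rm_lact d n) _ (rmhom_is f)).
Qed.

Lemma rmod_sharpK m n d : cancel (@rmod_sharp m n d) (@rmod_flat m n d).
Proof.
by move=> g; rewrite /rmod_flat /= reg_sharpK -compA spl_inK compm1.
Qed.

Lemma rmod_flatN m n d d' (u : hom d d') (f : rmhom m (rm_lact d n)) :
  rmod_flat (rmcomp (rm_lactm u (rmid n)) f) = u ∘ rmod_flat f.
Proof. by rewrite /rmod_flat /= reg_flatN compA. Qed.

Definition rmod_inner : linner K :=
  @Linner k C (rmod A) K (fun m n => X m n) rmod_flat rmod_sharp rmod_flatK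
    rmod_sharpK rmod_flatN.

Lemma rmod_lun_inn m n :
  vsval (lun_inn rmod_inner m n) = ((π m n) ▶ idm (U n)) ∘ u0 m n.
Proof. by rewrite /= comp1m. Qed.

Lemma reg_map_unit (m m' n n' : C) (f : hom m m') (g : hom n' n) :
  ((f ⊠ ldualm g) ▶ idm n) ∘ reg_unit m n
  = (idm _ ▶ g) ∘ (reg_unit m' n' ∘ f).
Proof.
by have := linn_map_lun (@reg_inner k C) f g; rewrite reg_inner_map !reg_lun_inn.
Qed.

Lemma rmod_map_in m m' n n' (f : rmhom m m') (g : rmhom n' n) :
  (ι m' n') ∘ linn_map rmod_inner f g
  = (vsval f ⊠ ldualm (vsval g)) ∘ (ι m n).
Proof.
apply: (splitting_lift (spl_inK (S m n)) (spl_inK (S m' n'))).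
  have E : (linn_map rmod_inner f g ▶ idm (U n)) ∘ vsval (lun_inn rmod_inner m n)
      = (idm _ ▶ vsval g) ∘ (vsval (lun_inn rmod_inner m' n') ∘ vsval f).
    exact (congr1 (@vsval _ _ _) (linn_map_lun rmod_inner f g)).
  apply: mean_endo_reg_inj; rewrite 2!lactm_idr -!compA.
  rewrite !rmod_lun_inn in E; rewrite E reg_map_unit -!compA.
  by rewrite (compA (idm _ ▶ _)) lactm_swap -!compA.
rewrite !spl_outK; apply: mean_endo_reg_inj; rewrite 2!lactm_idr -!compA.
rewrite reg_map_unit (compA (mean_endo _ _ ▶ _)) -lactm_swap -compA.
rewrite (compA (mean_endo _ _ ▶ _) (u0 _ _)) mean_endo_unit.
rewrite mean_endo_unit.
have gP := is_rmhom_lactr (X0 m' n') (rmhom_is g).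
rewrite -(mean_comp _ gP (rmhom_is f)) -reg_map_unit.
by rewrite (mean_compl _ (is_rmhom_lactl _ _)).
Qed.

Lemma reg_lact_inj d (m n : C) t (h h' : hom (d ⊗ (m ⊗ ldual n)) t) :
  (h ▶ idm n) ∘ (lassoc' L d _ n ∘ (idm d ▶ reg_unit m n))
  = (h' ▶ idm n) ∘ (lassoc' L d _ n ∘ (idm d ▶ reg_unit m n)) -> h = h'.
Proof.
by move=> E; apply: (lact_linn_inj (H := @reg_inner k C)); rewrite reg_lun_inn.
Qed.

Lemma reg_left_unit d (m n : C) :
  (assoc' d m (ldual n) ▶ idm n) ∘ (lassoc' L d _ n ∘ (idm d ▶ reg_unit m n))
  = reg_unit (d ⊗ m) n.
Proof.
have := linn_left_lun (@reg_inner k C) d m n.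
by rewrite reg_inner_left !reg_lun_inn.
Qed.

Lemma rmod_left_in d m n :
  (ι (rm_lact d m) n) ∘ linn_left rmod_inner d m n
  = assoc' d (U m) (ldual (U n)) ∘ (idm d ▶ (ι m n)).
Proof.
have ri : (idm d ▶ (π m n)) ∘ (idm d ▶ (ι m n)) = idm _.
  by rewrite -lactm_idl spl_inK lactm1.
apply: (splitting_lift ri (spl_inK (S (rm_lact d m) n))).
  have E : (linn_left rmod_inner d m n ▶ idm (U n))
      ∘ (lassoc' L d _ (U n) ∘ (idm d ▶ vsval (lun_inn rmod_inner m n)))
      = vsval (lun_inn rmod_inner (rm_lact d m) n).
    exact (congr1 (@vsval _ _ _) (linn_left_lun rmod_inner d m n)).
  apply: reg_lact_inj.
  rewrite (lactm_idr L (U n) (linn_left rmod_inner d m n)).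
  rewrite (lactm_idr L (U n) (π (rm_lact d m) n)) -!compA reg_left_unit.
  rewrite !rmod_lun_inn lactm_idl in E; rewrite -E.
  by rewrite (compA (lassoc' _ _ _ _)) lassoc'N -!compA.
rewrite -lactm_idl !spl_outK.
apply: reg_lact_inj.
rewrite 2!lactm_idr -!compA reg_left_unit.
have -> : (idm d ▶ mean_endo m n) ▶ idm (U n)
    ∘ (lassoc' L d _ (U n) ∘ (idm d ▶ u0 m n))
  = lassoc' L d _ (U n) ∘ (idm d ▶ ((mean_endo m n ▶ idm (U n)) ∘ u0 m n)).
  by rewrite lactm_idl !compA lassoc'N.
rewrite mean_endo_unit (mean_endo_unit (rm_lact d m) n).
rewrite -(mean_act d (n := rm_lact (X0 m n) n)).
have aP : @is_rmhom k C A (rm_lact d (rm_lact (X0 m n) n)) (rm_lact (d ⊗ X0 m n) n)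
    (lassoc' L d (X0 m n) (U n)).
  exact: rmhom_is (rm_assoc' d (X0 m n) n).
rewrite -(mean_compl (m := rm_lact d m) _ aP).
rewrite -(mean_compl (m := rm_lact d m) _ (is_rmhom_lactl _ _)).
by rewrite reg_left_unit.
Qed.

Local Notation rd d n := (rm_lact (rdual d) n).

Lemma reg_right_unit d (m n : C) :
  (linn_right_aux (@reg_inner k C) m n d ▶ idm n) ∘ reg_unit m n
  = lassoc' L _ (rdual d) n ∘ reg_unit m (rdual d ⊗ n).
Proof.
have := linn_right_aux_lun (@reg_inner k C) m n d.
by rewrite !reg_lun_inn.
Qed.

Lemma rmod_right_in d m n :
  (ι m (rd d n)) ∘ linn_right rmod_inner m n d
  = linn_right (@reg_inner k C) (U m) (U n) d ∘ ((ι m n) ▶ idm d).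
Proof.
have ri : ((π m n) ▶ idm d) ∘ ((ι m n) ▶ idm d) = idm _.
  by rewrite -lactm_idr spl_inK lactm1.
set w0 := linn_right_aux (@reg_inner k C) (U m) (U n) d.
set w := linn_right_aux rmod_inner m n d.
apply: (splitting_lift ri (spl_inK (S m (rd d n)))).
  have E : (w ▶ idm (U n)) ∘ vsval (lun_inn rmod_inner m n)
      = lassoc' L _ (rdual d) (U n) ∘ vsval (lun_inn rmod_inner m (rd d n)).
    exact (congr1 (@vsval _ _ _) (linn_right_aux_lun rmod_inner m n d)).
  suff F : w ∘ (π m n) = ((π m (rd d n)) ⊠ idm (rdual d)) ∘ w0.
    apply: etrans (esym (transpose_compr w (π m n))) _.
    by rewrite F transpose_compl.
  apply: mean_endo_reg_inj; rewrite !rmod_lun_inn in E.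
  rewrite (lactm_idr L (U n) w) -compA E (lactm_idr L (U n) (_ ⊠ _)) -[RHS]compA.
  rewrite reg_right_unit (compA _ (lassoc' _ _ _ _)) -lassoc'N -compA.
  by rewrite lactm1.
rewrite -lactm_idr !spl_outK.
suff F : (mean_endo m (rd d n) ⊠ idm (rdual d)) ∘ w0 = w0 ∘ mean_endo m n.
  apply: etrans (esym (transpose_compl (mean_endo m (rd d n)) w0)) _.
  by rewrite F transpose_compr.
apply: mean_endo_reg_inj.
rewrite (lactm_idr L (U n) w0) -[RHS]compA (mean_endo_unit m n).
rewrite (lactm_idr L (U n) (_ ⊠ _)) -[LHS]compA reg_right_unit.
rewrite (compA _ (lassoc' _ _ _ _)) -lassoc'N -compA lactm1.
rewrite (mean_endo_unit m (rd d n)) -(mean_compl _ (is_rmhom_lactl _ _)).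
have aP : @is_rmhom k C A (rm_lact (X0 m (rd d n)) (rd d n))
    (rm_lact (X0 m (rd d n) ⊗ rdual d) n)
    (lassoc' L (X0 m (rd d n)) (rdual d) (U n)).
  exact: rmhom_is (rm_assoc' _ (rdual d) n).
by rewrite -(mean_compl _ aP) reg_right_unit.
Qed.

(** On the image of the idempotent the counit equals its own mean, so it is A-linear there. *)
Lemma endo_counit_in m n :
  v0 m n ∘ ((ι m n) ▶ idm (U n))
  = @mean (rm_lact (X0 m n) n) m (v0 m n) ∘ ((ι m n) ▶ idm (U n)).
Proof.
by rewrite -mean_endo_counit -compA -lactm_idr endo_in.
Qed.

Lemma rmod_counit_is_rmhom m n :
  @is_rmhom k C A (rm_lact (X m n) n) m (v0 m n ∘ ((ι m n) ▶ idm (U n))).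
Proof.
rewrite endo_counit_in.
exact: (@is_rmhom_comp k C A _ (rm_lact (X0 m n) n) _ _ _ (mean_is_rmhom _)
  (is_rmhom_lactl _ _)).
Qed.

Definition rmod_counit m n : rmhom (rm_lact (X m n) n) m :=
  rmhom_of (rmod_counit_is_rmhom m n).

Lemma reg_counit_map (m m' n n' : C) (f : hom m m') (g : hom n' n) :
  reg_counit m' n' ∘ ((f ⊠ ldualm g) ▶ idm n')
  = f ∘ (reg_counit m n ∘ (idm _ ▶ g)).
Proof. by rewrite -reg_counit_nat reg_inner_map. Qed.

Lemma reg_counit_act (d m n : C) :
  reg_counit (d ⊗ m) n ∘ (assoc' d m (ldual n) ▶ idm n)
  = (idm d ▶ reg_counit m n) ∘ lassoc L d (m ⊗ ldual n) n.
Proof. by rewrite -reg_counit_left reg_inner_left. Qed.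

Lemma rmod_counit_nat m m' n n' (f : rmhom m m') (g : rmhom n' n) :
  rmcomp (rmod_counit m' n') (rm_lactm (linn_map rmod_inner f g) (rmid n'))
  = rmcomp f (rmcomp (rmod_counit m n) (rm_lactm (idm _) g)).
Proof.
apply: val_inj.
transitivity (v0 m' n' ∘ ((ι m' n' ∘ linn_map rmod_inner f g) ▶ idm (U n'))).
  by rewrite lactm_idr compA.
transitivity (vsval f ∘ ((v0 m n ∘ ((ι m n) ▶ idm (U n))) ∘ (idm _ ▶ vsval g))).
  rewrite rmod_map_in lactm_idr [LHS]compA reg_counit_map -!compA.
  by rewrite lactm_swap.
by [].
Qed.

Lemma rmod_counit_left d m n :
  rmcomp (rmod_counit (rm_lact d m) n)
    (rm_lactm (linn_left rmod_inner d m n) (rmid n))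
  = rmcomp (rm_lactm (idm d) (rmod_counit m n)) (rm_assoc d (X m n) n).
Proof.
apply: val_inj.
transitivity (v0 (rm_lact d m) n
  ∘ ((ι (rm_lact d m) n ∘ linn_left rmod_inner d m n) ▶ idm (U n))).
  by rewrite lactm_idr compA.
transitivity ((idm d ▶ (v0 m n ∘ ((ι m n) ▶ idm (U n)))) ∘ lassoc L d _ (U n)).
  rewrite rmod_left_in lactm_idr [LHS]compA reg_counit_act lactm_idl -!compA.
  by rewrite regular_lassocN.
by [].
Qed.

Lemma rmod_counit_right m n d :
  rmcomp (rmod_counit m (rm_lact (rdual d) n))
    (rm_lactm (linn_right rmod_inner m n d) (rmid _))
  = rmcomp (rmod_counit m n) (rmcomp
      (rm_lactm (idm (X m n)) (cap K (evp d) n))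
      (rm_assoc (X m n) d (rm_lact (rdual d) n))).
Proof.
apply: val_inj.
transitivity (v0 m (rd d n)
  ∘ ((ι m (rd d n) ∘ linn_right rmod_inner m n d) ▶ idm (U (rd d n)))).
  by rewrite lactm_idr compA.
transitivity ((v0 m n ∘ ((ι m n) ▶ idm (U n))) ∘ ((idm _ ▶ cap L (evp d) (U n))
  ∘ lassoc L _ d (U (rd d n)))).
  rewrite rmod_right_in lactm_idr [LHS]compA reg_counit_right -!compA.
  by rewrite regular_lassocN lactm1 (compA (idm _ ▶ cap _ _ _)) lactm_swap -!compA.
have -> : cap L (evp d) (U n) = vsval (cap K (evp d) n) by rewrite !capE.
by [].
Qed.

(** The inverse is that for m ⊗ ^*n, projected to the image. The projection replaces the counit by
    its mean, which does not affect A-linear morphisms. *)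
Lemma rmod_counit_bij m n d :
  bijective (fun g : hom d (X m n) =>
    rmcomp (rmod_counit m n) (rm_lactm g (rmid n))).
Proof.
have [inv invK Kinv] := reg_counit_bij (U m) (U n) d.
exists (fun f : rmhom (rm_lact d n) m => (π m n) ∘ inv (vsval f)) => [g|f].
  have -> : vsval (rmcomp (rmod_counit m n) (rm_lactm g (rmid n)))
    = v0 m n ∘ (((ι m n) ∘ g) ▶ idm (U n)) by rewrite lactm_idr compA.
  by rewrite invK compA spl_inK comp1m.
apply: val_inj.
transitivity (v0 m n ∘ (((ι m n) ∘ ((π m n) ∘ inv (vsval f))) ▶ idm (U n))).
  by rewrite lactm_idr compA.
rewrite compA spl_outK lactm_idr compA mean_endo_counit.
rewrite -(@mean_compr (rm_lact (X0 m n) n) m (rm_lact d n) _ _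
  (is_rmhom_lactl _ _)).
have := Kinv (vsval f) => /= ->.
exact: (@mean_fix (rm_lact d n) m _ (rmhom_is f)).
Qed.

Definition rmod_counit_structure : counit rmod_inner :=
  @Counit k C (rmod A) K rmod_inner rmod_counit rmod_counit_nat
    rmod_counit_left rmod_counit_right rmod_counit_bij.

End RmodInner.

Lemma rmod_inner_product (k : fieldType) (C : pivcat k) (A : frobalg C) :
  (forall (x : C) (p : hom x x), p ∘ p = p -> inhabited (splitting p)) ->
  frob_special A -> frob_symmetric A ->
  inhabited (inner_product (rmod_laction A)).
Proof.
move=> split [b1 [b [_ b0 _ mulcom]]] symA.
have spl (x : C) (p : hom x x) (pp : p ∘ p = p) : splitting p.
  have E : exists s : splitting p, True by case: (split x p pp) => s; exists s.
  exact: proj1_sig (constructive_indefinite_description _ E).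
exact: (inhabits (InnerProduct
  (counit_lpairing_iso (rmod_counit_structure b0 mulcom symA spl)))).
Qed.

(** * Finite abelian categories *)

Section LinearMaps.
Variables (k : fieldType) (V W : vectType k) (f : 'Hom(V, W)).

Lemma lfun_inj_dim : injective f -> (dim V <= dim W)%N.
Proof.
move=> fI; rewrite -(dimvf V) -(dimvf W) -(limg_dim_eq (f := f)) ?dimvS ?subvf //.
have/lker0P/eqP -> := fI; exact: capv0.
Qed.

Lemma lfun_inj_surj :
  injective f -> (dim W <= dim V)%N -> forall w, exists v, f v = w.
Proof.
move=> fI dimW w.
have E : (f @: fullv = fullv)%VS.
  apply/eqP; rewrite eqEdim subvf /= limg_dim_eq ?dimvf //.
  by have/lker0P/eqP -> := fI; rewrite capv0.
have : w \in (f @: fullv)%VS by rewrite E memvf.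
by case/memv_imgP => v _ ->; exists v.
Qed.

End LinearMaps.

Section CompLinear.
Variables (k : fieldType) (C : lincat k) (x y z : C) (g : hom y z).

Fact comp_linear : linear (@comp k C x y z g).
Proof. by move=> a f f'; rewrite comp_linr. Qed.

HB.instance Definition _ :=
  GRing.isLinear.Build k _ _ _ (@comp k C x y z g) comp_linear.

End CompLinear.

(** * Abelian categories and projective generators *)

Section KernelLemmas.
Variables (k : fieldType) (C : lincat k).
Implicit Types x y z w : C.

Lemma kernel_monic z x y (i : hom z x) (f : hom x y) : is_kernel i f -> monic i.
Proof.
move=> [fi univ] w g ig0.
have [h [_ uniq]] := univ w 0 (compm0 _ _).
by rewrite -(uniq g ig0) -(uniq 0 (compm0 _ _)).
Qed.

Lemma cokernel_epic x y z (p : hom y z) (f : hom x y) : is_cokernel p f -> epic p.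
Proof.
move=> [pf univ] w g gp0.
have [h [_ uniq]] := univ w 0 (comp0m _ _).
by rewrite -(uniq g gp0) -(uniq 0 (comp0m _ _)).
Qed.

Lemma monic_inj w x y (f : hom x y) (g h : hom w x) :
  monic f -> f ∘ g = f ∘ h -> g = h.
Proof.
by move=> fm E; apply/subr0_eq/fm; rewrite compBr E subrr.
Qed.

Lemma epic_inj x y w (f : hom x y) (g h : hom y w) :
  epic f -> g ∘ f = h ∘ f -> g = h.
Proof.
by move=> fe E; apply/subr0_eq/fe; rewrite compBl E subrr.
Qed.

Lemma iso_epic x y (f : hom x y) : is_iso f -> epic f.
Proof. by move=> fI w g fg0; apply: (iso_epiI fI); rewrite comp0m. Qed.

Lemma is_zero_to x y (f : hom x y) : is_zero y -> f = 0.
Proof. by move=> y0; rewrite -[f]comp1m y0 comp0m. Qed.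

Lemma is_zero_from x y (f : hom x y) : is_zero x -> f = 0.
Proof. by move=> x0; rewrite -[f]compm1 x0 compm0. Qed.

Lemma kernel_zero_monic z x y (i : hom z x) (f : hom x y) :
  is_kernel i f -> i = 0 -> monic f.
Proof.
move=> [_ univ] i0 w g fg0; have [h [<- _]] := univ w g fg0.
by rewrite i0 comp0m.
Qed.

Lemma cokernel_zero_epic x y z (p : hom y z) (f : hom x y) :
  is_cokernel p f -> p = 0 -> epic f.
Proof.
move=> [_ univ] p0 w g gf0; have [h [<- _]] := univ w g gf0.
by rewrite p0 compm0.
Qed.

Lemma projective_sum n (p : 'I_n -> C) s :
  is_direct_sum p s -> (forall i, projective (p i)) -> projective s.
Proof.
move=> [inj [proj [_ _ sum1]]] pP x y e f eE.
have [g gE] : exists g : forall i, hom (p i) x, forall i, e ∘ g i = f ∘ inj i.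
  by apply: (@fin_all_exists _ (fun i => hom (p i) x)
               (fun i g => e ∘ g = f ∘ inj i)) => i; apply: pP.
exists (\sum_i (g i ∘ proj i)); rewrite comp_sumr.
under eq_bigr => i _ do rewrite compA gE -compA.
by rewrite -comp_sumr sum1 compm1.
Qed.

Section AbelianLemmas.
Hypothesis abC : abelian C.

Lemma abelian_zero : exists z : C, is_zero z.
Proof.
have [sums _ _ _ _] := abC.
have [z [inj [proj [_ _ sum1]]]] := sums 0%N (fun i => False_rect C (notF (ltn_ord i))).
by exists z; rewrite /is_zero -sum1 big_ord0.
Qed.

Lemma monic_epic_iso x y (f : hom x y) : monic f -> epic f -> is_iso f.
Proof.
have [_ _ _ mk _] := abC; move=> fm fe; have [z [g [gf univ]]] := mk _ _ _ fm.
have g0 : g = 0 by apply: fe.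
have [|h [fh _]] := univ y (idm y); first by rewrite g0 comp0m.
exists h; split=> //; apply: (monic_inj fm).
by rewrite compA fh comp1m compm1.
Qed.

(** With e the cokernel of the kernel of f and m the induced map, suppose m u = 0 and let p be the
    cokernel of u. The epimorphism p e is a cokernel of some h with f h = 0, thus e h = 0; so e
    factors through p e, which makes p a split monomorphism and u zero. *)
Lemma image_factorization x y (f : hom x y) :
  exists z (e : hom x z) (m : hom z y), [/\ epic e, monic m & m ∘ e = f].
Proof.
have [_ kers cokers _ epis] := abC.
have [z [i [fi univ]]] := kers _ _ f; have [t [e eC]] := cokers _ _ i.
have [m [me _]] := eC.2 _ f fi.
exists t, e, m; split=> //; first exact: cokernel_epic eC.
move=> w u mu0; have [q [p pC]] := cokers _ _ u.
have [m' [m'p _]] := pC.2 _ m mu0.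
have pe : epic (p ∘ e).
  by move=> v g; rewrite compA => /(cokernel_epic eC) /(cokernel_epic pC).
have [v [h [peh0 univ']]] := epis _ _ _ pe.
have fh0 : f ∘ h = 0 by rewrite -me -m'p -!compA (compA p) peh0 compm0.
have [h' [ih' _]] := univ _ h fh0.
have eh0 : e ∘ h = 0 by rewrite -ih' compA eC.1 comp0m.
have [s [spe _]] := univ' _ e eh0.
have sp : s ∘ p = idm t.
  by apply: (epic_inj (cokernel_epic eC)); rewrite comp1m -compA.
by rewrite -[u]comp1m -sp -compA pC.1 compm0.
Qed.

Lemma monic_kernel_coker x y z (f : hom x y) (p : hom y z) :
  monic f -> is_cokernel p f -> is_kernel f p.
Proof.
have [_ _ _ mk _] := abC; move=> fm [pf univ].
have [t [g [gf univ']]] := mk _ _ _ fm; split=> // w u pu0.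
by have [g' [g'p _]] := univ _ g gf; apply: univ'; rewrite -g'p -compA pu0 compm0.
Qed.

Lemma epic_coker_kernel x y z (p : hom y z) (i : hom x y) :
  epic p -> is_kernel i p -> is_cokernel p i.
Proof.
have [_ _ _ _ ek] := abC; move=> pe [pi univ].
have [t [g [pg univ']]] := ek _ _ _ pe; split=> // w u ui0.
by have [g' [ig' _]] := univ _ g pg; apply: univ'; rewrite -ig' compA ui0 comp0m.
Qed.

Lemma idempotent_splits x (p : hom x x) : p ∘ p = p -> inhabited (splitting p).
Proof.
move=> pp; have [z [e [m [eE mM me]]]] := image_factorization p.
suff em : e ∘ m = idm z by exists; exists z m e.
apply: (monic_inj mM); apply: (epic_inj eE).
by rewrite -!compA me (compA m) me pp comp1m me.
Qed.

Lemma simple_to_simple x y (f : hom x y) : simple x -> simple y -> f <> 0 -> is_iso f.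
Proof.
have [_ kers _ _ _] := abC; move=> [_ xS] [_ yS] fn0.
have [z [i iK]] := kers _ _ f.
have [i0|[j [_ ij]]] := xS _ i (kernel_monic iK); last first.
  by case: fn0; rewrite -[f]compm1 -ij compA iK.1 comp0m.
by have [] := yS _ f (kernel_zero_monic iK i0).
Qed.

(** For projective p this makes Hom(p, -) exact and faithful, so that the dimension of Hom(p, x) can
    replace the length of x in inductions. *)
Definition generator p := forall x, (forall f : hom p x, f = 0) -> is_zero x.

Section Generator.
Variable p : C.
Hypotheses (pP : projective p) (pG : generator p).

Lemma generator_dim_le x y (i : hom x y) : monic i ->
  (dim (hom p x) <= dim (hom p y))%N.
Proof.
move=> im; apply: (lfun_inj_dim (f := linfun (comp i))) => f g.
by rewrite !lfunE => /(monic_inj im).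
Qed.

Lemma generator_monic_iso x y (i : hom x y) : monic i ->
  (dim (hom p y) <= dim (hom p x))%N -> is_iso i.
Proof.
move=> im le; have [_ _ cokers _ _] := abC.
have surj : forall g : hom p y, exists f, i ∘ f = g.
  move=> g; have [|f] := @lfun_inj_surj k _ _ (linfun (@comp k C p x y i)) _ le g.
    by move=> f f'; rewrite !lfunE => /(monic_inj im).
  by rewrite lfunE; exists f.
have [z [c cC]] := cokers _ _ i.
have z0 : is_zero z.
  apply: pG => f; have [g <-] := pP f (cokernel_epic cC).
  by have [h <-] := surj g; rewrite compA cC.1 comp0m.
apply: monic_epic_iso => //; apply: cokernel_zero_epic cC _.
exact: is_zero_to.
Qed.

Lemma generator_monic_zero x y (s : hom x y) :
  (forall f : hom p x, s ∘ f = 0) -> monic s -> s = 0.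
Proof.
move=> s0 sm; apply: is_zero_from; apply: pG => f; apply: sm.
exact: s0.
Qed.

Lemma nat_max (Q : nat -> Prop) b : (exists n, Q n) ->
  (forall n, Q n -> (n <= b)%N) -> exists n, Q n /\ forall m, Q m -> (m <= n)%N.
Proof.
elim: b => [|b IH] [n Qn] le.
  by exists n; split=> // m /le; rewrite leqn0 => /eqP ->.
have [Qb|nQb] := classic (Q b.+1); first by exists b.+1.
apply: IH; first by exists n.
move=> m Qm; move: (le m Qm); rewrite leq_eqVlt ltnS => /orP[/eqP mb|//].
by rewrite mb in Qm.
Qed.

Lemma maximal_subobject x : ~ is_zero x ->
  exists z (i : hom z x), [/\ monic i, ~ is_iso i &
    forall w (j : hom w x), monic j -> ~ is_iso j ->
      (dim (hom p w) <= dim (hom p z))%N].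
Proof.
move=> xn0; pose Q d := exists z (i : hom z x),
  [/\ monic i, ~ is_iso i & dim (hom p z) = d].
have [|d [z [i [im iI zd]]]|d [[z [i [im iI zd]]] dmax]] := @nat_max Q (dim (hom p x)).
- have [z z0] := abelian_zero; exists (dim (hom p z)), z, 0; split=> //.
    by move=> w g _; apply: is_zero_to.
  by move=> [h [_]]; rewrite comp0m => /esym.
- by rewrite -zd; apply: generator_dim_le im.
exists z, i; split=> // w j jm jI; rewrite zd; apply: dmax.
by exists w, j.
Qed.

Lemma generator_finite_length x : finite_length x.
Proof.
have [_ kers cokers _ _] := abC.
move: {2}(dim (hom p x)).+1 (ltnSn (dim (hom p x))) => n.
elim: n x => // n IH x; rewrite ltnS => xn.
have [x0|xn0] := classic (is_zero x); first exact: finite_length0.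
have [z [i [im iI imax]]] := maximal_subobject xn0.
have [s [g gC]] := cokers _ _ i.
have ge := cokernel_epic gC.
apply: (@finite_lengthS k C z x s i g) => //.
- exact: monic_kernel_coker gC.
- apply: IH; apply: leq_trans xn; rewrite ltnNge; apply/negP => le.
  exact: iI (generator_monic_iso im le).
split=> [s0|t j jm].
  by apply: iI; apply: monic_epic_iso => //; apply: cokernel_zero_epic gC _; apply: is_zero_to.
have [u [c cC]] := cokers _ _ j.
(* w is the preimage in x of the subobject t of the quotient s. By maximality of z it is all of x,
   and then j is invertible, or it is z, and then j vanishes. *)
have [w [l lK]] := kers _ _ (c ∘ g).
have [li|lI] := classic (is_iso l).
  right; apply: monic_epic_iso => //; apply: cokernel_zero_epic cC _.
  by apply: ge; apply: (iso_epic li); exact: lK.1.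
left.
have [v [lv _]] : exists! v, l ∘ v = i.
  by apply: lK.2; rewrite -compA gC.1 compm0.
have lm := kernel_monic lK.
have vm : monic v by move=> w' h vh0; apply: im; rewrite -lv -compA vh0 compm0.
have [v' [_ vv']] := generator_monic_iso vm (imax _ _ lm lI).
have gl0 : g ∘ l = 0.
  by rewrite -[l]compm1 -vv' (compA l) lv compA gC.1 comp0m.
apply: generator_monic_zero jm => f.
have [b gb] := pP (j ∘ f) ge.
have [b' [lb _]] : exists! b', l ∘ b' = b.
  by apply: lK.2; rewrite -compA gb compA cC.1 comp0m.
by rewrite -gb -lb compA gl0 comp0m.
Qed.

Lemma finite_length_simple_quotients x : finite_length x ->
  exists n (s : 'I_n -> C), forall y (q : hom x y), simple y -> q <> 0 ->
    exists i, isomorphic y (s i).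
Proof.
elim=> {x} [x x0|x y z f g fK gC _ [n [s sP]] zS].
  exists 0%N, (fun _ => x) => y q _ [].
  exact: is_zero_from.
exists n.+1, (fun i => if unlift ord0 i is Some j then s j else z) => t q tS qn0.
have [qf0|qfn0] := classic (q ∘ f = 0).
  have [h [hg _]] := gC.2 _ q qf0.
  have [|h' hh'] := @simple_to_simple _ _ h zS tS.
    by move=> h0; apply: qn0; rewrite -hg h0 comp0m.
  exists ord0; rewrite unlift_none; exists h', h; exact: is_inverse_sym.
have [i iI] := sP _ _ tS qfn0.
by exists (lift ord0 i); rewrite liftK.
Qed.

(** Every simple object receives a nonzero morphism from p, so it is isomorphic to one of the
    finitely many composition factors of p. *)
Lemma generator_finitely_many_simples : finitely_many_simples C.
Proof.
have [n [s sP]] := finite_length_simple_quotients (generator_finite_length p).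
exists n, s => x xS.
suff [f fn0] : exists f : hom p x, f <> 0 by apply: sP fn0.
apply: NNPP => no; apply: xS.1; apply: pG => f.
by apply: NNPP => fn0; apply: no; exists f.
Qed.

End Generator.

End AbelianLemmas.

(** p is the sum of projective objects q_i mapping onto the simple objects s_i. A nonzero object has
    a simple quotient, and the map from the matching q_i lifts along it to a nonzero map. *)
Lemma finite_abelian_generator : finite_abelian C ->
  exists p : C, projective p /\ generator p.
Proof.
move=> [abC fl ep [n [s sP]]].
have [q qP] : exists q : 'I_n -> C, forall i,
    exists e : hom (q i) (s i), projective (q i) /\ epic e.
  by apply: (@fin_all_exists _ (fun _ => C) (fun i q =>
       exists e : hom q (s i), projective q /\ epic e)) => i; apply: ep.
have [sums _ _ _ _] := abC; have [p pS] := sums _ q; exists p.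
split; first by apply: projective_sum pS _ => i; case: (qP i) => e [].
move=> x x0; move: (fl x) x0; case=> {x} [//|a x z f g fK gC _ zS x0].
have [i [j [j' [j'j jj']]]] := sP z zS; have [e [eP ee]] := qP i.
have [inj [proj [projinj _ _]]] := pS.
have [h gh] := eP _ _ g (j' ∘ e) (cokernel_epic gC).
have h0 : h = 0 by rewrite -[h]compm1 -projinj compA (x0 (h ∘ proj i)) comp0m.
case: zS.1; rewrite /is_zero -j'j.
suff -> : j' = 0 by rewrite comp0m.
by apply: ee; rewrite -gh h0 compm0.
Qed.

End KernelLemmas.

(* The action of a rigid category is exact, as d ▷ - has the adjoints d^* ▷ -
   and ^*d ▷ -. *)
Section ExactAction.
Variables (k : fieldType) (D : rigidcat k) (M : lincat k) (L : laction D M).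
Local Notation "d ▷ m" := (lact L d m) (at level 38, right associativity).
Local Notation "f ▶ g" := (lactm L f g) (at level 38, right associativity).

Lemma lact_monic d (x y : M) (i : hom x y) : monic i -> monic (idm d ▶ i).
Proof.
move=> im w g ig0.
have E : cap L (ev d) x ∘ (idm (rdual d) ▶ g) = 0.
  by apply: im; rewrite compA -capN -compA -lactm_idl ig0 lactm0r compm0.
rewrite -[g]comp1m -(coev_ev L) -compA -cupN compA -lactm_idl.
by rewrite E lactm0r comp0m.
Qed.

Lemma lact_epic d (x y : M) (p : hom x y) : epic p -> epic (idm d ▶ p).
Proof.
move=> pe w g gp0.
have E : (idm (ldual d) ▶ g) ∘ cup L (coev' d) y = 0.
  by apply: pe; rewrite -compA -cupN compA -lactm_idl gp0 lactm0r comp0m.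
rewrite -[g]compm1 -(ev'_coev' L) compA -capN -compA -lactm_idl.
by rewrite E lactm0r compm0.
Qed.

Lemma lact_kernel d (z x y : M) (i : hom z x) (f : hom x y) :
  is_kernel i f -> is_kernel (idm d ▶ i) (idm d ▶ f).
Proof.
move=> iK; split=> [|w g fg0]; first by rewrite -lactm_idl iK.1 lactm0r.
have [h [ih _]] : exists! h, i ∘ h = cap L (ev d) x ∘ (idm (rdual d) ▶ g).
  by apply: iK.2; rewrite compA -capN -compA -lactm_idl fg0 lactm0r compm0.
have E : (idm d ▶ i) ∘ ((idm d ▶ h) ∘ cup L (coev d) w) = g.
  rewrite compA -lactm_idl ih lactm_idl -compA cupN compA coev_ev comp1m.
  by [].
exists ((idm d ▶ h) ∘ cup L (coev d) w); split=> // h' E'.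
by apply: (monic_inj (lact_monic (kernel_monic iK))); rewrite E E'.
Qed.

Lemma lact_cokernel d (x y z : M) (p : hom y z) (f : hom x y) :
  is_cokernel p f -> is_cokernel (idm d ▶ p) (idm d ▶ f).
Proof.
move=> pC; split=> [|w g gf0]; first by rewrite -lactm_idl pC.1 lactm0r.
have [h [hp _]] : exists! h, h ∘ p = (idm (ldual d) ▶ g) ∘ cup L (coev' d) y.
  by apply: pC.2; rewrite -compA -cupN compA -lactm_idl gf0 lactm0r comp0m.
have E : cap L (ev' d) w ∘ (idm d ▶ h) ∘ (idm d ▶ p) = g.
  rewrite -compA -lactm_idl hp lactm_idl compA capN -compA ev'_coev' compm1.
  by [].
exists (cap L (ev' d) w ∘ (idm d ▶ h)); split=> // h' E'.
by apply: (epic_inj (lact_epic (cokernel_epic pC))); rewrite E E'.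
Qed.

Lemma lact_exactr d : exact (F := fun m => d ▷ m) (fun m m' f => idm d ▶ f).
Proof.
by split=> *; [apply: lact_kernel | apply: lact_cokernel].
Qed.

End ExactAction.

(** * The category of modules over a Frobenius algebra *)

Section RmodAbelian.
Variables (k : fieldType) (C : rigidcat k) (A : frobalg C).
Local Notation a := (fa_ob A).
Local Notation U m := (rm_ob m).
Implicit Types (m n p : rmodule A).

Lemma tenm_epic (x y w : C) (p : hom x y) : epic p -> epic (p ⊠ idm w).
Proof. exact: (@lact_epic k (revr C) C (regular (revr C)) w). Qed.

(** Stated for a jointly monic family so as to serve direct sums, by their projections, as well as
    kernels, by the inclusion. *)
Lemma joint_submodule (I : Type) (z : C) (m : I -> rmodule A)
    (f : forall i, hom z (U (m i))) (r : hom (z ⊗ a) z) :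
  (forall w (g h : hom w z), (forall i, f i ∘ g = f i ∘ h) -> g = h) ->
  (forall i, f i ∘ r = rm_act (m i) ∘ (f i ⊠ idm a)) ->
  r ∘ (r ⊠ idm a) = r ∘ (idm z ⊠ mul A) ∘ assoc z a a
  /\ r ∘ (idm z ⊠ eta A) = run z.
Proof.
move=> fI fr; split; apply: fI => i.
  rewrite !compA fr -!compA -tenm_idr fr tenm_idr !compA rm_mul -!compA.
  by rewrite assocN tenm1 (compA (idm _ ⊠ mul A)) (compA (f i ⊠ _)) -!tenmM
    !comp1m !compm1.
rewrite compA fr -compA -tenmM comp1m compm1.
rewrite -[f i in LHS]comp1m -[eta A]compm1 tenmM compA rm_eta.
exact: runN.
Qed.

Lemma epic_quotient_module n (z : C) (p : hom (U n) z) (r : hom (z ⊗ a) z) :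
  epic p -> r ∘ (p ⊠ idm a) = p ∘ rm_act n ->
  r ∘ (r ⊠ idm a) = r ∘ (idm z ⊠ mul A) ∘ assoc z a a
  /\ r ∘ (idm z ⊠ eta A) = run z.
Proof.
move=> pe rp; split.
  apply: (epic_inj (tenm_epic (w := a) (tenm_epic (w := a) pe))).
  rewrite -!compA -tenm_idr rp tenm_idr (compA r) rp -!compA rm_mul.
  rewrite assocN tenm1 (compA (idm _ ⊠ mul A)) -tenmM comp1m compm1.
  have -> : p ⊠ mul A = (p ⊠ idm a) ∘ (idm _ ⊠ mul A).
    by rewrite -tenmM compm1 comp1m.
  by rewrite -!compA (compA r) rp -!compA.
apply: (epic_inj (tenm_epic (w := one C) pe)).
rewrite -compA -tenmM comp1m compm1 runN -rm_eta compA -rp -compA -tenmM.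
by rewrite compm1 comp1m.
Qed.

Lemma rmod_is_kernel (z m n : rmod A) (i : hom z m) (f : hom m n) :
  is_kernel (vsval i) (vsval f) -> is_kernel i f.
Proof.
move=> iK; split=> [|w g fg0]; first by apply: val_inj; exact: iK.1.
have [h [ih uniq]] := iK.2 _ (vsval g) (congr1 (@vsval _ _ _) fg0).
have hP : @is_rmhom k C A w z h.
  apply: (monic_inj (kernel_monic iK)); rewrite compA ih (rmhom_is g) -ih.
  by rewrite tenm_idr !compA (rmhom_is i).
exists (rmhom_of hP); split=> [|h' ih']; apply: val_inj => //.
by apply: uniq; rewrite -ih'.
Qed.

Lemma rmod_is_cokernel (m n z : rmod A) (p : hom n z) (f : hom m n) :
  is_cokernel (vsval p) (vsval f) -> is_cokernel p f.
Proof.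
move=> pC; split=> [|w g gf0]; first by apply: val_inj; exact: pC.1.
have [h [hp uniq]] := pC.2 _ (vsval g) (congr1 (@vsval _ _ _) gf0).
have hP : @is_rmhom k C A z w h.
  apply: (epic_inj (tenm_epic (w := a) (cokernel_epic pC))).
  rewrite -!compA -tenm_idr hp -(rmhom_is p) compA hp.
  exact: rmhom_is g.
exists (rmhom_of hP); split=> [|h' ih']; apply: val_inj => //.
by apply: uniq; rewrite -ih'.
Qed.

Hypothesis abC : abelian C.

Lemma rmod_sum l (m : 'I_l -> rmod A) : exists s, is_direct_sum m s.
Proof.
have [sums _ _ _ _] := abC.
have [s [inj [proj [pi pj sum1]]]] := sums l (fun i => U (m i)).
have projI w (g h : hom w s) : (forall i, proj i ∘ g = proj i ∘ h) -> g = h.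
  move=> E; rewrite -[g]comp1m -[h]comp1m -sum1 !comp_suml.
  by apply: eq_bigr => i _; rewrite -!compA E.
pose r := \sum_i (inj i ∘ (rm_act (m i) ∘ (proj i ⊠ idm a))).
have pr i : proj i ∘ r = rm_act (m i) ∘ (proj i ⊠ idm a).
  rewrite comp_sumr (bigD1 i) //= big1 ?addr0 ?compA ?pi ?comp1m //.
  by move=> j ji; rewrite compA pj // comp0m.
have [r1 r2] := joint_submodule projI pr.
pose S := Rmodule r1 r2.
have injP i : @is_rmhom k C A (m i) S (inj i).
  apply: projI => j; rewrite !compA /= pr.
  have [ij|ij] := eqVneq i j.
    by rewrite -[RHS]compA -tenm_idr -ij pi tenm1 comp1m compm1.
  rewrite pj // comp0m -[RHS]compA -tenm_idr pj //.
  by have := lactm0l (regular C) _ _ (idm a) => /= ->; rewrite compm0.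
exists S, (fun i => @rmhom_of k C A (m i) S (inj i) (injP i)),
  (fun i => @rmhom_of k C A S (m i) (proj i) (pr i)).
split=> [i|i j ij|]; apply: val_inj => //=.
- exact: pj.
- by rewrite linear_sum.
Qed.

Lemma rmod_kernel (m n : rmod A) (f : hom m n) :
  exists z (i : hom z m), is_kernel (vsval i) (vsval f).
Proof.
have [_ kers _ _ _] := abC; have [z [i iK]] := kers _ _ (vsval f).
have [r [ir _]] : exists! r, i ∘ r = rm_act m ∘ (i ⊠ idm a).
  apply: iK.2; rewrite compA (rmhom_is f) -compA -tenm_idr iK.1.
  by have := lactm0l (regular C) _ _ (idm a) => /= ->; rewrite compm0.
have [|r1 r2] := @joint_submodule unit z (fun _ => m) (fun _ => i) r _ (fun _ => ir).
  by move=> w g h /(_ tt) /(monic_inj (kernel_monic iK)).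
by exists (Rmodule r1 r2), (@rmhom_of k C A (Rmodule r1 r2) m i ir).
Qed.

Lemma rmod_cokernel (m n : rmod A) (f : hom m n) :
  exists z (p : hom n z), is_cokernel (vsval p) (vsval f).
Proof.
have [_ _ cokers _ _] := abC; have [z [p pC]] := cokers _ _ (vsval f).
have pC' := @lact_cokernel k (revr C) C (regular (revr C)) a _ _ _ _ _ pC.
have [r [rp _]] : exists! r, r ∘ (p ⊠ idm a) = p ∘ rm_act n.
  by apply: pC'.2; rewrite /= -compA -(rmhom_is f) compA pC.1 comp0m.
have [r1 r2] := epic_quotient_module (cokernel_epic pC) rp.
by exists (Rmodule r1 r2), (@rmhom_of k C A n (Rmodule r1 r2) p (esym rp)).
Qed.

Lemma rmod_monic (m n : rmod A) (f : hom m n) : monic f -> monic (vsval f).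
Proof.
move=> fm; have [z [i iK]] := rmod_kernel f.
have i0 : i = 0 by apply: fm; apply: val_inj; exact: iK.1.
by apply: (kernel_zero_monic iK); rewrite i0.
Qed.

Lemma rmod_epic (m n : rmod A) (f : hom m n) : epic f -> epic (vsval f).
Proof.
move=> fe; have [z [p pC]] := rmod_cokernel f.
have p0 : p = 0 by apply: fe; apply: val_inj; exact: pC.1.
by apply: (cokernel_zero_epic pC); rewrite p0.
Qed.

Lemma rmod_abelian : abelian (rmod A).
Proof.
split.
- exact: rmod_sum.
- by move=> m n f; have [z [i /rmod_is_kernel iK]] := rmod_kernel f; exists z, i.
- by move=> m n f; have [z [p /rmod_is_cokernel pC]] := rmod_cokernel f; exists z, p.
- move=> m n f /rmod_monic fm; have [z [p pC]] := rmod_cokernel f; exists z, p.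
  by apply: rmod_is_kernel; apply: monic_kernel_coker.
- move=> m n f /rmod_epic fe; have [z [i iK]] := rmod_kernel f; exists z, i.
  by apply: rmod_is_cokernel; apply: epic_coker_kernel.
Qed.

Definition rmod_regular : rmodule A := Rmodule (mul_assoc A) (mul_etar A).

Definition free_rmodule (x : C) : rmod A := rm_lact x rmod_regular.

Lemma free_rmodule_epic m : epic (rm_act m).
Proof.
move=> w g g0; rewrite -[g]compm1 -(runK (U m)).2 -(rm_eta m) !compA g0.
by rewrite !comp0m.
Qed.

Fact free_map_is_rmhom x m (f : hom x (U m)) :
  @is_rmhom k C A (free_rmodule x) m (rm_act m ∘ (f ⊠ idm a)).
Proof.
rewrite /is_rmhom /= /rm_lact_act /= -!compA (compA (f ⊠ _)) -tenmM comp1m.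
rewrite compm1 tenm_idr (compA (rm_act m) (rm_act m ⊠ _)) rm_mul -!compA.
rewrite assocN tenm1 (compA (idm _ ⊠ mul A)) -tenmM comp1m compm1.
by [].
Qed.

Definition free_map x m (f : hom x (U m)) : @hom k (rmod A) (free_rmodule x) m :=
  rmhom_of (free_map_is_rmhom f).

Definition free_unmap x m (g : @hom k (rmod A) (free_rmodule x) m) : hom x (U m) :=
  vsval g ∘ (idm x ⊠ eta A) ∘ run' x.

Lemma free_unmapK x m : cancel (@free_unmap x m) (@free_map x m).
Proof.
move=> g; apply: val_inj; rewrite /= /free_unmap !tenm_idr !compA -(rmhom_is g).
rewrite /= /rm_lact_act /= -!compA (compA (assoc _ _ _)) assocN.
rewrite -!compA (compA (idm x ⊠ mul A)) -tenm_idl mul_etal (compA (idm x ⊠ lun _)).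
by rewrite ten_triangle -tenm_idr (runK x).2 tenm1 compm1.
Qed.

Lemma free_mapK x m : cancel (@free_map x m) (@free_unmap x m).
Proof.
move=> f; rewrite /free_unmap /= -!compA (compA (f ⊠ _)) -tenmM comp1m compm1.
rewrite -{1}[f]comp1m -[eta A]compm1 tenmM -compA (compA (rm_act m)) rm_eta.
by rewrite compA runN -compA (runK x).2 compm1.
Qed.

Lemma free_rmodule_projective x : projective x -> projective (free_rmodule x).
Proof.
move=> xP m n e f /rmod_epic ee.
have [h eh] := xP _ _ _ (free_unmap f) ee; exists (free_map h).
rewrite -[f]free_unmapK -eh; apply: val_inj.
by rewrite /= compA (rmhom_is e) -compA -tenm_idr.
Qed.

Lemma free_rmodule_generator x : generator x -> generator (free_rmodule x).
Proof.
move=> xG m m0; apply: val_inj; apply: (xG (U m)) => f.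
rewrite -[f]free_mapK (m0 (free_map f)).
by rewrite /free_unmap /= !comp0m.
Qed.

Lemma rmod_enough_projectives :
  enough_projectives C -> enough_projectives (rmod A).
Proof.
move=> ep m; have [p [e [pP eE]]] := ep (U m).
exists (free_rmodule p), (free_map e); split; first exact: free_rmodule_projective.
move=> n g /(congr1 (@vsval _ _ _)) /=; rewrite compA => g0; apply: val_inj.
by apply: free_rmodule_epic; apply: (tenm_epic (w := a) eE).
Qed.

End RmodAbelian.

Section RmodFinite.
Variables (k : fieldType) (C : rigidcat k) (A : frobalg C).
Hypothesis finC : finite_abelian C.

Lemma rmod_finite_abelian : finite_abelian (rmod A).
Proof.
have [abC _ ep _] := finC.
have [p [pP pG]] := finite_abelian_generator finC.
have abA := rmod_abelian A abC.
have qP := free_rmodule_projective (A := A) abC pP.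
have qG := free_rmodule_generator (A := A) pG.
split=> //.
- exact: generator_finite_length qP qG.
- exact: rmod_enough_projectives.
- exact: generator_finitely_many_simples qP qG.
Qed.

Lemma rmod_module_category : module_category (rmod_laction A).
Proof.
split; first exact: rmod_finite_abelian.
split=> [m|d]; last exact: lact_exactr.
split=> x y z i f E.
- apply: rmod_is_kernel.
  exact: (@lact_kernel k (revr C) C (regular (revr C)) (rm_ob m) _ _ _ _ _ E).
- apply: rmod_is_cokernel.
  exact: (@lact_cokernel k (revr C) C (regular (revr C)) (rm_ob m) _ _ _ _ _ E).
Qed.

End RmodFinite.

Lemma dim_vdual (k : fieldType) (V : vectType k) : dim (vdual V) = dim V.
Proof. by rewrite /dim /= muln1. Qed.

Definition lfun_of (k : fieldType) (V W : vectType k) (f : V -> W)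
    (fL : linear f) : 'Hom(V, W) :=
  let F : {linear V -> W} := HB.pack f (GRing.isLinear.Build k V W _ f fL) in
  linfun F.

Lemma lfun_ofE (k : fieldType) (V W : vectType k) (f : V -> W) (fL : linear f) x :
  lfun_of fL x = f x.
Proof. by rewrite lfunE. Qed.

(** * Trace forms and inner products *)

Record trace_form (k : fieldType) (C : lincat k) := TraceForm {
  tf :> forall x : C, hom x x -> k;
  tf_linear : forall x a (f g : hom x x), tf (a *: f + g) = a * tf f + tf g;
  tf_cyclic : forall (x y : C) (f : hom x y) (g : hom y x),
    tf (g ∘ f) = tf (f ∘ g);
  tf_nondegenerate : forall (x y : C) (g : hom x y),
    (forall f : hom y x, tf (f ∘ g) = 0) -> g = 0 }.

Section TraceForm.
Variables (k : fieldType) (C : lincat k) (t : trace_form C).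

Lemma tf_inj (x y : C) (g g' : hom x y) :
  (forall f : hom y x, t _ (f ∘ g) = t _ (f ∘ g')) -> g = g'.
Proof.
move=> E; apply/eqP; rewrite -subr_eq0 addrC -scaleN1r; apply/eqP.
apply: (@tf_nondegenerate _ _ t) => f.
by rewrite compDr compZr tf_linear E mulN1r addNr.
Qed.

Let form_linear (x y : C) (g : hom x y) :
  linear ((fun f => t _ (f ∘ g)) : hom y x -> k^o).
Proof. by move=> a f f'; rewrite compDl compZl tf_linear. Qed.

Let form_linear2 (x y : C) :
  linear (fun g : hom x y => lfun_of (form_linear g) : vdual (hom y x)).
Proof.
move=> a g g'; apply/lfunP => f.
by rewrite add_lfunE scale_lfunE !lfun_ofE compDr compZr tf_linear.
Qed.

Let form_inj (x y : C) : injective (lfun_of (@form_linear2 x y)).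
Proof.
move=> g g'; rewrite !lfun_ofE => E; apply: tf_inj => f.
by have := congr1 (fun F : vdual _ => F f) E; rewrite !lfun_ofE.
Qed.

Lemma tf_perfect (x y : C) (phi : hom y x -> k) :
  (forall a f f', phi (a *: f + f') = a * phi f + phi f') ->
  exists g : hom x y, forall f, t _ (f ∘ g) = phi f.
Proof.
move=> phiL; have phiL' : linear (phi : hom y x -> k^o) by exact: phiL.
have [|g gE] := lfun_inj_surj (@form_inj x y) _ (lfun_of phiL').
  (* Nondegeneracy in the other direction bounds the dimension of Hom(y, x) by that of Hom(x, y), so
     the injection into the dual is onto. *)
  by rewrite dim_vdual -(dim_vdual (hom x y)); exact: lfun_inj_dim (@form_inj y x).
exists g => f; have := congr1 (fun F : vdual _ => F f) gE.
by rewrite !lfun_ofE.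
Qed.

End TraceForm.

Section FusionTrace.
Variables (k : fieldType) (C : pivcat k) (fusC : fusion C).

Lemma fusion_one_nonzero : ~ is_zero (one C).
Proof.
move=> z; have [_ [g gK _]] := fusC.1.
have E : (1 : k) = 0 by rewrite -[1](gK) -[0 in RHS]gK z !scaler0.
by have := oner_neq0 k; rewrite E eqxx.
Qed.

(** The idempotent of a simple summand of 1 lies in End(1) = k, so it is a scalar a with a a = a. A
    nonzero one is 1, and then that summand is all of 1. *)
Lemma fusion_one_simple : exists (s : C) (i : hom s (one C)) (j : hom (one C) s),
  simple s /\ is_inverse i j.
Proof.
have [[_ [sc scK scV]] ss] := fusC.
have [n [x [xS [inj [proj [pi pj sum1]]]]]] := ss (one C).
have [i ni] : exists i, inj i ∘ proj i <> 0.
  apply: NNPP => no; apply: fusion_one_nonzero; rewrite /is_zero -sum1 big1 // => i _.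
  by apply: NNPP => ni; apply: no; exists i.
exists (x i), (inj i), (proj i); split=> //; split=> //.
have E := scV (inj i ∘ proj i); set a := sc _ in E.
have : (a * a) *: idm (one C) = a *: idm (one C).
  rewrite -scalerA -[a *: idm _ in LHS]comp1m -compZl E -compA (compA (proj i)).
  by rewrite pi comp1m.
move/(can_inj scK); have a0 : a != 0 by apply/eqP => a0; apply: ni; rewrite -E a0 scale0r.
by move=> aa; rewrite -E (mulfI a0 (etrans aa (esym (mulr1 a)))) scale1r.
Qed.

Lemma fusion_one_retract (w : C) (f : hom (one C) w) : f <> 0 ->
  exists q : hom w (one C), q ∘ f = idm (one C).
Proof.
have [[[abC _ _ _] _] ss] := fusC.
have [s [i [j [sS [ji ij]]]]] := fusion_one_simple.
have [n [x [xS [inj [proj [_ _ sum1]]]]]] := ss w => fn0.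
have [l ln] : exists l, proj l ∘ f ∘ i <> 0.
  apply: NNPP => no; apply: fn0; rewrite -[f]compm1 -ij compA -[f]comp1m -sum1.
  rewrite !comp_suml big1 // => l _; apply: NNPP => nl; apply: no; exists l => E.
  by apply: nl; rewrite -!compA (compA f) (compA (proj l)) (compA (proj l)) E comp0m compm0.
have [r [rK _]] := simple_to_simple abC sS (xS l) ln.
exists (i ∘ r ∘ proj l).
by rewrite -[LHS]compm1 -[X in _ ∘ X]ij -!compA (compA f) (compA (proj l))
  (compA (proj l)) (compA r) rK comp1m.
Qed.

(* [traceR] takes values in End(1) = k. *)
Lemma fusion_trace_form : exists t : trace_form C,
  forall (x y : C) (f : hom x x) (g : hom y y), traceR f = traceR g -> t _ f = t _ g.
Proof.
have [_ [sc scK scV]] := fusC.1.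
have trL (x : C) a (f g : hom x x) :
    sc (traceR (a *: f + g)) = a * sc (traceR f) + sc (traceR g).
  apply: (can_inj scK); rewrite scV scalerDl -scalerA !scV /traceR.
  by rewrite tenm_linl comp_linr comp_linl.
have cyc (x y : C) (f : hom x y) (g : hom y x) :
    sc (traceR (g ∘ f)) = sc (traceR (f ∘ g)) by rewrite traceR_cyclic.
have nd (x y : C) (g : hom x y) :
    (forall f : hom y x, sc (traceR (f ∘ g)) = 0) -> g = 0.
  move=> g0; apply: traceR_nondegenerate => [w c c0|f]; last first.
    by rewrite -[LHS]scV g0 scale0r.
  apply: NNPP => /fusion_one_retract [q qc]; apply: fusion_one_nonzero.
  by rewrite /is_zero -qc.
exists (@TraceForm k C (fun x f => sc (traceR f)) trL cyc nd) => x y f g /= E.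
by rewrite E.
Qed.

End FusionTrace.

(** * Existence of inner homs over a semisimple category *)

Section InnerHomExistence.
Variables (k : fieldType) (D : pivcat k) (M : lincat k) (L : laction D M).
Local Notation "d ▷ m" := (lact L d m) (at level 38, right associativity).
Local Notation "f ▶ g" := (lactm L f g) (at level 38, right associativity).
Hypotheses (finD : finite_abelian D) (ssD : semisimple D) (exL : lact_exact L).
Variables m n : M.

Lemma semisimple_generator : exists G : D, forall s, simple s ->
  exists (i : hom s G) (r : hom G s), r ∘ i = idm s.
Proof.
have [[sums _ _ _ _] _ _ [l [s sP]]] := finD.
have [G [inj [proj [pi _ _]]]] := sums l s.
exists G => x /sP [i [f [g [gf _]]]]; exists (inj i ∘ f), (g ∘ proj i).
by rewrite -compA (compA (proj i)) pi comp1m.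
Qed.

Definition versal (X : D) (u : hom m (X ▷ n)) :=
  forall d (f : hom m (d ▷ n)), exists g : hom X d, (g ▶ idm n) ∘ u = f.

(** X has one copy of the sum G of all simple objects for each element of a basis of Hom(m, G ▷ n),
    and u collects this basis. *)
Lemma versal_exists : exists X (u : hom m (X ▷ n)), versal u.
Proof.
have [G GP] := semisimple_generator; have [[sums _ _ _ _] _ _ _] := finD.
pose b := vbasis (fullv : {vspace hom m (G ▷ n)}).
have [X [inj [proj [pi pj _]]]] := sums (\dim (fullv : {vspace hom m (G ▷ n)})) (fun _ => G).
exists X, (\sum_i ((inj i ▶ idm n) ∘ b`_i)) => d f.
have [l [s [sS [inj' [proj' [_ _ sum1]]]]]] := ssD d.
have [h hE] : exists h : forall i, hom X (s i), forall i,
    (h i ▶ idm n) ∘ (\sum_i ((inj i ▶ idm n) ∘ b`_i)) = (proj' i ▶ idm n) ∘ f.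
  suff E i : exists h : hom X (s i),
      (h ▶ idm n) ∘ (\sum_i ((inj i ▶ idm n) ∘ b`_i)) = (proj' i ▶ idm n) ∘ f.
    exists (fun i => proj1_sig (constructive_indefinite_description _ (E i))) => i.
    exact: proj2_sig (constructive_indefinite_description _ (E i)).
  (* The component of f at a simple summand is pushed into G ▷ n by j, expanded in the basis, and
     brought back by r. *)
  have [j [r rj]] := GP _ (sS i); pose v := (j ∘ proj' i) ▶ idm n ∘ f.
  exists (r ∘ \sum_i (coord b i v *: proj i)).
  rewrite lactm_idr -compA.
  have -> : (\sum_i (coord b i v *: proj i)) ▶ idm n ∘ (\sum_i ((inj i ▶ idm n) ∘ b`_i)) = v.
    rewrite [RHS](coord_vbasis (memvf v)) comp_sumr; apply: eq_bigr => a _.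
    rewrite compA -lactm_idr comp_suml (bigD1 a) //= big1 ?addr0.
      by rewrite compZl pi lactmZl lactm1 compZl comp1m.
    by move=> c ca; rewrite compZl pj ?scaler0 // eq_sym.
  by rewrite compA -lactm_idr compA rj comp1m.
exists (\sum_i (inj' i ∘ h i)).
have actsum (I : finType) (x y : D) (F : I -> hom x y) :
    (\sum_i F i) ▶ idm n = \sum_i (F i ▶ idm n).
  by elim/big_ind2: _ => [|a1 a2 b1 b2 <- <-|//]; rewrite ?lactm0l ?lactmDl.
rewrite actsum comp_suml.
transitivity ((\sum_i (inj' i ∘ proj' i)) ▶ idm n ∘ f); last by rewrite sum1 lactm1 comp1m.
rewrite actsum comp_suml; apply: eq_bigr => i _.
by rewrite !lactm_idr -!compA hE.
Qed.

(* A versal object of minimal size is universal: otherwise the kernel of a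
   morphism vanishing on it would be a smaller versal object. *)
Lemma universal_exists : exists X (u : hom m (X ▷ n)),
  forall d (f : hom m (d ▷ n)), exists! g : hom X d, (g ▶ idm n) ∘ u = f.
Proof.
have [abD _ _ _] := finD; have [_ kers _ _ _] := abD.
have [p [pP pG]] := finite_abelian_generator finD.
suff [X [u [uV uU]]] : exists X (u : hom m (X ▷ n)), versal u /\
    forall d (g : hom X d), (g ▶ idm n) ∘ u = 0 -> g = 0.
  exists X, u => d f; have [g gf] := uV d f; exists g; split=> // g' g'f.
  apply/eqP; rewrite -subr_eq0; apply/eqP; apply: uU.
  by rewrite lactmDl -[- g']scaleN1r lactmZl compDl compZl gf g'f scaleN1r subrr.
have [X [u uV]] := versal_exists.
move: {2}(dim (hom p X)).+1 (ltnSn (dim (hom p X))) => l.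
elim: l => // l IH in X u uV *; rewrite ltnS => Xl.
case: (classic (forall d (g : hom X d), (g ▶ idm n) ∘ u = 0 -> g = 0)) => [uU|].
  by exists X, u.
move/not_all_ex_not => [d] /not_all_ex_not [g] H.
have [gu0 gn0] : (g ▶ idm n) ∘ u = 0 /\ g <> 0.
  by apply: NNPP => H'; apply: H => gu; apply: NNPP => gn; apply: H'.
have [K [i iK]] := kers _ _ g.
(* As - ▷ n is exact, it preserves the kernel of g, so u factors through K ▷ n. *)
have [_ iU] := (exL.1 n).1 _ _ _ _ _ iK; have [v [iv _]] := iU _ u gu0.
apply: (IH K v) => [e f|].
  have [h hf] := uV e f; exists (h ∘ i).
  by rewrite lactm_idr -compA iv.
rewrite (leq_trans _ Xl) // ltnNge; apply/negP => le.
have iI := generator_monic_iso abD pP pG (kernel_monic iK) le.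
by apply: gn0; apply: (iso_epic iI); exact: iK.1.
Qed.

End InnerHomExistence.

Lemma linner_exists (k : fieldType) (D : pivcat k) (M : lincat k)
    (L : laction D M) :
  finite_abelian D -> semisimple D -> lact_exact L -> inhabited (linner L).
Proof.
move=> finD ssD exL.
have U m n := constructive_indefinite_description _ (universal_exists finD ssD exL m n).
pose X m n := proj1_sig (U m n).
have V m n := constructive_indefinite_description _ (proj2_sig (U m n)).
pose u m n : hom m (lact L (X m n) n) := proj1_sig (V m n).
have uP m n d (f : hom m (lact L d n)) :
    exists! g : hom (X m n) d, lactm L g (idm n) ∘ u m n = f.
  exact: proj2_sig (V m n) d f.
pose fl m n d (f : hom m (lact L d n)) : hom (X m n) d :=
  proj1_sig (constructive_indefinite_description _ (uP m n d f)).
have flP m n d f : lactm L (@fl m n d f) (idm n) ∘ u m n = f.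
  by have [] := proj2_sig (constructive_indefinite_description _ (uP m n d f)).
have uI m n d (g g' : hom (X m n) d) :
    lactm L g (idm n) ∘ u m n = lactm L g' (idm n) ∘ u m n -> g = g'.
  move=> E; have [h [_ hU]] := uP m n d (lactm L g (idm n) ∘ u m n).
  by rewrite -(hU g) // (hU g').
constructor.
refine (@Linner k D M L X fl (fun m n d g => lactm L g (idm n) ∘ u m n) _ _ _).
- exact: flP.
- by move=> m n d g; apply: uI; rewrite flP.
- by move=> m n d d' v f; apply: uI; rewrite flP lactm_idr -compA flP.
Qed.

(** * Right actions as left actions of the reversed category *)

Section ReverseActions.
Variables (k : fieldType) (M : lincat k).

Lemma rassocV (C : moncat k) (R : raction C M) m c d :
  rassoc R m c d ∘ rassoc' R m c d = idm _.
Proof. by have [] := rassocK R m c d. Qed.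

Lemma rassoc'V (C : moncat k) (R : raction C M) m c d :
  rassoc' R m c d ∘ rassoc R m c d = idm _.
Proof. by have [] := rassocK R m c d. Qed.

Lemma rassoc'N (C : moncat k) (R : raction C M) (m m' : M) (c c' d d' : C)
    (f : hom m m') (g : hom c c') (h : hom d d') :
  rassoc' R m' c' d' ∘ ractm R f (g ⊠ h)
  = ractm R (ractm R f g) h ∘ rassoc' R m c d.
Proof.
rewrite -[LHS]compm1 -(rassocV R m) compA -(compA _ _ (rassoc R _ _ _)) -rassocN.
by rewrite (compA (rassoc' R _ _ _)) rassoc'V comp1m.
Qed.

Lemma ractm_is_inverse (C : moncat k) (R : raction C M) (m m' : M) (c c' : C)
    (f : hom m m') f' (g : hom c c') g' :
  is_inverse f f' -> is_inverse g g' -> is_inverse (ractm R f g) (ractm R f' g').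
Proof.
move=> [f1 f2] [g1 g2].
by split; rewrite -ractmM ?f1 ?f2 ?g1 ?g2 ractm1.
Qed.

Lemma lactm_is_inverse (D : moncat k) (L : laction D M) (m m' : M) (c c' : D)
    (f : hom c c') f' (g : hom m m') g' :
  is_inverse f f' -> is_inverse g g' -> is_inverse (lactm L f g) (lactm L f' g').
Proof.
move=> [f1 f2] [g1 g2].
by split; rewrite -lactmM ?f1 ?f2 ?g1 ?g2 lactm1.
Qed.

Definition ractl (C : moncat k) (R : raction C M) : laction (revm C) M.
Proof.
refine (@Laction k (revm C) M (fun c m => ract R m c)
  (fun c c' m m' f g => ractm R g f) _ _ _ _
  (fun c d m => rassoc' R m d c) (fun c d m => rassoc R m d c) _ _
  (runit R) (runit' R) (runitK R) (runitN R) _ _).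
- by move=> *; apply: ractm1.
- by move=> *; apply: ractmM.
- by move=> *; apply: ractm_linr.
- by move=> *; apply: ractm_linl.
- by move=> c d m; exact: is_inverse_sym (rassocK R m d c).
- by move=> *; apply: rassoc'N.
- move=> b c d m /=; rewrite -[RHS]compA.
  apply: is_inverse_uniq (ract_pentagon R m d c b).
    by apply: is_inverse_comp; apply: rassocK.
  apply: is_inverse_comp.
    by apply: ractm_is_inverse (rassocK _ _ _ _) (is_inverse_id _).
  apply: is_inverse_comp; first exact: rassocK.
  exact: ractm_is_inverse (is_inverse_id _) (assocK _ _ _).
- by move=> d m /=; rewrite -ract_triangle -compA rassocV compm1.
Defined.

Definition lactr (D : moncat k) (L : laction D M) : raction (revm D) M.
Proof.
refine (@Raction k (revm D) M (fun m d => lact L d m)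
  (fun m m' c c' f g => lactm L g f) _ _ _ _
  (fun m c d => lassoc' L d c m) (fun m c d => lassoc L d c m) _ _
  (lunit L) (lunit' L) (lunitK L) (lunitN L) _ _).
- by move=> *; apply: lactm1.
- by move=> *; apply: lactmM.
- by move=> *; apply: lactm_linr.
- by move=> *; apply: lactm_linl.
- by move=> c d m; exact: is_inverse_sym (lassocK L m d c).
- by move=> *; apply: lassoc'N.
- move=> m b c d /=; rewrite -[RHS]compA.
  apply: is_inverse_uniq (lact_pentagon L d c b m).
    by apply: is_inverse_comp; apply: lassocK.
  apply: is_inverse_comp.
    by apply: lactm_is_inverse (assocK _ _ _) (is_inverse_id _).
  apply: is_inverse_comp; first exact: lassocK.
  exact: lactm_is_inverse (is_inverse_id _) (lassocK _ _ _ _).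
- by move=> d m /=; rewrite -lact_triangle -compA lassocV compm1.
Defined.

Lemma bassocV (D C : moncat k) (B : biaction D C M) d m c :
  bassoc B d m c ∘ bassoc' B d m c = idm _.
Proof. by have [] := bassocK B d m c. Qed.

Lemma bassoc'V (D C : moncat k) (B : biaction D C M) d m c :
  bassoc' B d m c ∘ bassoc B d m c = idm _.
Proof. by have [] := bassocK B d m c. Qed.

Lemma bassoc'N (D C : moncat k) (B : biaction D C M) (d d' : D) (m m' : M)
    (c c' : C) (f : hom d d') (g : hom m m') (h : hom c c') :
  bassoc' B d' m' c' ∘ lactm (ba_l B) f (ractm (ba_r B) g h)
  = ractm (ba_r B) (lactm (ba_l B) f g) h ∘ bassoc' B d m c.
Proof.
rewrite -[LHS]compm1 -(bassocV B d m c) compA -(compA _ _ (bassoc B _ _ _)).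
by rewrite -bassocN (compA (bassoc' B _ _ _)) bassoc'V comp1m.
Qed.

Definition revb (D C : moncat k) (B : biaction D C M) :
  biaction (revm C) (revm D) M.
Proof.
refine (@Biaction k (revm C) (revm D) M (ractl (ba_r B)) (lactr (ba_l B))
  (fun c m d => bassoc' B d m c) (fun c m d => bassoc B d m c) _ _ _ _ _ _).
- by move=> d m c; exact: is_inverse_sym (bassocK B c m d).
- by move=> *; apply: bassoc'N.
- move=> d d' m c /=; rewrite -[RHS]compA.
  apply: is_inverse_uniq (bact_pentagonr B c m d' d).
    by apply: is_inverse_comp; [exact: rassocK | exact: bassocK].
  apply: is_inverse_comp.
    by apply: ractm_is_inverse (bassocK _ _ _ _) (is_inverse_id _).
  apply: is_inverse_comp; first exact: bassocK.
  exact: lactm_is_inverse (is_inverse_id _) (rassocK _ _ _ _).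
- move=> d m c c' /=; rewrite -[RHS]compA.
  apply: is_inverse_uniq (bact_pentagonl B c' c m d).
    by apply: is_inverse_comp; [exact: bassocK | exact: lassocK].
  apply: is_inverse_comp.
    by apply: ractm_is_inverse (lassocK _ _ _ _) (is_inverse_id _).
  apply: is_inverse_comp; first exact: bassocK.
  exact: lactm_is_inverse (is_inverse_id _) (bassocK _ _ _ _).
- by move=> m c /=; rewrite -bact_triangler -compA bassocV compm1.
- by move=> d m /=; rewrite -bact_trianglel -compA bassocV compm1.
Defined.

End ReverseActions.

Section LeftPartialTrace.
Variables (k : fieldType) (D : pivcat k).
Implicit Types (d x : D).

Definition lptrace d x (v : hom (d ⊗ x) (d ⊗ x)) : hom x x :=
  (lun x ∘ (evq d ⊠ idm x) ∘ assoc' (ldual d) d x) ∘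
  ((idm (ldual d) ⊠ v) ∘
   (assoc (ldual d) d x ∘ ((coev' d ⊠ idm x) ∘ lun' x))).

Lemma lptrace_rev d x (v : hom (d ⊗ x) (d ⊗ x)) :
  lptrace v = @ptrace k (revp D) x d v.
Proof. by rewrite /ptrace evp_rev. Qed.

Lemma traceL_lptrace d x (v : hom (d ⊗ x) (d ⊗ x)) :
  traceL v = traceL (lptrace v).
Proof. by rewrite !traceL_rev lptrace_rev; exact: (@traceR_ptrace k (revp D)). Qed.

Lemma lptrace_lact (M : lincat k) (L : laction D M) d x
    (v : hom (d ⊗ x) (d ⊗ x)) m :
  lactm L (lptrace v) (idm m) = cap L (evq d) (lact L x m) ∘
   (lactm L (idm _) (lassoc L d x m ∘ (lactm L v (idm m) ∘ lassoc' L d x m))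
    ∘ cup L (coev' d) (lact L x m)).
Proof.
rewrite /lptrace lactm_idr cap_lact (lactm_idr L m (idm _ ⊠ v)) -!compA.
rewrite (compA (lassoc L _ _ _)) lassocN -!compA -cup_lact !lactm_idl -!compA.
congr (_ ∘ (_ ∘ (_ ∘ _))).
by rewrite (compA (lactm L _ (lassoc' L _ _ _))) -lactm_idl lassoc'V lactm1 comp1m.
Qed.

End LeftPartialTrace.

(* The left duality functor is left adjoint to d ▷ - by [ev'], and right adjoint
   to it by the pivotal structure; a trace is compatible with the action if it
   intertwines the two adjunctions. *)
Definition trace_adjoint (k : fieldType) (D : pivcat k) (M : lincat k)
    (t : trace_form M) (L : laction D M) : Prop :=
  forall (d : D) (n m : M) (h : hom n (lact L d m)) (g : hom m (lact L (ldual d) n)),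
    t _ (cap L (ev' d) n ∘ (lactm L (idm d) g ∘ h))
    = t _ (g ∘ (cap L (evq d) m ∘ lactm L (idm _) h)).

(** * The counit defined by a pair of traces *)

Section TraceCounit.
Variables (k : fieldType) (D : pivcat k) (M : lincat k) (L : laction D M).
Local Notation "d ▷ m" := (lact L d m) (at level 38, right associativity).
Local Notation "f ▶ g" := (lactm L f g) (at level 38, right associativity).
Implicit Types (d x y : D) (m n : M).
Variables (t : trace_form M) (s : trace_form D).
Hypothesis sP : forall (x y : D) (f : hom x x) (g : hom y y),
  traceR f = traceR g -> s _ f = s _ g.
Hypothesis sphD : spherical D.
Hypothesis tL : trace_adjoint t L.
Variable H : linner L.
Local Notation "⟨ m , n ⟩" := (linn H m n).
Local Notation u := (lun_inn H).

(** The partial trace over d, for morphisms of M: f is written as a transpose along [ev'], and the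
    compatibility of t turns this into a closure by [evq]. *)
Lemma trace_lact d m n (f : hom (d ▷ m) (d ▷ n)) (g : hom n m) :
  t _ (f ∘ (idm d ▶ g))
  = t _ ((cap L (evq d) n ∘ ((idm _ ▶ f) ∘ cup L (coev' d) m)) ∘ g).
Proof.
have E : f = cap L (ev' d) (d ▷ n) ∘ (idm d ▶ ((idm _ ▶ f) ∘ cup L (coev' d) m)).
  by rewrite lactm_idl compA capN -compA ev'_coev' compm1.
rewrite {1}E -[X in t _ X]compA tL capN (compA _ g) tf_cyclic -!compA.
by [].
Qed.

Lemma trace_counit_exists m n : exists p : hom (⟨m, n⟩ ▷ n) m,
  forall w : hom m (⟨m, n⟩ ▷ n), t _ (w ∘ p) = s _ (lflat H w).
Proof.
apply: tf_perfect => a f g.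
suff -> : lflat H (a *: f + g) = a *: lflat H f + lflat H g by rewrite tf_linear.
apply: linn_inj; rewrite lactmDl lactmZl compDl compZl !lflat_lun.
by [].
Qed.

Definition trace_cun m n : hom (⟨m, n⟩ ▷ n) m :=
  proj1_sig (constructive_indefinite_description _ (trace_counit_exists m n)).
Local Notation p := trace_cun.

Lemma trace_cunP m n (w : hom m (⟨m, n⟩ ▷ n)) :
  t _ (w ∘ p m n) = s _ (lflat H w).
Proof.
exact: proj2_sig (constructive_indefinite_description _ (trace_counit_exists m n)) w.
Qed.

(** The defining property of the counit, extended from ⟨m,n⟩ to all d by cyclicity of both traces.
    Together with nondegeneracy of t it reduces equations for p to equations of transposes. *)
Lemma trace_cun_lact m n d (w : hom m (d ▷ n)) (g : hom d ⟨m, n⟩) :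
  t _ (w ∘ (p m n ∘ (g ▶ idm n))) = s _ (lflat H w ∘ g).
Proof.
rewrite compA tf_cyclic compA trace_cunP lflatN.
exact: tf_cyclic.
Qed.

Lemma trace_cun_nat m m' n n' (f : hom m m') (g : hom n' n) :
  p m' n' ∘ (linn_map H f g ▶ idm n') = f ∘ (p m n ∘ (idm _ ▶ g)).
Proof.
apply: (tf_inj (t := t)) => w; rewrite trace_cun_lact.
rewrite (compA w) (compA _ (p m n)) [RHS]tf_cyclic (compA (_ ▶ g)) trace_cunP.
congr (s _ _); apply: linn_inj.
rewrite lflat_lun lactm_idr -!compA linn_map_lun (compA (lflat H w ▶ _)).
by rewrite -lactm_swap -!compA (compA (lflat H w ▶ _)) lflat_lun.
Qed.

Lemma trace_cun_left d m n :
  p (d ▷ m) n ∘ (linn_left H d m n ▶ idm n)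
  = (idm d ▶ p m n) ∘ lassoc L d _ n.
Proof.
apply: (tf_inj (t := t)) => w; rewrite trace_cun_lact.
set v := lflat H w ∘ linn_left H d m n.
have wE : w = (v ▶ idm n) ∘ (lassoc' L d _ n ∘ (idm d ▶ u m n)).
  by rewrite /v lactm_idr -!compA linn_left_lun lflat_lun.
rewrite compA [RHS]tf_cyclic compA trace_lact trace_cunP.
(* Closing up d on the left preserves the left trace, whereas s is governed by the right one;
   sphericality passes between them. *)
have -> : s _ v = s _ (lptrace v).
  by apply: sP; rewrite -!sphD; exact: traceL_lptrace.
congr (s _ _); apply: linn_inj.
rewrite lflat_lun lptrace_lact -!compA -cupN [in RHS]wE !lactm_idl -!compA.
by [].
Qed.

Lemma linn_right_lun m n d :
  (linn_right H m n d ▶ idm (rdual d ▷ n))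
    ∘ (lassoc' L _ d _ ∘ ((idm _ ▶ cup L (coev d) n) ∘ u m n))
  = u m (rdual d ▷ n).
Proof.
rewrite linn_right_lact -!compA (compA (lassoc L ⟨m, n⟩ d _)) lassocV comp1m.
rewrite (compA (linn_right_aux H m n d ▶ _)) -lactm_swap -!compA.
rewrite linn_right_aux_lun (compA (idm _ ▶ cup L _ _)) -tenm1.
rewrite -lassoc'N -!compA (compA (lassoc L _ (rdual d) _)) lassocV comp1m.
by rewrite compA -lactm_idl ev_coev lactm1 comp1m.
Qed.

Lemma trace_cun_right m n d :
  p m (rdual d ▷ n) ∘ (linn_right H m n d ▶ idm _)
  = p m n ∘ ((idm _ ▶ cap L (evp d) n) ∘ lassoc L _ d (rdual d ▷ n)).
Proof.
apply: (tf_inj (t := t)) => w; rewrite trace_cun_lact.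
rewrite compA [RHS]tf_cyclic compA trace_cunP.
set v := lflat H w ∘ linn_right H m n d.
have -> : s _ v = s _ (ptrace v) by apply: sP; exact: traceR_ptrace.
congr (s _ _); apply: linn_inj.
rewrite lflat_lun ptrace_lact -!compA; congr (_ ∘ (_ ∘ _)).
by rewrite /v lactm_idr -!compA linn_right_lun lflat_lun.
Qed.

Lemma trace_cun_bij m n d :
  bijective (fun g : hom d ⟨m, n⟩ => p m n ∘ (g ▶ idm n)).
Proof.
have inj : injective (fun g : hom d ⟨m, n⟩ => p m n ∘ (g ▶ idm n)).
  move=> g g' /= E; apply: (tf_inj (t := s)) => f.
  by rewrite -[f](lsharpK (l := H)) -!trace_cun_lact E.
have surj h : exists g : hom d ⟨m, n⟩, p m n ∘ (g ▶ idm n) = h.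
  have [|g gE] := tf_perfect s (x := d) (y := ⟨m, n⟩)
      (phi := fun f => t _ (lsharp H f ∘ h)).
    move=> a f f'; rewrite !lsharpE lactmDl lactmZl !compDl !compZl.
    by rewrite tf_linear.
  exists g; apply: (tf_inj (t := t)) => w.
  by rewrite trace_cun_lact gE lflatK.
pose inv h := proj1_sig (constructive_indefinite_description _ (surj h)).
have invK h : p m n ∘ (inv h ▶ idm n) = h.
  exact: proj2_sig (constructive_indefinite_description _ (surj h)).
by exists inv => [g|h] //; apply: inj; rewrite invK.
Qed.

Definition trace_counit : counit H :=
  Counit trace_cun_nat trace_cun_left trace_cun_right trace_cun_bij.

End TraceCounit.

(** * Balancing with respect to the other action *)

Section Balance.
Variables (k : fieldType) (D C : pivcat k) (M : lincat k) (B : biaction D C M).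
Local Notation L := (ba_l B).
Local Notation R := (ba_r B).
Local Notation "d ▷ m" := (lact L d m) (at level 38, right associativity).
Local Notation "f ▶ g" := (lactm L f g) (at level 38, right associativity).
Local Notation "m ◁ c" := (ract R m c) (at level 40, left associativity).
Local Notation "f ◀ g" := (ractm R f g) (at level 40, left associativity).
Implicit Types (d x y : D) (c : C) (m n p : M).

Lemma ractm_idr m m' m'' c (g : hom m' m'') (f : hom m m') :
  (g ∘ f) ◀ idm c = (g ◀ idm c) ∘ (f ◀ idm c).
Proof. by rewrite -ractmM comp1m. Qed.

Lemma cap_ract x y (h : hom (x ⊗ y) (one D)) p c :
  cap L h (p ◁ c) ∘ ((idm x ▶ bassoc B y p c) ∘ bassoc B x (y ▷ p) c)
  = cap L h p ◀ idm c.
Proof.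
have E : lassoc' L x y (p ◁ c) ∘ ((idm x ▶ bassoc B y p c) ∘ bassoc B x (y ▷ p) c)
    = bassoc B (x ⊗ y) p c ∘ (lassoc' L x y p ◀ idm c).
  apply: (iso_monoI (lassoc_is_iso L x y (p ◁ c))).
  rewrite compA lassocV comp1m compA bact_pentagonl -!compA -ractm_idr lassocV.
  by rewrite ractm1 compm1.
rewrite !capE -!compA E (compA (h ▶ _)) -ractm1 -bassocN -!compA.
rewrite (compA (lunit L _)) bact_trianglel -!ractm_idr.
by [].
Qed.

Lemma rannihil_lact x n c :
  rannihil B (x ▷ n) c = (idm x ▶ rannihil B n c)
    ∘ (bassoc B x (n ◁ rdual c) c ∘ (bassoc B x n (rdual c) ◀ idm c)).
Proof.
rewrite /rannihil !lactm_idl -!compA.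
rewrite [X in _ = _ ∘ (_ ∘ X)]compA -bact_pentagonr (compA (idm x ▶ (_ ◀ _))).
rewrite -bassocN -!compA (compA (idm x ▶ runit _ _)) bact_triangler lactm1.
by [].
Qed.

(** The evaluation [evp c] acting from the right: it kills c followed by c^*, as [rannihil] kills
    c^* followed by c. *)
Definition rannihil_piv m c : hom (m ◁ c ◁ rdual c) m :=
  rannihil B m (rdual c) ∘ (idm m ◀ piv c ◀ idm (rdual c)).

Variable H : linner L.
Local Notation "⟨ m , n ⟩" := (linn H m n).
Local Notation u := (lun_inn H).

Lemma linn_balance_lun m c n :
  (linn_balance (B:=B) H m c n ▶ idm n) ∘ u (m ◁ c) n
  = (idm _ ▶ rannihil B n c) ∘ (bassoc B _ _ c ∘ (u m (n ◁ rdual c) ◀ idm c)).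
Proof. by rewrite lflat_lun -!compA. Qed.

Lemma linn_dual_balance_lun m c n :
  ((linn_map H (idm n) (idm m ◀ piv c) ∘ linn_balance (B:=B) H n (rdual c) m) ▶ idm m)
    ∘ u (n ◁ rdual c) m
  = (idm _ ▶ rannihil_piv m c) ∘ (bassoc B _ _ (rdual c)
      ∘ (u n (m ◁ c) ◀ idm (rdual c))).
Proof.
rewrite lactm_idr -compA linn_balance_lun (compA (linn_map H _ _ ▶ _)).
rewrite -lactm_swap -!compA -ractm1 (compA (linn_map H _ _ ▶ _)) -bassocN -!compA.
rewrite -ractm_idr linn_map_lun compm1 ractm_idr (compA (bassoc B _ _ _)).
by rewrite bassocN /rannihil_piv lactm_idl -!compA.
Qed.

(** The balancing condition read in M: as for naturality, the dual and the inner hom are removed by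
    [ev_inj] and [pairing_act_inj]. *)
Lemma counit_balanced (psi : counit H) :
  (forall m c n, psi m (n ◁ rdual c) ∘ (linn_balance (B:=B) H m c n ▶ idm _)
    = rannihil_piv m c ∘ ((psi (m ◁ c) n ◀ idm (rdual c)) ∘ bassoc' B _ n _)) ->
  lbalanced (linn_balance (B:=B) H) (linn_dual_balance (B:=B) H) (counit_lpairing_iso psi).
Proof.
move=> psiB m c n; apply: ev_inj; rewrite ev_rcurry ev_slide.
rewrite [counit_lpairing_iso psi _ _]/= -[counit_iso psi (m ◁ c) n]compm1 ev_rcurry.
apply: pairing_act_inj; rewrite pairing_act_form psiB.
rewrite /pairing_act cap_ten -compA -lactm_idl compm1.
rewrite linn_dual_balance_lun [linn_pairing _ _ _]/=.
rewrite (lactm_idl L _ (idm _ ▶ rannihil_piv m c)) (lactm_idl L _ (bassoc B _ _ _)).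
rewrite (compA (cap L (counit_form _ _ _) _)) capN -[RHS]compA.
congr (rannihil_piv m c ∘ _).
rewrite -[idm _ ▶ (u _ _ ◀ _)]compm1 -(bassocV B) (compA (_ ▶ (u _ _ ◀ _))).
rewrite -bassocN -!compA (compA (idm _ ▶ bassoc _ _ _ _)) (compA (cap L _ _)).
rewrite cap_ract compA -(ractm_idr _ (cap L _ _)).
by rewrite -/(pairing_act _) act_pairingK.
Qed.

Variables (t : trace_form M) (s : trace_form D).
Hypothesis sP : forall (x y : D) (f : hom x x) (g : hom y y),
  traceR f = traceR g -> s _ f = s _ g.
Hypothesis sphD : spherical D.
Hypothesis tL : trace_adjoint t L.
Hypothesis tR : @trace_adjoint k (revp C) M t (ractl R).

Lemma trace_adjoint_ract c n m (h : hom n (m ◁ c)) (g : hom m (n ◁ rdual c)) :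
  t _ (rannihil B n c ∘ ((g ◀ idm c) ∘ h))
  = t _ (g ∘ (rannihil_piv m c ∘ (h ◀ idm (rdual c)))).
Proof.
have := @tR c n m h g; rewrite evq_rev !capE /= => ->.
congr (t _ (_ ∘ (_ ∘ _))); rewrite evpE /rannihil_piv /rannihil -!compA.
by rewrite rassocN (compA (idm m ◀ _)) -ractmM comp1m.
Qed.

(** Tested against w, both sides become values of s on endomorphisms of ⟨m ◁ c, n⟩, once
    [trace_adjoint_ract] has moved c^* across the trace; the endomorphisms agree by the definition
    of [linn_balance]. *)
Lemma trace_counit_balanced : lbalanced (linn_balance (B:=B) H) (linn_dual_balance (B:=B) H)
  (counit_lpairing_iso (trace_counit sP sphD tL H)).
Proof.
apply: counit_balanced => m c n; apply: (tf_inj (t := t)) => w.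
rewrite trace_cun_lact.
set q := trace_counit _ _ _ _ _ _.
rewrite (compA (rannihil_piv m c)) (compA w) [RHS]tf_cyclic (compA _ w).
rewrite -trace_adjoint_ract compA trace_cunP; congr (s _ _).
apply: linn_inj; rewrite lflat_lun lactm_idr -compA linn_balance_lun.
rewrite rannihil_lact (compA (lflat H w ▶ _)) -lactm_swap -!compA -ractm1.
rewrite (compA (lflat H w ▶ _)) -bassocN -!compA -ractm_idr lflat_lun.
rewrite ractm_idr (compA (bassoc B _ _ _ ◀ _)) -ractm_idr.
by rewrite bassocV ractm1 comp1m.
Qed.

End Balance.

(** * The trace form of a bimodule trace *)

Section BimoduleTrace.
Variables (k : fieldType) (D C : pivcat k) (M : lincat k) (B : biaction D C M).
Local Notation L := (ba_l B).
Local Notation R := (ba_r B).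
Local Notation "d ▷ m" := (lact L d m) (at level 38, right associativity).
Local Notation "f ▶ g" := (lactm L f g) (at level 38, right associativity).
Local Notation "m ◁ c" := (ract R m c) (at level 40, left associativity).
Local Notation "f ◀ g" := (ractm R f g) (at level 40, left associativity).
Variable T : bimodule_trace B.

(** By naturality the value of [btr] at f and g depends only on either composite, and is recovered
    from this trace on endomorphisms. *)
Definition btr_id (m : M) (f : hom m m) : k := btr T m m (idm m) f.

Lemma btr_id_compr (n m : M) (f : hom n m) (g : hom m n) :
  btr T n m f g = btr_id (g ∘ f).
Proof.
by rewrite /btr_id -[f in LHS]compm1 -[f ∘ _]compm1 btr_nat comp1m.
Qed.

Lemma btr_id_compl (n m : M) (f : hom n m) (g : hom m n) :
  btr T n m f g = btr_id (f ∘ g).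
Proof.
by rewrite /btr_id -[f in LHS]comp1m -[idm m in LHS]comp1m btr_nat compm1.
Qed.

Fact btr_id_linear m a (f g : hom m m) :
  btr_id (a *: f + g) = a * btr_id f + btr_id g.
Proof. by rewrite /btr_id linearP. Qed.

Fact btr_id_cyclic (n m : M) (f : hom n m) (g : hom m n) :
  btr_id (g ∘ f) = btr_id (f ∘ g).
Proof. by rewrite -btr_id_compr btr_id_compl. Qed.

Fact btr_id_nondegenerate (n m : M) (g : hom n m) :
  (forall f : hom m n, btr_id (f ∘ g) = 0) -> g = 0.
Proof.
move=> g0; apply: (bij_inj (btr_bij T n m)); apply/lfunP => f.
by rewrite btr_id_compr g0 linear0 lfunE.
Qed.

Definition btr_form : trace_form M :=
  TraceForm btr_id_linear btr_id_cyclic btr_id_nondegenerate.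

Lemma btr_adjoint_left : trace_adjoint btr_form L.
Proof.
move=> d n m h g /=.
(* f is chosen so that its mate is h, and g' is g transported along ^*d = d^*. In [lmate_piv] the
   pivotal structure then cancels against [piv_lr], which leaves [ev' d]. *)
pose f := cap L (ev d) m ∘ (idm (rdual d) ▶ h).
pose g' := (piv_lr d ▶ idm n) ∘ g.
have fh : lmate f = h.
  rewrite /lmate -!compA (compA (lassoc L _ _ _)) -cupE /f lactm_idl -compA cupN.
  by rewrite compA coev_ev comp1m.
have := btr_left T f g'; rewrite !btr_id_compr fh => E.
transitivity (btr_id (lmate_piv g' ∘ h)).
  congr (btr_id _); rewrite /lmate_piv compA; congr (_ ∘ _).
  rewrite -capE [piv d ▶ g']lactmE /g' lactm_idl !compA -cap_evp.
  congr (_ ∘ _); rewrite -[ev' d]compm1 -tenm1 -evp_piv_lr cap_ten compm1.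
  by [].
rewrite E /g' [LHS]btr_id_cyclic compA btr_id_cyclic; congr (btr_id (g ∘ _)).
rewrite /f -!compA -[evq d]compm1 -tenm1 -ev_piv_lr compm1 cap_ten lactm1.
by rewrite -!compA lactm_swap.
Qed.

(** A snake identity for the right action, obtained as [coev'_ev'] for the left action of the
    reversed category. *)
Lemma rannihil_rcreate n m (x : C) (v : hom n (m ◁ rdual x)) :
  (rannihil B m x ∘ (v ◀ idm x)) ◀ idm (rdual x) ∘ rcreate R n x = v.
Proof.
have E1 : rannihil B m x = cap (ractl R : laction (revp C) M) (ev' (r := revp C) x) m.
  by rewrite capE.
have E2 p : rcreate R p x = cup (ractl R : laction (revp C) M) (coev' (r := revp C) x) p.
  by rewrite cupE.
rewrite ractm_idr -compA E2 [X in _ ∘ X](cupN (ractl R)) compA E1.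
have := coev'_ev' (ractl R : laction (revp C) M) m x => ->.
by rewrite comp1m.
Qed.

Lemma btr_adjoint_ract (c : C) n m (h : hom n (m ◁ c)) (g : hom m (n ◁ rdual c)) :
  btr_id (rannihil B n c ∘ ((g ◀ idm c) ∘ h))
  = btr_id (g ∘ (rannihil_piv B m c ∘ (h ◀ idm (rdual c)))).
Proof.
rewrite -[RHS]btr_id_compr -(btr_right T) btr_id_compr.
set f := rannihil_piv _ _ _ ∘ _.
have -> : rmate f = (idm m ◀ piv c) ∘ h.
  rewrite /f /rannihil_piv -[_ ∘ _ ∘ (h ◀ _)]compA -ractm_idr.
  exact: rannihil_rcreate.
(* [rmate] has contributed a factor [piv c] and [rmate_piv] its inverse; they cancel. *)
congr (btr_id _); rewrite /rmate_piv -(compA (rannihil B n c)).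
by rewrite (compA (g ◀ _)) -ractmM compm1 (pivK c).1.
Qed.

Lemma btr_adjoint_right : @trace_adjoint k (revp C) M btr_form (ractl R).
Proof.
move=> c n m h g; rewrite evq_rev !capE /=.
have := @btr_adjoint_ract c n m h g; rewrite /rannihil !compA => ->.
congr (btr_id (_ ∘ _)); rewrite evpE /rannihil_piv /rannihil -!compA.
by rewrite rassocN (compA (idm m ◀ _)) -ractmM comp1m.
Qed.

End BimoduleTrace.

Lemma spherical_rev (k : fieldType) (C : pivcat k) :
  spherical C -> spherical (revp C).
Proof.
move=> sphC x f; rewrite -(@traceL_rev k C x f) sphC traceLE traceRE.
by rewrite evq_rev.
Qed.

(** * The right inner product obtained by reversal *)

Section RightFromLeft.
Variables (k : fieldType) (D C : pivcat k) (M : lincat k) (B : biaction D C M).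
Local Notation L := (ba_l B).
Local Notation R := (ba_r B).
Local Notation B' := (revb B : biaction (revp C) (revp D) M).
Variable H' : linner (ba_l B').

Definition rinner_of : rinner R :=
  @Rinner k C M R (fun n m => linn H' m n) (fun n m => @lflat _ _ _ _ H' m n)
    (fun n m => @lsharp _ _ _ _ H' m n) (fun n m => @lflatK _ _ _ _ H' m n)
    (fun n m => @lsharpK _ _ _ _ H' m n) (fun n m => @lflatN _ _ _ _ H' m n).

Variable e : lpairing_iso (linn_pairing H') (linn_dual_pairing H').

Let rpi_of n m : hom (rinn rinner_of n m) (ldual (rinn rinner_of m n)) := e m n.

Fact rinner_of_left c n m :
  rpi_of (ract R n (ldual c)) m ∘ rinn_left rinner_of c n m
  = rinn_dual_left rinner_of c n m ∘ (idm c ⊠ rpi_of n m).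
Proof.
have := lpi_right e m n c; rewrite /= /linn_dual_right /rdual_ten nest_rev.
exact.
Qed.

Fact rinner_of_right n m c :
  rpi_of n (ract R m c) ∘ rinn_right rinner_of n m c
  = rinn_dual_right rinner_of n m c ∘ (rpi_of n m ⊠ idm c).
Proof.
have := lpi_left e c m n; rewrite /= /linn_dual_left nest_rev.
exact.
Qed.

Definition rpairing_iso_of :
    rpairing_iso (rinn_pairing rinner_of) (rinn_dual_pairing rinner_of) :=
  @RpairingIso k C M R (rinn_pairing rinner_of) (rinn_dual_pairing rinner_of)
    rpi_of (fun n m => lpi_iso e m n)
    (fun n n' m m' g f => lpi_nat e f g) rinner_of_left rinner_of_right.

Lemma rbalanced_of :
  lbalanced (linn_balance (B := B') H') (linn_dual_balance (B := B') H') e ->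
  rbalanced (rinn_balance (B := B) rinner_of) (rinn_dual_balance (B := B) rinner_of)
    rpairing_iso_of.
Proof. by move=> eB n d m; exact: (eB m d n). Qed.

End RightFromLeft.

(** Stated for an arbitrary trace with both adjunction properties, so that it applies to [B] and to
    its reversal with the same trace on M. *)
Lemma trace_left_inner_product (k : fieldType) (D C : pivcat k) (M : lincat k)
    (B : biaction D C M) (t : trace_form M) :
  fusion D -> spherical D -> lact_exact (ba_l B) -> trace_adjoint t (ba_l B) ->
  @trace_adjoint k (revp C) M t (ractl (ba_r B)) ->
  exists (H : linner (ba_l B))
    (e : lpairing_iso (linn_pairing H) (linn_dual_pairing H)),
    lbalanced (linn_balance (B := B) H) (linn_dual_balance (B := B) H) e.
Proof.
move=> fusD sphD exL tL tR.
have [s sP] := fusion_trace_form fusD.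
have [H] := linner_exists fusD.1.1 fusD.2 exL.
exists H, (counit_lpairing_iso (trace_counit sP sphD tL H)).
exact: trace_counit_balanced.
Qed.

Theorem theorem1p4 (k : fieldType) :
  (forall (C : pivcat k) (A : frobalg C),
     finite_tensor C -> frob_special A -> frob_symmetric A ->
     inner_product_module_category (rmod_laction A)) /\
  (forall (D C : pivcat k) (M : lincat k) (B : biaction D C M),
     fusion D -> spherical D -> fusion C -> spherical C ->
     bimodule_category B -> semisimple M -> bimodule_trace B ->
     inner_product_bimodule_category B).
Proof.
split=> [C A [finC _] spA symA|D C M B fusD sphD fusC sphC bimB _ T].
  split; first exact: rmod_module_category.
  apply: rmod_inner_product => // x p pp.
  have [abC _ _ _] := finC; exact: idempotent_splits.
split=> //; have [_ exL exR] := bimB.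
have tL := btr_adjoint_left T; have tR := btr_adjoint_right T.
have [H [e eB]] := trace_left_inner_product fusD sphD exL tL tR.
(* Reversing D twice rebuilds its pivotal structure through [piv_ll], so the two structures have to
   be compared: [evq_rev] and [evp_rev] show that [evq] is the same for both. *)
have tL' : @trace_adjoint k (revp (revp D)) M (btr_form T)
    (ractl (lactr (ba_l B))).
  by move=> d n m h g; have := tL d n m h g; rewrite !evq_rev evp_rev !capE.
have [H' [e' eB']] := @trace_left_inner_product k (revp C) (revp D) M (revb B)
  (btr_form T) fusC (spherical_rev sphC) exR tR tL'.
constructor; exact: (@InnerProductBi k D C M B H e eB (rinner_of H')
  (rpairing_iso_of e') (rbalanced_of eB')).
Qed.
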